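(* For each irreducible root system $\Delta$, the set $\mathcal A(\Delta)$ of amazing roots is as follows (with the coordinates and the numbering of simple roots fixed in the context, $[c_1\dots c_n]$ denoting $\sum_i c_i\alpha_i$, and $\theta$ the highest root): (1) $\mathcal A(A_n)=\Delta^+=\{\varepsilon_i-\varepsilon_j\mid 1\le i<j\le n+1\}$ for $n\ge 1$; (2) $\mathcal A(B_n)=\{\varepsilon_1-\varepsilon_2\}\cup\{\varepsilon_1+\varepsilon_j\mid 2\le j\le n\}\cup\{\varepsilon_i+\varepsilon_{i+1}\mid 2\le i\le n-1\}$ for $n\ge 3$; (3) $\mathcal A(C_n)=\Delta^+_l=\{2\varepsilon_1,\dots,2\varepsilon_n\}$ for $n\ge 2$; (4) $\mathcal A(D_n)=\{\varepsilon_1-\varepsilon_2,\ \varepsilon_1-\varepsilon_n,\ \varepsilon_{n-1}-\varepsilon_n\}\cup\{\varepsilon_1+\varepsilon_j\mid 2\le j\le n\}\cup\{\varepsilon_i+\varepsilon_{i+1}\mid 2\le i\le n-1\}$ for $n\ge 4$; (5) $\mathcal A(E_6)=\{\alpha_1,\ \alpha_5,\ [111110],\ [122101],\ [012211],\ [112211],\ [122111],\ [122211],\ [123211],\ [123212]=\theta\}$; (6) $\mathcal A(E_7)=\{\alpha_1,\ [1222101],\ [0123212],\ [1123212],\ [1233211],\ [1223212],\ [1233212],\ [1234212],\ [1234312],\ [1234322]=\theta\}$; (7) $\mathcal A(E_8)=\{[01234322],\ [12345313],\ [12345422],\ [12345323],\ [12345423],\ [12346423],\ [12356423],\ [12456423],\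 [13456423],\ [23456423]=\theta\}$; (8) $\mathcal A(F_4)=\{[2210],\ [2421],\ [2431],\ [2432]=\theta\}$; (9) $\mathcal A(G_2)=\{[31],\ [32]=\theta\}$.
   Context: Let $\Delta$ be an irreducible (reduced, crystallographic) root system, the root system of a simple complex Lie algebra, with positive roots $\Delta^+$, simple roots $\Pi=\{\alpha_1,\dots,\alpha_n\}$, highest root $\theta$, and Weyl group $W$. $\Delta^+_l$ is the set of long positive roots (all roots are long in the simply-laced case). The partial order on $\Delta^+$: $\mu\preccurlyeq\nu$ if $\nu-\mu$ is a non-negative integral combination of simple roots. An upper ideal is a subset $I\subset\Delta^+$ such that $\nu\in I$, $\gamma\in\Delta^+$, $\nu\preccurlyeq\gamma$ imply $\gamma\in I$. An abelian ideal is an upper ideal $I$ with $\gamma'+\gamma''\notin\Delta^+$ for all $\gamma',\gamma''\in I$. For $\gamma\in\Delta^+$ put $I\langle\succcurlyeq\gamma\rangle=\{\nu\in\Delta^+\mid\nu\succcurlyeq\gamma\}$. Rootlets. Let $V$ be the real span of $\Delta$ and consider $V\oplus\mathbb R\delta$. The real affine roots are $\gamma+k\delta$ ($\gamma\in\Delta$, $k\in\mathbb Z$); the positive ones $\widehat\Delta^+$ are those with $k\ge 1$, or $k=0$ and $\gamma\in\Delta^+$. The affine Weyl group $\widehat W$ is generated by the reflections $s_{\gamma+k\delta}$, acting by $s_{\gamma+k\delta}(\beta+m\delta)=s_\gamma(\beta)+(m-k\langle\beta,\gamma^\vee\rangle)\delta$ (so $\widehat W$ fixes $\delta$). For $w\in\widehat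 W$ let $N(w)=\{\nu\in\widehat\Delta^+\mid w(\nu)\in-\widehat\Delta^+\}$. It is known (Peterson) that for each abelian ideal $I$ there is a unique $w_I\in\widehat W$ with $N(w_I)=\{\delta-\gamma\mid\gamma\in I\}$. For a nonempty abelian ideal $I$, its rootlet is $\mathrm{rt}(I)=w_I(2\delta-\theta)$; it is known to be an element of $\Delta^+_l$, and every element of $\Delta^+_l$ is the rootlet of some nonempty abelian ideal. For $\mu\in\Delta^+_l$, the set of nonempty abelian ideals with rootlet $\mu$, ordered by inclusion, is known to have a unique maximal element, denoted $I(\mu)_{\max}$. A root $\gamma\in\Delta^+_l$ is amazing if $I(\gamma)_{\max}=I\langle\succcurlyeq\gamma\rangle$; the set of amazing roots is $\mathcal A=\mathcal A(\Delta)$. Coordinates and numbering. $A_n$: $\alpha_i=\varepsilon_i-\varepsilon_{i+1}$ ($1\le i\le n$). $B_n$: $\alpha_i=\varepsilon_i-\varepsilon_{i+1}$ ($i<n$), $\alpha_n=\varepsilon_n$. $C_n$: $\alpha_i=\varepsilon_i-\varepsilon_{i+1}$ ($i<n$), $\alpha_n=2\varepsilon_n$. $D_n$: $\alpha_i=\varepsilon_i-\varepsilon_{i+1}$ ($i<n$), $\alpha_n=\varepsilon_{n-1}+\varepsilon_n$. $E_6$: the Dynkin diagram is the chain $\alpha_1-\alpha_2-\alpha_3-\alpha_4-\alpha_5$ with $\alpha_6$ attached to $\alpha_3$. $E_7$: the chain $\alpha_1-\cdots-\alpha_6$ with $\alpha_7$ attached to $\alpha_4$. $E_8$: the chain $\alpha_1-\cdots-\alpha_7$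 with $\alpha_8$ attached to $\alpha_5$. $F_4$: the chain $\alpha_1-\alpha_2-\alpha_3-\alpha_4$ with $\alpha_1,\alpha_2$ short and $\alpha_3,\alpha_4$ long. $G_2$: $\alpha_1$ short, $\alpha_2$ long. *)

(* Defs.v *)
From mathcomp Require Import all_boot all_order all_algebra.
From mathcomp Require Import all_classical.

Set Implicit Arguments.
Unset Strict Implicit.
Unset Printing Implicit Defensive.

Import Order.TTheory GRing.Theory Num.Theory.

Local Open Scope classical_set_scope.
Local Open Scope ring_scope.

Section RootSystems.

Variables (R : realFieldType) (m : nat).
Local Notation V := 'rV[R]_m.

Definition dot (u v : V) : R := \sum_(i < m) u 0 i * v 0 i.

(* <b, c^v> = 2 (b, c) / (c, c) *)
Definition cartan (b c : V) : R := 2 * dot b c / dot c c.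

Definition refl (c v : V) : V := v - cartan v c *: c.

(* D is a root system in its linear span, which may be smaller than the ambient
   space: type A_n is usually realized in R^(n+1). *)
Record root_system (D : set V) : Prop := RootSystem {
  rs_finite : finite_set D;
  rs_nonzero : ~ D 0;
  rs_refl : forall b c, D b -> D c -> D (refl c b);
  rs_crystallographic :
    forall b c, D b -> D c -> exists k : int, cartan b c = k%:~R;
  rs_reduced : forall (a : R) c, D c -> D (a *: c) -> a = 1 \/ a = -1 }.

Definition irreducible (D : set V) : Prop :=
  D !=set0 /\
  forall A B : set V, A `|` B = D ->
    (forall a b, A a -> B b -> dot a b = 0) -> A = set0 \/ B = set0.

(* The ordered list of simple roots alpha_1, ..., alpha_n is a sequence P, with
   alpha_i = P`_i.-1; comb P [:: c_1; ...; c_n] is sum_i c_i alpha_i. *)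
Definition comb (P : seq V) (c : seq nat) : V :=
  \sum_(i < size P) P`_i *+ nth 0%N c i.

Definition nonneg (P : seq V) (v : V) : Prop := exists c : seq nat, v = comb P c.

Record simple_roots (D : set V) (P : seq V) : Prop := SimpleRoots {
  sr_root : forall a, a \in P -> D a;
  sr_free : free P;
  sr_sign : forall c, D c -> nonneg P c \/ nonneg P (- c) }.

Definition positive (D : set V) (P : seq V) : set V :=
  [set c | D c /\ nonneg P c].

Definition root_le (P : seq V) (u v : V) : Prop := nonneg P (v - u).

Definition highest_root (D : set V) (P : seq V) (theta : V) : Prop :=
  positive D P theta /\ forall c, positive D P c -> root_le P c theta.

(* In an irreducible D the long roots are those of maximal length, which are
   all roots when D is simply laced. *)
Definition long_positive (D : set V) (P : seq V) : set V :=
  [set c | positive D P c /\ forall b, D b -> dot b b <= dot c c].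

Definition upper_ideal (D : set V) (P : seq V) (I : set V) : Prop :=
  I `<=` positive D P /\
  forall u v, I u -> positive D P v -> root_le P u v -> I v.

Definition abelian_ideal (D : set V) (P : seq V) (I : set V) : Prop :=
  upper_ideal D P I /\ forall u v, I u -> I v -> ~ positive D P (u + v).

Definition ideal_above (D : set V) (P : seq V) (c : V) : set V :=
  [set v | positive D P v /\ root_le P c v].

(* The vector v + t delta is the pair (v, t) : V * R. *)
Definition affine_positive (D : set V) (P : seq V) : set (V * R) :=
  [set x | exists c (k : int),
     [/\ x = (c, k%:~R), D c & (1 <= k) \/ (k = 0 /\ positive D P c)]].

Definition affine_refl (c : V) (k : int) (x : V * R) : V * R :=
  (refl c x.1, x.2 - k%:~R * cartan x.1 c).

(* Reflections are involutions, so the group they generate consists of their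
   finite compositions. *)
Inductive affine_weyl (D : set V) : (V * R -> V * R) -> Prop :=
| AffineWeyl_id : affine_weyl D id
| AffineWeyl_refl c k w :
    D c -> affine_weyl D w -> affine_weyl D (affine_refl c k \o w).

Definition inversions (D : set V) (P : seq V) (w : V * R -> V * R) :
    set (V * R) :=
  [set x | affine_positive D P x /\ affine_positive D P (- w x)].

(* w is the element w_I: (- c, 1) is delta - c. *)
Definition peterson (D : set V) (P : seq V) (I : set V) (w : V * R -> V * R) :
    Prop :=
  affine_weyl D w /\ inversions D P w = [set (- c, 1) | c in I].

(* rt(I) = w_I (2 delta - theta) = mu *)
Definition rootlet (D : set V) (P : seq V) (I : set V) (mu : V) : Prop :=
  exists w theta,
    [/\ peterson D P I w, highest_root D P theta & w (- theta, 2) = (mu, 0)].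

Definition ideals_with_rootlet (D : set V) (P : seq V) (mu : V) :
    set (set V) :=
  [set I | [/\ abelian_ideal D P I, I !=set0 & rootlet D P I mu]].

Definition maximal_in (S : set (set V)) (I : set V) : Prop :=
  S I /\ forall J, S J -> I `<=` J -> J = I.

(* I = I(mu)_max, the unique maximal nonempty abelian ideal of rootlet mu *)
Definition is_Imax (D : set V) (P : seq V) (mu : V) (I : set V) : Prop :=
  unique (maximal_in (ideals_with_rootlet D P mu)) I.

Definition amazing (D : set V) (P : seq V) : set V :=
  [set c | long_positive D P c /\ is_Imax D P c (ideal_above D P c)].

(* e 1, ..., e N is an orthonormal family up to a common scaling factor, so that
   root systems need not be rescaled to fit the standard coordinates. *)
Definition coordinates (N : nat) (e : nat -> V) : Prop :=
  exists2 a : R, 0 < a &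
    forall i j, (1 <= i <= N)%N -> (1 <= j <= N)%N ->
      dot (e i) (e j) = if i == j then a else 0.

Definition simple_A (e : nat -> V) (n : nat) : seq V :=
  [seq e i - e i.+1 | i <- iota 1 n].

Definition simple_B (e : nat -> V) (n : nat) : seq V :=
  rcons [seq e i - e i.+1 | i <- iota 1 n.-1] (e n).

Definition simple_C (e : nat -> V) (n : nat) : seq V :=
  rcons [seq e i - e i.+1 | i <- iota 1 n.-1] (e n *+ 2).

Definition simple_D (e : nat -> V) (n : nat) : seq V :=
  rcons [seq e i - e i.+1 | i <- iota 1 n.-1] (e n.-1 + e n).

(* The Dynkin diagram on nodes 1, ..., size d, with edges E (unordered pairs)
   and relative squared root lengths d. Adjacent simple roots satisfy
   2 (alpha_i, alpha_j) = - max(|alpha_i|^2, |alpha_j|^2), whence the Cartan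
   integer <alpha_i, alpha_j^v> = - max(d_i, d_j) / d_j. *)
Definition dynkin_cartan (d : seq nat) (E : seq (nat * nat)) (i j : nat) : int :=
  let di := nth 0%N d i.-1 in
  let dj := nth 0%N d j.-1 in
  if i == j then 2
  else if ((i, j) \in E) || ((j, i) \in E) then - (maxn di dj %/ dj)%N%:Z
  else 0.

Definition dynkin (d : seq nat) (E : seq (nat * nat)) (P : seq V) : Prop :=
  size P = size d /\
  forall i j, (1 <= i <= size d)%N -> (1 <= j <= size d)%N ->
    cartan P`_i.-1 P`_j.-1 = (dynkin_cartan d E i j)%:~R.

Definition chain (k : nat) : seq (nat * nat) :=
  [seq (i, i.+1) | i <- iota 1 k.-1].

Definition type_E6 : seq V -> Prop := dynkin (nseq 6 1%N) ((3, 6)%N :: chain 5).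

Definition type_E7 : seq V -> Prop := dynkin (nseq 7 1%N) ((4, 7)%N :: chain 6).

Definition type_E8 : seq V -> Prop := dynkin (nseq 8 1%N) ((5, 8)%N :: chain 7).

Definition type_F4 : seq V -> Prop := dynkin [:: 1; 1; 2; 2]%N (chain 4).

Definition type_G2 : seq V -> Prop := dynkin [:: 1; 3]%N (chain 2).

Definition irreducible_root_system (D : set V) (P : seq V) : Prop :=
  [/\ root_system D, irreducible D & simple_roots D P].

End RootSystems.

(* Main.v *)
(* Call H the set of positive roots b with (b, theta) > 0, and let delta be the
   imaginary root. Removing a minimal element c from an abelian ideal I
   replaces w_I by s_a w_I, where a = - w_I (delta - c) is a simple affine root,
   and adding an element works in the same way. Only the elements of H move
   w_I (2 delta - theta), and each one other than theta lowers its coroot height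
   by one. Hence I /\ H has 1 + ht(theta^v) - ht(rt(I)^v) elements, and an
   induction on I shows that they all lie above rt(I).

   Conversely, reflecting theta downwards in simple roots yields, for each long
   mu, an abelian ideal contained in H with rootlet mu; roots outside H may then
   be added without changing the rootlet. So a long root c such that the ideal
   I(>= c) is abelian and has 1 + ht(theta^v) - ht(c^v) elements in H is the
   rootlet of I(>= c), and it is amazing as soon as every positive root
   orthogonal to theta and not above c lies below an element of H which is not
   above c. The two conditions on I(>= c) are necessary for c to be amazing.

   What remains is combinatorial. In the classical types the order on roots is
   controlled by the functionals that are nonnegative on the simple roots (mostly
   partial sums of coordinates); in the exceptional types everything is evaluated
   on the lists of coefficients of the positive roots. *)
Require Import Defs.
From mathcomp Require Import all_boot all_order all_algebra.
From mathcomp Require Import all_classical.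
From mathcomp Require Import ring lra zify.

Import Order.TTheory GRing.Theory Num.Theory.

Local Open Scope classical_set_scope.
Local Open Scope ring_scope.


(** * Root systems *)

(** The difficulty is that [w_I] is given only by its inversion set, so it is followed along chains
    of ideals that differ by one root. That the Heisenberg part of an ideal lies above the rootlet
    does not propagate by itself: adjoining g lowers the rootlet from mu' to mu' - k al, and this
    must still be at most g. The missing information comes from the splitting 2 delta - theta =
    (delta - g) + (delta - (theta - g)). For ideals inside H the induction also records that, as
    long as g is outside the ideal, the second summand is sent to a finite vector that is at most g;
    this forces the simple affine root of the next step to be a finite simple root al. The coroot
    height drops by exactly one because k |al|^2 = <theta, g^v> |g|^2 = |theta|^2. Counting then
    decides equality: every ideal of rootlet c has its Heisenberg part inside I(>= c), and c
    prescribes the size of that part. So I(>= c) never has too few such elements, and having the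
    exact number identifies the two parts. *)

Section InnerProduct.

Context {R : realFieldType} {m : nat}.
Implicit Types (u v w c : 'rV[R]_m) (t : R).

Lemma dotC u v : dot u v = dot v u.
Proof. by apply: eq_bigr => i _; rewrite mulrC. Qed.

Lemma dotDl u v w : dot (u + v) w = dot u w + dot v w.
Proof. by rewrite -big_split; apply: eq_bigr => i _; rewrite mxE mulrDl. Qed.

Lemma dotZl t u v : dot (t *: u) v = t * dot u v.
Proof. by rewrite mulr_sumr; apply: eq_bigr => i _; rewrite mxE mulrA. Qed.

Lemma dotNl u v : dot (- u) v = - dot u v.
Proof. by rewrite -scaleN1r dotZl mulN1r. Qed.

Lemma dot0l v : dot 0 v = 0.
Proof. by rewrite -[0 in LHS](scale0r 0) dotZl mul0r. Qed.

Lemma dotBl u v w : dot (u - v) w = dot u w - dot v w.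
Proof. by rewrite dotDl dotNl. Qed.

Lemma dotMnl u v (n : nat) : dot (u *+ n) v = dot u v *+ n.
Proof. by rewrite -scaler_nat dotZl mulr_natl. Qed.

Lemma dotDr u v w : dot w (u + v) = dot w u + dot w v.
Proof. by rewrite dotC dotDl !(dotC w). Qed.

Lemma dotZr t u v : dot v (t *: u) = t * dot v u.
Proof. by rewrite dotC dotZl dotC. Qed.

Lemma dotNr u v : dot v (- u) = - dot v u.
Proof. by rewrite dotC dotNl dotC. Qed.

Lemma dotBr u v w : dot w (u - v) = dot w u - dot w v.
Proof. by rewrite dotDr dotNr. Qed.

Lemma dotMnr u v (n : nat) : dot v (u *+ n) = dot v u *+ n.
Proof. by rewrite dotC dotMnl dotC. Qed.

Lemma dotNN u : dot (- u) (- u) = dot u u.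
Proof. by rewrite dotNl dotNr opprK. Qed.

Lemma dot_suml (I : Type) (r : seq I) (Q : pred I) (F : I -> 'rV[R]_m) v :
  dot (\sum_(i <- r | Q i) F i) v = \sum_(i <- r | Q i) dot (F i) v.
Proof.
elim/big_rec2: _ => [|i x y _ IH]; first by rewrite dot0l.
by rewrite dotDl IH.
Qed.

Lemma dot_sqr_ge0 v : 0 <= dot v v.
Proof. by apply: sumr_ge0 => i _; rewrite -expr2 sqr_ge0. Qed.

Lemma dot_sqr_eq0 v : (dot v v == 0) = (v == 0).
Proof.
apply/eqP/eqP => [h|->]; last by rewrite dot0l.
apply/rowP => i; rewrite mxE; apply/eqP; rewrite -sqrf_eq0 expr2; apply/eqP.
by move: i (erefl true); apply/psumr_eq0P: h => j _; rewrite -expr2 sqr_ge0.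
Qed.

Lemma dot_sqr_gt0 v : (0 < dot v v) = (v != 0).
Proof. by rewrite lt_def dot_sqr_ge0 dot_sqr_eq0 andbT. Qed.

Lemma cartanDl u v c : cartan (u + v) c = cartan u c + cartan v c.
Proof. by rewrite /cartan dotDl; ring. Qed.

Lemma cartanZl t u c : cartan (t *: u) c = t * cartan u c.
Proof. by rewrite /cartan dotZl; ring. Qed.

Lemma cartanNl u c : cartan (- u) c = - cartan u c.
Proof. by rewrite -scaleN1r cartanZl mulN1r. Qed.

Lemma cartanBl u v c : cartan (u - v) c = cartan u c - cartan v c.
Proof. by rewrite cartanDl cartanNl. Qed.

Lemma cartanNr u c : cartan u (- c) = - cartan u c.
Proof. by rewrite /cartan !(dotNr, dotNl) opprK; ring. Qed.

Lemma cartanNN u c : cartan (- u) (- c) = cartan u c.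
Proof. by rewrite cartanNl cartanNr opprK. Qed.

Lemma cartan_self c : c != 0 -> cartan c c = 2.
Proof. by move=> c0; rewrite /cartan mulfK // dot_sqr_eq0. Qed.

Lemma cartan_dot u c : c != 0 -> cartan u c * dot c c = 2 * dot u c.
Proof. by move=> c0; rewrite /cartan mulfVK // dot_sqr_eq0. Qed.

Lemma cartan_gt0 u c : c != 0 -> (0 < cartan u c) = (0 < dot u c).
Proof.
move=> c0; have h := c0; rewrite -dot_sqr_gt0 in h.
by rewrite -(pmulr_lgt0 _ h) cartan_dot // pmulr_rgt0.
Qed.

Lemma reflE c v : refl c v = v - cartan v c *: c. Proof. by []. Qed.

Lemma refl_self c : c != 0 -> refl c c = - c.
Proof.
by move=> c0; rewrite reflE cartan_self // scaler_nat mulr2n opprD addNKr.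
Qed.

Lemma refl_dot c u v : c != 0 -> dot (refl c u) (refl c v) = dot u v.
Proof.
move=> c0; rewrite !reflE !(dotBl, dotBr, dotZl, dotZr) (dotC c v).
have hv := cartan_dot v c c0.
have h : cartan v c * dot u c = cartan u c * dot v c by rewrite /cartan; ring.
move: (cartan v c) (cartan u c) hv h => p q hv h.
by rewrite hv h; ring.
Qed.

End InnerProduct.

(** * Nonnegative combinations of simple roots, coefficients and height *)

Section NonNegative.

Context {R : realFieldType} {m : nat}.
Variable P : seq 'rV[R]_m.
Implicit Types (u v a : 'rV[R]_m).

Lemma nonnegP v :
  nonneg P v <-> exists f : 'I_(size P) -> nat, v = \sum_(i < size P) P`_i *+ f i.
Proof.
split=> [[c ->]|[f ->]]; first by exists (fun i : 'I_(size P) => nth 0%N c i).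
exists [seq f i | i <- enum 'I_(size P)]; apply: eq_bigr => i _.
by rewrite (nth_map i) ?size_enum_ord // nth_ord_enum.
Qed.

Lemma nonneg0 : nonneg P 0.
Proof. by apply/nonnegP; exists (fun=> 0%N); rewrite big1. Qed.

Lemma nonnegD u v : nonneg P u -> nonneg P v -> nonneg P (u + v).
Proof.
move=> /nonnegP[f ->] /nonnegP[g ->]; apply/nonnegP; exists (fun i => f i + g i)%N.
by rewrite -big_split; apply: eq_bigr => i _; rewrite mulrnDr.
Qed.

Lemma nonnegMn u n : nonneg P u -> nonneg P (u *+ n).
Proof.
move=> hu; elim: n => [|n IH]; first by rewrite mulr0n; exact: nonneg0.
by rewrite mulrS; exact: nonnegD.
Qed.

Lemma nonneg_mem a : a \in P -> nonneg P a.
Proof.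
move=> aP; apply/nonnegP.
have lt : (index a P < size P)%N by rewrite index_mem.
exists (fun i => (i == Ordinal lt) : nat); rewrite (bigD1 (Ordinal lt)) //= eqxx.
by rewrite nth_index // big1 ?addr0 // => i /negPf ->.
Qed.

Lemma nonneg_ind (K : 'rV[R]_m -> Prop) :
  K 0 -> (forall a v, a \in P -> nonneg P v -> K v -> K (a + v)) ->
  forall v, nonneg P v -> K v.
Proof.
move=> K0 KS v /nonnegP[f ->].
suff [] : nonneg P (\sum_(i < size P) P`_i *+ f i) /\ K (\sum_(i < size P) P`_i *+ f i) by [].
elim/big_rec: _ => [|i x _ [nx Kx]]; first by split=> //; exact: nonneg0.
have Pi : P`_i \in P by rewrite mem_nth.
elim: (f i) => [|k [nk Kk]]; first by rewrite mulr0n add0r.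
rewrite mulrS -addrA; split; last exact: KS.
by apply: nonnegD => //; exact: nonneg_mem.
Qed.

(** In other words, pairing with a vector that is nonnegative on the simple roots is monotone for
    [root_le]; order relations in the classical types are refuted this way. *)
Lemma nonneg_dot_ge0 v w :
  (forall a, a \in P -> 0 <= dot a w) -> nonneg P v -> 0 <= dot v w.
Proof.
move=> h; move: v; apply: nonneg_ind => [|a v aP _ IH]; first by rewrite dot0l.
by rewrite dotDl addr_ge0 // h.
Qed.

Lemma nonneg_dot_gt0 u v :
  nonneg P v -> 0 < dot u v -> exists2 a, a \in P & 0 < dot u a.
Proof.
move=> nv uv; apply: contrapT => h; move: uv; rewrite ltNge => /negP; apply.
have := @nonneg_dot_ge0 v (- u).
rewrite dotNr oppr_ge0 dotC; apply=> // a aP; rewrite dotNr oppr_ge0 leNgt dotC.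
by apply/negP => ua; apply: h; exists a.
Qed.

Lemma root_le_refl u : root_le P u u.
Proof. by rewrite /root_le subrr; exact: nonneg0. Qed.

Lemma root_le_trans u v w : root_le P u v -> root_le P v w -> root_le P u w.
Proof.
by move=> uv vw; rewrite /root_le -(subrKA v); apply: nonnegD.
Qed.

Hypothesis freeP : free P.

(** [coord] is linear on the whole ambient space, not only on the span of [P], so [cf] and [ht] can
    be applied to arbitrary differences of vectors. *)
Definition cf (i : 'I_(size P)) (v : 'rV[R]_m) : R := coord (in_tuple P) i v.

Lemma cfD i u v : cf i (u + v) = cf i u + cf i v.
Proof. exact: linearD. Qed.

Lemma cfZ i t v : cf i (t *: v) = t * cf i v.
Proof. exact: linearZ. Qed.

Lemma cfN i v : cf i (- v) = - cf i v.
Proof. exact: linearN. Qed.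

Lemma cfB i u v : cf i (u - v) = cf i u - cf i v.
Proof. exact: linearB. Qed.

Lemma cf_sum (k : 'I_(size P) -> R) i : cf i (\sum_(j < size P) k j *: P`_j) = k i.
Proof. by rewrite /cf (coord_sum_free (X := in_tuple P)). Qed.

Lemma cf_natsum (f : 'I_(size P) -> nat) i : cf i (\sum_(j < size P) P`_j *+ f j) = (f i)%:R.
Proof. by under eq_bigr do rewrite -scaler_nat; rewrite cf_sum. Qed.

Lemma cf_nth i (j : 'I_(size P)) : cf i P`_j = (j == i)%:R.
Proof. by rewrite /cf (coord_free (X := in_tuple P)). Qed.

Lemma cf_ge0 i v : nonneg P v -> 0 <= cf i v.
Proof. by move=> /nonnegP[f ->]; rewrite cf_natsum. Qed.

Lemma nonneg_cfE v : nonneg P v -> v = \sum_(i < size P) cf i v *: P`_i.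
Proof.
move=> /nonnegP[f ->]; apply: eq_bigr => i _.
by rewrite cf_natsum scaler_nat.
Qed.

Lemma nonneg_eq0 v : nonneg P v -> (forall i, cf i v <= 0) -> v = 0.
Proof.
move=> nv h; rewrite (nonneg_cfE v nv) big1 // => i _.
suff -> : cf i v = 0 by rewrite scale0r.
by apply/eqP; rewrite eq_le h cf_ge0.
Qed.

Lemma nonneg_anti v : nonneg P v -> nonneg P (- v) -> v = 0.
Proof.
move=> nv nNv; apply: nonneg_eq0 => // i.
by rewrite -oppr_ge0 -cfN cf_ge0.
Qed.

Lemma root_le_anti u v : root_le P u v -> root_le P v u -> u = v.
Proof.
rewrite /root_le => h1 h2; apply/eqP; rewrite -subr_eq0; apply/eqP.
by apply: nonneg_anti => //; rewrite opprB.
Qed.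

Definition ht (v : 'rV[R]_m) : R := \sum_i cf i v.

Lemma htD u v : ht (u + v) = ht u + ht v.
Proof. by rewrite -big_split; apply: eq_bigr => i _; rewrite /= cfD. Qed.

Lemma htZ t v : ht (t *: v) = t * ht v.
Proof. by rewrite mulr_sumr; apply: eq_bigr => i _; rewrite cfZ. Qed.

Lemma htN v : ht (- v) = - ht v.
Proof. by rewrite -scaleN1r htZ mulN1r. Qed.

Lemma htB u v : ht (u - v) = ht u - ht v.
Proof. by rewrite htD htN. Qed.

Lemma ht_simple a : a \in P -> ht a = 1.
Proof.
move=> aP; have lt : (index a P < size P)%N by rewrite index_mem.
pose j : 'I_(size P) := Ordinal lt; have -> : a = P`_j by rewrite nth_index.
rewrite /ht (bigD1 j) // cf_nth eqxx big1 => [|i /negPf ni].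
  by rewrite /= addr0.
by rewrite cf_nth eq_sym ni.
Qed.

Lemma ht_nat v : nonneg P v -> exists n : nat, ht v = n%:R.
Proof.
move=> /nonnegP[f ->]; exists (\sum_i f i)%N; rewrite natr_sum.
by apply: eq_bigr => i _; rewrite cf_natsum.
Qed.

Lemma ht_ge1 v : nonneg P v -> v != 0 -> 1 <= ht v.
Proof.
move=> nv v0; have [n hn] := ht_nat v nv; rewrite hn ler1n lt0n.
apply: contra v0 => /eqP n0; apply/eqP; apply: nonneg_eq0 => // i.
rewrite n0 in hn.
have /psumr_eq0P := hn; move=> /(_ (fun j _ => cf_ge0 j v nv) i erefl) ->.
by [].
Qed.

End NonNegative.

(** * Sums and differences of roots, positive roots, simple reflections *)

Section Roots.

Context {R : realFieldType} {m : nat} {D : set 'rV[R]_m} {P : seq 'rV[R]_m}.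
Hypotheses (rsD : root_system D) (srP : simple_roots D P).
Implicit Types (u v a b c : 'rV[R]_m).

Local Notation pos := (positive D P).

Lemma root_neq0 c : D c -> c != 0.
Proof. by move=> Dc; apply/eqP => c0; apply: (rs_nonzero rsD); rewrite -c0. Qed.

Lemma root_opp c : D c -> D (- c).
Proof. by move=> Dc; rewrite -refl_self ?root_neq0 //; exact: rs_refl. Qed.

Lemma root_of_opp c : D (- c) -> D c.
Proof. by move=> /root_opp; rewrite opprK. Qed.

Lemma root_dot_gt0 c : D c -> 0 < dot c c.
Proof. by move=> /root_neq0; rewrite dot_sqr_gt0. Qed.

Lemma cartan_lt2 u v : D u -> D v -> cartan u v < 2 -> cartan u v <= 1.
Proof.
move=> Du Dv; have [k ->] := rs_crystallographic rsD Du Dv.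
by rewrite (_ : 2 = (2 : int)%:~R) // (_ : 1 = (1 : int)%:~R) // ltr_int ler_int; lia.
Qed.

Lemma cartan_ge1 u v : D u -> D v -> 0 < cartan u v -> 1 <= cartan u v.
Proof.
move=> Du Dv; have [k ->] := rs_crystallographic rsD Du Dv.
by rewrite (_ : 1 = (1 : int)%:~R) // ltr0z ler_int; lia.
Qed.

(** Expanding (u - v, u - v) > 0 gives 2 (u, v) < (u, u) + (v, v) <= 2 (v, v), so the Cartan integer
    is less than 2. *)
Lemma cartan_le1 u v : D u -> D v -> dot u u <= dot v v -> u != v ->
  cartan u v <= 1.
Proof.
move=> Du Dv luv uv; apply: cartan_lt2 => //.
have := dot_sqr_gt0 (u - v); rewrite subr_eq0 uv !(dotBl, dotBr) (dotC v u) => h.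
rewrite /cartan ltr_pdivrMr ?root_dot_gt0 //.
by lra.
Qed.

(** The Cartan integer of the shorter root against the longer one is 1, so the reflection of the
    shorter one is the difference itself. *)
Lemma root_sub u v : D u -> D v -> u != v -> 0 < dot u v -> D (u - v).
Proof.
have aux x y : D x -> D y -> x != y -> 0 < dot x y -> dot x x <= dot y y -> D (x - y).
  move=> Dx Dy xy h lxy.
  have c1 : cartan x y = 1.
    apply/eqP; rewrite eq_le cartan_le1 //= cartan_ge1 //.
    by rewrite cartan_gt0 ?root_neq0.
  by rewrite -[y in x - y]scale1r -c1; exact: rs_refl.
move=> Du Dv uv h; have [l|/ltW l] := leP (dot u u) (dot v v); first exact: aux.
by rewrite -opprB; apply: root_opp; apply: aux; rewrite 1?eq_sym 1?dotC.
Qed.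

Lemma root_add u v : D u -> D v -> u != - v -> dot u v < 0 -> D (u + v).
Proof.
move=> Du Dv uv h; rewrite -[v]opprK; apply: root_sub => //.
  exact: root_opp.
by rewrite dotNr oppr_gt0.
Qed.

Lemma simple_pos a : a \in P -> pos a.
Proof. by move=> aP; split; [exact: (sr_root srP)|exact: nonneg_mem]. Qed.

Lemma pos_root c : pos c -> D c. Proof. by case. Qed.

Lemma pos_or_neg c : D c -> pos c \/ pos (- c).
Proof.
move=> Dc; have [n|n] := sr_sign srP Dc; [left|right]; split=> //.
exact: root_opp.
Qed.

Lemma pos_asym c : pos c -> ~ pos (- c).
Proof.
move=> [Dc nc] [_ nNc]; move: (root_neq0 _ Dc).
by rewrite (nonneg_anti P (sr_free srP) c nc nNc) eqxx.
Qed.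

Lemma pos_add_ge c v : D c -> pos v -> nonneg P (c - v) -> pos c.
Proof.
move=> Dc [Dv nv] ncv; split=> //; rewrite -(subrK v c); exact: nonnegD.
Qed.

Lemma root_scale_eq t c : D c -> D (t *: c) -> nonneg P c -> nonneg P (t *: c) ->
  t *: c = c.
Proof.
move=> Dc Dt nc nt; have [->|tN] := rs_reduced rsD Dc Dt; first by rewrite scale1r.
case: (@pos_asym c) => //.
by rewrite tN scaleN1r in nt *; split=> //; exact: root_opp.
Qed.

(* A positive root other than [a] has a positive coefficient away from [a], and
   subtracting multiples of [a] leaves it alone. *)
Lemma simple_sub_pos t a c : a \in P -> pos c -> c != a -> D (c - t *: a) ->
  pos (c - t *: a).
Proof.
move=> aP [Dc nc] ca Dca; have [//|[_ nN]] := pos_or_neg _ Dca.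
have lt : (index a P < size P)%N by rewrite index_mem.
pose j : 'I_(size P) := Ordinal lt; have ea : a = P`_j by rewrite nth_index.
have frP := sr_free srP.
have h i : i != j -> cf P i c = 0.
  move=> ij; apply/eqP; rewrite eq_le cf_ge0 // andbT.
  have := cf_ge0 P frP i _ nN; rewrite cfN cfB cfZ ea cf_nth // eq_sym (negPf ij).
  by rewrite mulr0 subr0 oppr_ge0.
have ec : c = cf P j c *: a.
  rewrite {1}(nonneg_cfE P frP c nc) (bigD1 j) // -ea big1 /= ?addr0 //.
  by move=> i /h ->; rewrite scale0r.
move: ca; rewrite ec (root_scale_eq _ a) ?eqxx // -?ec //; first exact: (sr_root srP).
exact: nonneg_mem.
Qed.

Lemma simple_refl_pos a c : a \in P -> pos c -> c != a -> pos (refl a c).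
Proof.
move=> aP pc ca; apply: simple_sub_pos => //.
by apply: rs_refl => //; [case: pc|exact: (sr_root srP)].
Qed.

Lemma pos_dot_simple c : pos c -> exists2 a, a \in P & 0 < dot c a.
Proof. by move=> [Dc nc]; apply: nonneg_dot_gt0 nc _; exact: root_dot_gt0. Qed.

Lemma pos_sub_simple c : pos c -> c \notin P ->
  exists2 a, a \in P & pos (c - a).
Proof.
move=> pc cP; have [a aP ca] := pos_dot_simple c pc; exists a => //.
have c_a : c != a by apply: contraNneq cP => ->.
rewrite -[a]scale1r; apply: simple_sub_pos => //; rewrite scale1r.
by apply: root_sub => //; [case: pc|exact: (sr_root srP)].
Qed.

End Roots.

(** * The highest root and its Cartan integers *)

Section HighestRoot.

Context {R : realFieldType} {m : nat} {D : set 'rV[R]_m} {P : seq 'rV[R]_m}.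
Context {theta : 'rV[R]_m}.
Hypotheses (rsD : root_system D) (srP : simple_roots D P).
Hypotheses (htheta : highest_root D P theta).
Hypotheses (ltheta : forall b, D b -> dot b b <= dot theta theta).
Implicit Types (u v a b c : 'rV[R]_m).

Local Notation pos := (positive D P).

Lemma theta_pos : pos theta. Proof. by case: htheta. Qed.

Lemma theta_root : D theta. Proof. by case: theta_pos. Qed.

Lemma le_theta c : pos c -> root_le P c theta.
Proof. by case: htheta => _; apply. Qed.

Lemma highest_root_uniq c : highest_root D P c -> c = theta.
Proof.
move=> [pc hc]; apply: (root_le_anti P (sr_free srP)); first exact: le_theta.
by apply: hc; exact: theta_pos.
Qed.

(** Otherwise [theta + a] would be a positive root not below [theta]. *)
Lemma theta_dominant a : a \in P -> 0 <= dot a theta.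
Proof.
move=> aP; rewrite leNgt; apply/negP => h.
have [Da na] := simple_pos srP a aP.
have Dt : D (theta + a).
  apply: (root_add rsD) => //; [exact: theta_root|apply/eqP => e|by rewrite dotC].
  by apply: (pos_asym rsD srP a) => //; rewrite -e; exact: theta_pos.
have /le_theta : pos (theta + a).
  by split=> //; apply: nonnegD => //; case: theta_pos.
rewrite /root_le opprD addNKr => nNa.
by apply: (pos_asym rsD srP a) => //; split=> //; exact: (root_opp rsD).
Qed.

Lemma nonneg_dot_theta v : nonneg P v -> 0 <= dot v theta.
Proof. by apply: nonneg_dot_ge0; exact: theta_dominant. Qed.

Lemma pos_dot_theta c : pos c -> 0 <= dot c theta.
Proof. by move=> [_ nc]; exact: nonneg_dot_theta. Qed.

Lemma dot_theta_pos c : D c -> 0 < dot c theta -> pos c.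
Proof.
move=> Dc h; have [//|/pos_dot_theta] := pos_or_neg rsD srP c Dc.
by rewrite dotNl oppr_ge0 leNgt h.
Qed.

Lemma cartan_theta c : D c -> 0 < dot c theta -> c != theta -> cartan c theta = 1.
Proof.
move=> Dc h ct; have Dt := theta_root.
apply/eqP; rewrite eq_le (cartan_le1 rsD) //=; last exact: ltheta.
by apply: (cartan_ge1 rsD) => //; rewrite cartan_gt0 ?(root_neq0 rsD).
Qed.

Lemma cartan_theta_le2 c : D c -> cartan c theta <= 2.
Proof.
move=> Dc; have Dt := theta_root; have [->|ct] := eqVneq c theta.
  by rewrite cartan_self ?(root_neq0 rsD).
by apply: le_trans (_ : _ <= 1) _; [apply: (cartan_le1 rsD) => //; exact: ltheta|rewrite ler1n].
Qed.

Lemma cartan_theta_eq2 c : D c -> 1 < cartan c theta -> c = theta.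
Proof.
move=> Dc; have Dt := theta_root; have [//|ct] := eqVneq c theta.
by rewrite ltNge (cartan_le1 rsD) // ltheta.
Qed.

Lemma root_theta_sub c : D c -> 0 < dot c theta -> c != theta -> D (theta - c).
Proof.
by move=> Dc h ct; apply: (root_sub rsD) => //; rewrite 1?eq_sym 1?dotC //; exact: theta_root.
Qed.

(** If c were dominant, pairing theta - c >= 0 with c would give (theta, c) >= (c, c), and equal
    lengths then make |c - theta|^2 <= 0. *)
Lemma long_neg_simple c : pos c -> dot c c = dot theta theta -> c != theta ->
  exists2 a, a \in P & dot c a < 0.
Proof.
move=> pc lc ct; apply: contrapT => h.
have h2 : 0 <= dot (theta - c) c.
  apply: nonneg_dot_ge0 (le_theta _ pc) => a aP; rewrite leNgt dotC.
  by apply/negP => ca; apply: h; exists a.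
move: ct; rewrite -subr_eq0 -dot_sqr_eq0 => /negP; apply.
have := dot_sqr_ge0 (c - theta); rewrite eq_le andbC => -> /=.
by move: h2; rewrite !(dotBl, dotBr) (dotC theta c) lc; lra.
Qed.

End HighestRoot.

(** * The affine Weyl group *)

Section AffineWeylGroup.

Context {R : realFieldType} {m : nat} {D : set 'rV[R]_m} {P : seq 'rV[R]_m}.
Hypotheses (rsD : root_system D) (srP : simple_roots D P).
Local Notation A := ('rV[R]_m * R)%type.
Implicit Types (a b x y : A) (w : A -> A).

Local Notation pos := (positive D P).
Local Notation apos := (affine_positive D P).

(** The formula of [affine_refl] with an arbitrary second component, so that reflections in images
    such as [w (- g, 1)] can be written. *)
Definition arefl a x : A := (refl a.1 x.1, x.2 - a.2 * cartan x.1 a.1).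

Definition areal x : Prop := D x.1 /\ exists k : int, x.2 = k%:~R.

(** With t = 1 and t = -1 this is subtraction and addition, so a single identity in [asub] carries
    all the linearity of affine Weyl elements. *)
Definition asub x (t : R) y : A := (x.1 - t *: y.1, x.2 - t * y.2).

Lemma areflE a x : arefl a x = asub x (cartan x.1 a.1) a.
Proof. by rewrite /arefl /asub mulrC. Qed.

Lemma asub1 x y : asub x 1 y = x - y.
Proof. by rewrite /asub scale1r mul1r. Qed.

Lemma asub_add x y : asub x (-1) y = x + y.
Proof. by rewrite /asub scaleN1r mulN1r !opprK. Qed.

Lemma affine_reflE c (k : int) : affine_refl c k = arefl (c, k%:~R).
Proof. by []. Qed.

Lemma areal_neq0 a : areal a -> a.1 != 0.
Proof. by case=> /(root_neq0 rsD). Qed.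

Lemma arealN a : areal a -> areal (- a).
Proof.
move=> [Da [k ak]]; split; first exact: (root_opp rsD).
by exists (- k); rewrite /= ak rmorphN.
Qed.

Lemma arefl_asub a x t y : arefl a (asub x t y) = asub (arefl a x) t (arefl a y).
Proof.
rewrite /arefl /asub /refl /= cartanBl cartanZl; congr pair; last by ring.
by apply/rowP => i; rewrite !mxE; ring.
Qed.

Lemma arefl_self a : a.1 != 0 -> arefl a a = - a.
Proof.
move=> a0; rewrite /arefl refl_self // cartan_self //.
case: a a0 => c t /= _; rewrite (_ : - (c, t) = (- c, - t)) //.
by congr pair; ring.
Qed.

Lemma arefl_dot a x y : a.1 != 0 ->
  dot (arefl a x).1 (arefl a y).1 = dot x.1 y.1.
Proof. exact: refl_dot. Qed.

Lemma areflN a : arefl (- a) = arefl a.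
Proof.
apply/funext => x; rewrite !areflE /asub /= cartanNr.
by congr pair; rewrite ?scaleNr ?scalerN ?opprK //; ring.
Qed.

Lemma arefl_real a x : areal a -> areal x -> areal (arefl a x).
Proof.
move=> [Da [j aj]] [Dx [k xk]]; split; first exact: rs_refl.
have [l cl] := rs_crystallographic rsD Dx Da.
by exists (k - j * l); rewrite /= cl xk aj rmorphB rmorphM.
Qed.

Lemma areflK a : a.1 != 0 -> involutive (arefl a).
Proof.
move=> a0 x; rewrite [X in arefl a X]areflE arefl_asub arefl_self // areflE /asub /=.
by rewrite scalerN mulrN !opprK subrK subrK; case: x.
Qed.

Lemma affine_weyl_asub w : affine_weyl D w ->
  forall x t y, w (asub x t y) = asub (w x) t (w y).
Proof.
elim=> [//|c k {}w Dc _ IH] x t y /=.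
by rewrite IH affine_reflE arefl_asub.
Qed.

Lemma affine_weylD w : affine_weyl D w -> {morph w : x y / x + y}.
Proof. by move=> aw x y; rewrite -!asub_add affine_weyl_asub. Qed.

Lemma affine_weylB w : affine_weyl D w -> {morph w : x y / x - y}.
Proof. by move=> aw x y; rewrite -!asub1 affine_weyl_asub. Qed.

Lemma affine_weyl0 w : affine_weyl D w -> w 0 = 0.
Proof. by move=> aw; rewrite -[0 in LHS]subr0 affine_weylB // subrr. Qed.

Lemma affine_weylN w : affine_weyl D w -> {morph w : x / - x}.
Proof. by move=> aw x; rewrite -sub0r affine_weylB // affine_weyl0 // sub0r. Qed.

Lemma affine_weyl_delta w : affine_weyl D w -> forall t, w (0, t) = (0, t).
Proof.
elim=> [//|c k {}w Dc _ IH] t /=; rewrite IH affine_reflE /arefl /refl /cartan /=.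
by rewrite dot0l mulr0 mul0r scale0r mulr0 !subr0.
Qed.

Lemma affine_weyl_dot w : affine_weyl D w ->
  forall x y, dot (w x).1 (w y).1 = dot x.1 y.1.
Proof.
elim=> [//|c k {}w Dc _ IH] x y; rewrite affine_reflE /comp.
by rewrite arefl_dot ?IH // (root_neq0 rsD).
Qed.

Lemma affine_weyl_cartan w : affine_weyl D w ->
  forall x y, cartan (w x).1 (w y).1 = cartan x.1 y.1.
Proof. by move=> aw x y; rewrite /cartan !affine_weyl_dot. Qed.

Lemma affine_weyl_real w : affine_weyl D w -> forall x, areal x -> areal (w x).
Proof.
elim=> [//|c k {}w Dc _ IH] x /IH rx /=; rewrite affine_reflE.
by apply: arefl_real => //; split=> //; exists k.
Qed.

Lemma affine_weyl_comp w1 w2 :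
  affine_weyl D w1 -> affine_weyl D w2 -> affine_weyl D (w1 \o w2).
Proof. by move=> h1 h2; elim: h1 => [//|c k w Dc _ IH]; exact: AffineWeyl_refl. Qed.

Lemma affine_weyl_arefl a : areal a -> affine_weyl D (arefl a).
Proof.
case: a => c t [/= Dc [k ->]]; rewrite -affine_reflE.
by apply: (AffineWeyl_refl k Dc); exact: AffineWeyl_id.
Qed.

Lemma affine_weyl_inv w : affine_weyl D w ->
  exists v, [/\ affine_weyl D v, cancel w v & cancel v w].
Proof.
elim=> [|c k {}w Dc _ [v [av wv vw]]].
  by exists id; split=> //; exact: AffineWeyl_id.
have c0 := root_neq0 rsD c Dc; rewrite affine_reflE.
have rc : areal (c, k%:~R) by split=> //; exists k.
exists (v \o arefl (c, k%:~R)); split=> [|x|x] /=.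
- by apply: affine_weyl_comp => //; exact: affine_weyl_arefl.
- by rewrite areflK.
- by rewrite vw areflK.
Qed.

Lemma affine_weyl_conj w a x : affine_weyl D w ->
  w (arefl a x) = arefl (w a) (w x).
Proof. by move=> aw; rewrite !areflE affine_weyl_asub // affine_weyl_cartan. Qed.

Lemma apos_real x : apos x -> areal x.
Proof. by move=> [c [k [-> Dc _]]]; split=> //; exists k. Qed.

Lemma aposP c (k : int) :
  apos (c, k%:~R) <-> D c /\ (1 <= k \/ (k = 0 /\ pos c)).
Proof.
split=> [[c' [k' [[-> /eqP]]]]|[Dc h]]; last by exists c, k.
by rewrite eqr_int => /eqP -> .
Qed.

Lemma apos_asym x : apos x -> ~ apos (- x).
Proof.
move=> [c [k [-> Dc h]]]; have -> : - (c, k%:~R) = (- c, (- k)%:~R) :> A by rewrite rmorphN.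
move=> /aposP[_ h2]; case: h => [h|[k0 pc]]; case: h2 => [h2|[k02 pc2]]; try lia.
exact: (pos_asym rsD srP c pc pc2).
Qed.

Lemma apos_or_neg x : areal x -> apos x \/ apos (- x).
Proof.
case: x => c t [/= Dc [k ->]].
have -> : - (c, k%:~R) = (- c, (- k)%:~R) :> A by rewrite rmorphN.
have DNc := root_opp rsD c Dc.
have [h|h|->] := ltgtP k 0.
- by right; apply/aposP; split=> //; left; lia.
- by left; apply/aposP; split=> //; left; lia.
- by have [] := pos_or_neg rsD srP c Dc; [left|right]; apply/aposP; split=> //; right.
Qed.

Lemma apos_finite c : apos (c, 0) <-> pos c.
Proof.
rewrite (_ : (c, 0) = (c, (0 : int)%:~R)) //; split.
  by move=> /aposP[_ []] // [].
by move=> pc; apply/aposP; split; [case: pc|right].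
Qed.

Lemma apos_ge1 c (k : int) : D c -> 1 <= k -> apos (c, k%:~R).
Proof. by move=> Dc k1; apply/aposP; split=> //; left. Qed.

Lemma apos_lt1 x : apos x -> x.2 < 1 -> pos x.1.
Proof.
move=> [c [k [-> Dc h]]] /=; rewrite (_ : 1 = (1 : int)%:~R) // ltr_int => k1.
by case: h => [|[]//]; lia.
Qed.

End AffineWeylGroup.

(** * Affine simple roots, words in simple reflections, inversions *)

Section AffineSimple.

Context {R : realFieldType} {m : nat} {D : set 'rV[R]_m} {P : seq 'rV[R]_m}.
Context {theta : 'rV[R]_m}.
Hypotheses (rsD : root_system D) (srP : simple_roots D P).
Hypotheses (htheta : highest_root D P theta).
Hypotheses (ltheta : forall b, D b -> dot b b <= dot theta theta).
Local Notation A := ('rV[R]_m * R)%type.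
Implicit Types (a b x y : A) (w : A -> A) (s : seq A).

Local Notation pos := (positive D P).
Local Notation apos := (affine_positive D P).
Local Notation areal := (@areal R m D).

(** The affine simple roots alpha_1, ..., alpha_n and alpha_0 = delta - theta. *)
Definition asimple a : Prop := (exists2 c, c \in P & a = (c, 0)) \/ a = (- theta, 1).

Lemma asimple_apos a : asimple a -> apos a.
Proof.
case=> [[c cP ->]|->]; first by apply/apos_finite; exact: simple_pos srP _ cP.
rewrite -[1]/((1 : int)%:~R); apply: apos_ge1 => //.
by apply: (root_opp rsD); exact: theta_root htheta.
Qed.

Lemma asimple_real a : asimple a -> areal a.
Proof. by move=> /asimple_apos /apos_real. Qed.

(** For a finite simple root the level is unchanged. For alpha_0 the root c + k delta moves to level
    k + p with p = <c, theta^v>, and only the cases with k + p <= 0 need an argument; there -2 <= p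
    leaves few of them. *)
Lemma asimple_refl_apos a x : asimple a -> apos x -> x != a -> apos (arefl a x).
Proof.
move=> [[al alP ->]|->] [c [k [-> Dc h]]] xa.
  have Dal := sr_root srP alP; rewrite /arefl /= mul0r subr0.
  case: h => [k1|[k0 pc]].
    by apply: apos_ge1 => //; exact: rs_refl.
  rewrite k0; apply/apos_finite; apply: simple_refl_pos => //.
  by apply: contraNneq xa => ->; rewrite k0.
have Dt := theta_root htheta; have pt := theta_pos htheta.
have [p cp] := rs_crystallographic rsD Dc Dt.
have -> : arefl (- theta, 1) (c, k%:~R) = (refl theta c, (k + p)%:~R).
  rewrite -areflN /arefl /= opprK cp rmorphD /=; congr pair; ring.
have Dc' : D (refl theta c) by exact: rs_refl.
apply/aposP; split=> //.
have [|le0] := leP 1 (k + p); [by left|right].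
have cpE : (p%:~R : R) * dot theta theta = 2 * dot c theta.
  by rewrite -cp cartan_dot // (root_neq0 rsD).
have pp := root_dot_gt0 rsD _ Dt.
(* At level 0 the root c is positive, so p >= 0; together with k + p <= 0 this gives p = 0, and the
   root is fixed. *)
case: h => [k1|[k0 pc]]; last first.
  have p0 : 0 <= p.
    rewrite -(ler0z R) -(pmulr_lge0 _ pp) cpE mulr_ge0 //.
    exact: (pos_dot_theta rsD srP htheta _ pc).
  have {}p0 : p = 0 by lia.
  by split; [rewrite k0 p0|rewrite /refl cp p0 scale0r subr0].
have pneg : p <= -1 by lia.
have Nc : pos (- c).
  have [pc|//] := pos_or_neg rsD srP _ Dc.
  have := pos_dot_theta rsD srP htheta _ pc => ct.
  suff : 0 <= p by lia.
  by rewrite -(ler0z R) -(pmulr_lge0 _ pp) cpE mulr_ge0.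
have cth : 1 <= - p <= 2.
  apply/andP; split; first by lia.
  have := cartan_theta_le2 rsD htheta ltheta _ (root_opp rsD _ Dc).
  by rewrite cartanNl cp -rmorphN /= (_ : 2 = (2 : int)%:~R) // ler_int.
(* For p = -1 the image is the finite vector c + theta = theta - (- c), nonnegative because - c is
   positive. For p = -2 the root c is - theta. *)
have [p1|p1] : p = - 1 \/ p = - 2 by lia.
  split; first by lia.
  split=> //; rewrite /refl cp p1 rmorphN /= scaleN1r opprK addrC -[c]opprK.
  exact: (le_theta htheta).
have c_t : c = - theta.
  apply: oppr_inj; rewrite opprK; apply: (cartan_theta_eq2 rsD htheta ltheta).
    exact: (root_opp rsD).
  by rewrite cartanNl cp p1 rmorphN opprK /= (_ : 1 = (1 : int)%:~R) // ltr_int.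
(* k = 1 is the excluded root alpha_0 itself; k = 2 is sent to the finite root theta. *)
have [k1'|k2] : k = 1 \/ k = 2 by lia.
  by move: xa; rewrite k1' c_t eqxx.
split; first by lia.
rewrite /refl cp p1 c_t rmorphN /= scaleNr opprK.
by rewrite (_ : 2%:~R = 2%:R) // scaler_nat mulr2n addKr.
Qed.

(** Height in the affine simple roots: delta = alpha_0 + theta has height 1 + ht(theta). *)
Definition aht x : R := ht P x.1 + x.2 * (1 + ht P theta).

Lemma aht_asub x t y : aht (asub x t y) = aht x - t * aht y.
Proof. by rewrite /aht /= htB htZ; ring. Qed.

Lemma ahtD x y : aht (x + y) = aht x + aht y.
Proof. by rewrite -asub_add aht_asub; ring. Qed.

Lemma aht_simple a : asimple a -> aht a = 1.
Proof.
move=> [[c cP ->]|->]; rewrite /aht /=.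
  by rewrite (ht_simple P (sr_free srP)) // mul0r addr0.
by rewrite htN; ring.
Qed.

Lemma aht_ge1 x : apos x -> 1 <= aht x.
Proof.
have frP := sr_free srP.
have hge1 c : pos c -> 1 <= ht P c.
  by move=> [Dc nc]; apply: ht_ge1 => //; exact: root_neq0 rsD _ Dc.
have tge1 := hge1 _ (theta_pos htheta).
move=> [c [k [-> Dc h]]]; rewrite /aht /=; case: h => [k1|[-> pc]]; last first.
  by rewrite mul0r addr0 hge1.
have hc : - ht P theta <= ht P c.
  have [/hge1|/(le_theta htheta)] := pos_or_neg rsD srP _ Dc; first by lra.
  move=> nc; have [n] := ht_nat P frP _ nc.
  by rewrite htB htN => hn; have := ler0n R n; lra.
have : (1 : R) <= k%:~R by rewrite (_ : 1 = (1 : int)%:~R) // ler_int.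
by move: hc tge1; nra.
Qed.

Definition wact s : A -> A := foldr (fun a w => arefl a \o w) id s.

Definition aword s : Prop := forall a, a \in s -> asimple a.

Lemma aword_cons a s : aword (a :: s) <-> asimple a /\ aword s.
Proof.
split=> [h|[ha hs] b]; last by rewrite inE => /orP[/eqP ->|/hs].
by split=> [|b bs]; apply: h; rewrite inE ?eqxx ?bs ?orbT.
Qed.

Lemma aword_cat s1 s2 : aword (s1 ++ s2) <-> aword s1 /\ aword s2.
Proof.
split=> [h|[h1 h2] b]; last by rewrite mem_cat => /orP[/h1|/h2].
by split=> b bs; apply: h; rewrite mem_cat bs ?orbT.
Qed.

Lemma wact_cat s1 s2 : wact (s1 ++ s2) = wact s1 \o wact s2.
Proof. by elim: s1 => //= a s1 ->. Qed.

Lemma wact_weyl s : aword s -> affine_weyl D (wact s).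
Proof.
elim: s => [_|a s IH /aword_cons[ha /IH h]] /=; first exact: AffineWeyl_id.
apply: (affine_weyl_comp (arefl a)) => //.
by apply: affine_weyl_arefl; exact: asimple_real.
Qed.

(* A root cannot be nonpositive on all simple roots and on [- theta]. *)
Lemma asimple_dot_gt0 x : areal x -> exists2 a, asimple a & 0 < dot x.1 a.1.
Proof.
case: x => c t [/= Dc _].
have [pc|pc] := pos_or_neg rsD srP _ Dc.
  have [a aP ca] := pos_dot_simple rsD _ pc.
  by exists (a, 0) => //; left; exists a.
apply: contrapT => h.
have h1 : dot c theta >= 0.
  rewrite leNgt; apply/negP => ct; apply: h; exists (- theta, 1); first by right.
  by rewrite /= dotNr oppr_gt0.
have h2 : 0 <= dot (theta - - c) (- c).
  apply: nonneg_dot_ge0 (le_theta htheta _ pc) => a aP.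
  rewrite dotNr oppr_ge0 leNgt; apply/negP => ca; apply: h.
  by exists (a, 0); [left; exists a|rewrite /= dotC].
have := root_dot_gt0 rsD _ Dc.
by move: h2; rewrite !(dotDl, dotNr, dotNl) opprK (dotC theta c); lra.
Qed.

(** Induction on the affine height: for a simple a with (x, a) > 0, the reflection in x is the
    conjugate by s_a of the reflection in s_a x, which is positive and strictly lower unless x =
    a. *)
Lemma arefl_word x : apos x -> exists2 s, aword s & arefl x = wact s.
Proof.
have H : forall n : nat, forall x, apos x -> aht x < n%:R ->
    exists2 s, aword s & arefl x = wact s.
  elim=> [|n IH] {}x px hx.
    by have := aht_ge1 _ px => h; exfalso; move: h hx; lra.
  have rx := apos_real _ px.
  have [a sa xa] := asimple_dot_gt0 _ rx.
  have [->|x_a] := eqVneq x a.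
    by exists [:: a] => // b; rewrite inE => /eqP ->.
  have ra := asimple_real _ sa; have a0 := areal_neq0 rsD _ ra.
  have [|s ws es] := IH _ (asimple_refl_apos a x sa px x_a).
    rewrite areflE aht_asub (aht_simple a) // mulr1.
    have := cartan_ge1 rsD _ _ rx.1 ra.1; rewrite cartan_gt0 // xa => /(_ isT).
    by move: hx; rewrite -addn1 natrD; lra.
  exists (a :: s ++ [:: a]).
    by apply/aword_cons; split=> //; apply/aword_cat; split=> // b; rewrite inE => /eqP ->.
  apply/funext => y; rewrite /= wact_cat /= -es.
  have waW := affine_weyl_arefl a ra.
  apply: (inv_inj (areflK a a0)).
  by rewrite (affine_weyl_conj rsD _ x y waW) areflK.
(* The induction runs on a natural bound of the height, which has to be exhibited since [R] need not
   be archimedean. *)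
move=> px; have [n nx] : exists n : nat, aht x < n%:R.
  have [c [k [-> Dc _]]] := px.
  have [n0 hn0] : exists n : nat, ht P c <= n%:R.
    have [[_ nc]|[_ nc]] := pos_or_neg rsD srP _ Dc.
      by have [n ->] := ht_nat P (sr_free srP) _ nc; exists n.
    have [n hn] := ht_nat P (sr_free srP) _ nc; exists 0%N.
    by rewrite -oppr_ge0 -htN hn.
  have [nt hnt] := ht_nat P (sr_free srP) _ (theta_pos htheta).2.
  exists (n0 + `|k| * nt.+1).+1%N; rewrite /aht /= hnt.
  have kn : (k%:~R : R) <= `|k|%N%:R by rewrite -[`|k|%N%:R]/(`|k|%:Z%:~R) ler_int; lia.
  rewrite -addn1 !natrD natrM -addn1 natrD.
  have := ler0n R nt; move: kn hn0; nra.
exact: (H n).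
Qed.

Lemma affine_weyl_word w : affine_weyl D w -> exists2 s, aword s & w = wact s.
Proof.
elim=> [|c k {}w Dc _ [s ws ->]]; first by exists [::].
rewrite affine_reflE; have rc : areal (c, k%:~R) by split=> //; exists k.
suff [s' ws' ->] : exists2 s', aword s' & arefl (c, k%:~R) = wact s'.
  by exists (s' ++ s); [apply/aword_cat|rewrite wact_cat].
have [|] := apos_or_neg rsD srP _ rc => /arefl_word //.
by rewrite areflN.
Qed.

Lemma arefl_simple_sign a x : asimple a -> areal x ->
  apos x -> apos (- arefl a x) -> x = a.
Proof.
move=> sa rx px nx; apply/eqP; apply: contraPT nx => xa.
exact: (apos_asym rsD srP _ (asimple_refl_apos _ _ sa px xa)).
Qed.

(* The exchange condition shortens a word whose last letter is not inverted. *)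
Lemma no_inversion_id w : affine_weyl D w -> inversions D P w = set0 -> w = id.
Proof.
move=> /affine_weyl_word[s ws ->].
have [n] := ubnP (size s); elim: n s ws => // n IH s; case/lastP: s => [//|s a].
rewrite size_rcons ltnS => wsa sn N0.
have [ws wa] : aword s /\ asimple a.
  by move: wsa; rewrite -cats1 => /aword_cat[? h]; split=> //; apply: h; rewrite inE.
have ra := asimple_real _ wa; have a0 := areal_neq0 rsD _ ra.
(* Otherwise the last letter a would be an inversion of the whole word, because the word sends a to
   - wact s a. *)
have neg : apos (- wact s a).
  have rwa : areal (wact s a) by exact: affine_weyl_real rsD _ (wact_weyl _ ws) _ ra.
  have [pwa|//] := apos_or_neg rsD srP _ rwa.
  have : set0 a; last by [].
  rewrite -N0; split; first exact: asimple_apos.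
  rewrite -cats1 wact_cat /= arefl_self // (affine_weylN _ (wact_weyl _ ws)) opprK.
  exact: pwa.
(* Letting the letters of s act on a one at a time, the sign changes at some letter b; a simple
   reflection makes only its own root negative, so the root reached just before is b. *)
have [s1 [b [s2 [es ewa]]]] : exists s1 b s2, s = s1 ++ b :: s2 /\ wact s2 a = b.
  clear wsa sn N0 IH; elim: s ws neg => [_ /=|b s IHs /aword_cons[sb ws] neg].
    by move=> na; case: (apos_asym rsD srP _ (asimple_apos _ wa)).
  have rwa : areal (wact s a) by exact: affine_weyl_real rsD _ (wact_weyl _ ws) _ ra.
  have [pwa|/(IHs ws)[s1 [b' [s2 [-> e]]]]] := apos_or_neg rsD srP _ rwa.
    by exists [::], b, s; split=> //; apply: arefl_simple_sign.
  by exists (b :: s1), b', s2.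
have [ws1 /aword_cons[sb ws2]] : aword s1 /\ aword (b :: s2).
  by apply/aword_cat; rewrite -es.
(* Since s2 sends a to b, moving s_a across s2 turns it into s_b, which cancels the letter b; the
   word loses two letters. *)
have e : wact (rcons s a) = wact (s1 ++ s2).
  rewrite -cats1 es -catA /= wact_cat /= !wact_cat; apply/funext => x /=.
  rewrite -ewa -(affine_weyl_conj rsD _ _ _ (wact_weyl _ ws2)).
  by rewrite areflK.
rewrite e in N0 *; apply: IH => //; first by apply/aword_cat.
by move: sn; rewrite es !size_cat /=; lia.
Qed.

(** A simple reflection preserves the sign of every real affine root other than its own root and the
    opposite. *)
Lemma inversions_arefl w a x : affine_weyl D w -> asimple a -> apos x ->
  w x != a -> w x != - a ->
  inversions D P (arefl a \o w) x <-> inversions D P w x.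
Proof.
move=> aw sa px xa xNa; rewrite /inversions /=.
have ra := asimple_real _ sa; have a0 := areal_neq0 rsD _ ra.
have rx : areal (w x) by exact: affine_weyl_real rsD _ aw _ (apos_real _ px).
have awa := affine_weyl_arefl a ra.
have pres y : apos y -> y != a -> apos (arefl a y) by exact: asimple_refl_apos.
split=> -[_ h]; split=> //.
- have [p|//] := apos_or_neg rsD srP _ rx.
  by case: (apos_asym rsD srP _ (pres _ p xa)).
- by rewrite -(affine_weylN _ awa); apply: pres => //; rewrite eqr_oppLR.
Qed.

End AffineSimple.

(** * Adding and removing elements of an abelian ideal *)

Section PetersonStep.

Context {R : realFieldType} {m : nat} {D : set 'rV[R]_m} {P : seq 'rV[R]_m}.
Context {theta : 'rV[R]_m}.
Hypotheses (rsD : root_system D) (srP : simple_roots D P).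
Hypotheses (htheta : highest_root D P theta).
Hypotheses (ltheta : forall b, D b -> dot b b <= dot theta theta).
Local Notation A := ('rV[R]_m * R)%type.
Implicit Types (a b x y : A) (w : A -> A) (g u v c : 'rV[R]_m).
Implicit Types (I J : set 'rV[R]_m).

Local Notation pos := (positive D P).
Local Notation apos := (affine_positive D P).
Local Notation areal := (@areal R m D).
Local Notation asimple := (@asimple R m P theta).

Lemma areal_delta c : D c -> areal (- c, 1).
Proof.
move=> Dc; split; first exact: (root_opp rsD).
by exists 1.
Qed.

Lemma apos_delta_sub c : D c -> apos (- c, 1).
Proof.
by move=> Dc; apply: (apos_ge1 (- c) 1) => //; exact: (root_opp rsD).
Qed.

(** Positivity of delta - a leaves only levels 0 and 1. A root of level 0 splits off a finite simple
    root; one of level 1 splits off a finite simple root or alpha_0. *)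
Lemma affine_indecomposable a : apos a -> apos ((0, 1) - a) -> ~ asimple a ->
  exists b1 b2, [/\ apos b1, apos b2 & a = b1 + b2].
Proof.
move=> [c [k [-> Dc hk]]] ha na.
have {}ha : apos (- c, (1 - k)%:~R).
  by move: ha; rewrite rmorphB /= -[- c]add0r.
move: ha => /aposP[_ hk'].
have [k0|k1] : k = 0 \/ k = 1.
- by case: hk => [?|[? _]]; case: hk' => [?|[? _]]; lia.
- have pc : pos c by case: hk => [|[]//]; lia.
  have [|al alP pca] := pos_sub_simple rsD srP _ pc.
    by apply/negP => cP; apply: na; left; exists c; rewrite ?k0.
  exists (al, 0), (c - al, 0); split; try by apply/apos_finite.
    by apply/apos_finite; exact: simple_pos srP _ alP.
  by rewrite k0 -[RHS]/(al + (c - al), 0 + 0) addr0 addrC subrK.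
have pc : pos (- c) by case: hk' => [|[]//]; lia.
have ct : - c != theta.
  apply/eqP => e; apply: na; right; rewrite k1; congr pair.
  by rewrite -e opprK.
have ntc := le_theta htheta _ pc.
(* Level 1, so a = delta - (- c): if some simple root pairs positively with c, then c - al is a root
   and al is split off. *)
have [[al alP cal]|h] := pselect (exists2 al, al \in P & 0 < dot c al).
  have [Dal nal] := simple_pos srP _ alP.
  have cal_ne : c != al.
    apply/eqP => e; apply: (pos_asym rsD srP _ _ pc).
    by rewrite e; exact: simple_pos srP _ alP.
  have Dca : D (c - al) by exact: root_sub.
  exists (c - al, 1%:~R), (al, 0); split; first exact: apos_ge1.
    by apply/apos_finite; exact: simple_pos srP _ alP.
  by rewrite k1 -[RHS]/(c - al + al, 1 + 0) addr0 subrK.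
(* Now - c is dominant, hence (theta, - c) >= (c, c) > 0; so theta + c is a root and a is alpha_0
   plus this positive root. *)
have ctpos : 0 < dot (- c) theta.
  have : 0 <= dot (theta - - c) (- c).
    apply: nonneg_dot_ge0 ntc => al alP; rewrite dotNr oppr_ge0 leNgt dotC.
    by apply/negP => ?; apply: h; exists al.
  have := root_dot_gt0 rsD _ Dc.
  by rewrite !(dotDl, dotBr, dotNl, dotNr) opprK dotC; lra.
exists (- theta, 1%:~R), (theta - - c, 0); split.
- by apply: apos_ge1 => //; apply: root_opp rsD _ (theta_root htheta).
- apply/apos_finite; split=> //.
  by apply: (root_theta_sub rsD htheta) => //; exact: root_opp rsD _ Dc.
- by rewrite k1 -[RHS]/(- theta + (theta - - c), 1 + 0) opprK addr0 addKr.
Qed.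

(** Only the roots sent by w to the simple root [w x] or to its negative can change status; the
    first is x, the second is not positive. *)
Lemma inversions_add w x : affine_weyl D w -> apos x -> asimple (w x) ->
  inversions D P (arefl (w x) \o w) = x |` inversions D P w.
Proof.
move=> aw px sx.
have rwx := asimple_real rsD srP htheta _ sx; have a0 := areal_neq0 rsD _ rwx.
have pwx := asimple_apos rsD srP htheta _ sx.
have [v [av wv vw]] := affine_weyl_inv rsD _ aw.
apply/seteqP; split=> y.
  move=> [py ny]; have [->|yx] := eqVneq y x; first by left.
  right; have yx' : w y != w x by apply: contraNneq yx => /(can_inj wv) ->.
  have [e|yNx] := eqVneq (w y) (- w x).
    case: (apos_asym rsD srP _ px); rewrite (_ : - x = y) //.
    by apply: (can_inj wv); rewrite (affine_weylN _ aw) e.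
  by have [h _] := inversions_arefl rsD srP htheta ltheta w _ y aw sx py yx' yNx; apply: h.
move=> [->|[py ny]]; first by split=> //=; rewrite arefl_self // opprK.
have yx : w y != w x by apply/eqP => e; apply: (apos_asym rsD srP _ pwx); rewrite -e.
have yNx : w y != - w x.
  apply/eqP => e; case: (apos_asym rsD srP _ px); rewrite (_ : - x = y) //.
  by apply: (can_inj wv); rewrite (affine_weylN _ aw) e.
by have [_ h] := inversions_arefl rsD srP htheta ltheta w _ y aw sx py yx yNx; apply: h.
Qed.

Lemma peterson_inverted J w c : peterson D P J w -> J c -> apos (- w (- c, 1)).
Proof.
move=> [_ eN] Jc; have : inversions D P w (- c, 1) by rewrite eN; exists c.
by case.
Qed.

Lemma peterson_kept J w x : peterson D P J w -> apos x ->
  (forall c, J c -> x != (- c, 1)) -> apos (w x).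
Proof.
move=> [aw eN] px h; have rx := affine_weyl_real rsD _ aw _ (apos_real _ px).
have [//|nx] := apos_or_neg rsD srP _ rx.
have : inversions D P w x by [].
by rewrite eN => -[c /h] /[swap] ->; rewrite eqxx.
Qed.

(** All inversions have level 1, so w keeps the finite positive roots positive. *)
Lemma peterson_finite J w c : peterson D P J w -> pos c -> apos (w (c, 0)).
Proof.
move=> pw pc; apply: (peterson_kept _ _ _ pw); first exact/apos_finite.
by move=> g _; rewrite xpair_eqE negb_and orbC eq_sym oner_eq0.
Qed.

Lemma peterson_out J w c : peterson D P J w -> D c -> ~ J c -> apos (w (- c, 1)).
Proof.
move=> pw Dc Jc; apply: (peterson_kept _ _ _ pw); first exact: apos_delta_sub.
move=> g Jg; apply/eqP => -[/oppr_inj e]; apply: Jc; by rewrite e.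
Qed.

Lemma abelian_upper {I} u v :
  abelian_ideal D P I -> I u -> pos v -> nonneg P (v - u) -> I v.
Proof. by move=> [[_ h] _]; exact: h. Qed.

Lemma abelian_pos {I} u : abelian_ideal D P I -> I u -> pos u.
Proof. by move=> [[h _] _]; exact: h. Qed.

(** As delta - w (delta - g) = w g is positive, a nonsimple w (delta - g) would be a sum of two
    positive roots. Their preimages sum to delta - g, and every distribution of signs contradicts
    that J with g is an abelian ideal. *)
Lemma peterson_simple_up J w g : abelian_ideal D P (J `|` [set g]) ->
  peterson D P J w -> ~ J g -> asimple (w (- g, 1)).
Proof.
move=> aJ pw Jg; have [aw eN] := pw.
have J'g : (J `|` [set g]) g by right.
have pg := abelian_pos _ aJ J'g; have Dg := pos_root _ pg.
have pa := peterson_out _ _ _ pw Dg Jg.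
have pda : apos ((0, 1) - w (- g, 1)).
  rewrite -(affine_weyl_delta _ aw) -(affine_weylB _ aw).
  rewrite -[_ - _]/(0 - - g, 1 - 1) opprK add0r subrr.
  exact: (peterson_finite _ _ _ pw pg).
have [//|na] := pselect (asimple (w (- g, 1))).
have [b1 [b2 [pb1 pb2 eb]]] := affine_indecomposable _ pa pda na.
have [v [av wv vw]] := affine_weyl_inv rsD _ aw.
have evg : v b1 + v b2 = (- g, 1) by rewrite -(affine_weylD _ av) -eb wv.
have rv1 := affine_weyl_real rsD _ av _ (apos_real _ pb1).
have rv2 := affine_weyl_real rsD _ av _ (apos_real _ pb2).
(* If y is negative, then - y is an inversion delta - c with c in J, so y' = 2 delta - (g + c) and g
   + c would be a root. *)
have neg y y' : y + y' = (- g, 1) -> apos (w y) -> areal y' -> ~ apos (- y).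
  move=> e pwy ry' py.
  have : inversions D P w (- y) by split=> //; rewrite (affine_weylN _ aw) opprK.
  rewrite eN => -[c Jc ec].
  have J'c : (J `|` [set g]) c by left.
  have [Dc nc] := abelian_pos _ aJ J'c.
  have ey' : - y'.1 = g + c.
    have -> : y' = (- g, 1) - y by rewrite -e addrC addKr.
    by rewrite -ec -[LHS]/(- (- g - c)) opprD !opprK.
  case: aJ => _ /(_ g c J'g J'c); apply; split.
    by rewrite -ey'; apply: (root_opp rsD); case: ry'.
  by apply: nonnegD => //; case: pg.
(* If y' is a finite positive root c, then y = delta - (g + c); the root g + c lies in the ideal by
   upward closure, hence in J, and y would be inverted. *)
have both y y' : y + y' = (- g, 1) -> apos y -> apos y' -> apos (w y) -> y'.2 != 0.
  move=> e py py' pwy; apply/eqP => y'0.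
  case: y' e py' y'0 => c t /= e py' y'0; rewrite y'0 in e py'.
  move/apos_finite: py' => pc.
  have ey : y = (- (g + c), 1).
    have -> : y = (- g, 1) - (c, 0) by rewrite -e addrK.
    by rewrite -[LHS]/(- g - c, 1 - 0) subr0 opprD.
  have Dgc : D (g + c).
    by have [] := apos_real _ py; rewrite ey /= => /(root_of_opp rsD).
  have : (J `|` [set g]) (g + c).
    apply: (abelian_upper _ _ aJ J'g); last by rewrite addrAC subrr add0r; case: pc.
    by split=> //; apply: nonnegD; [case: pg|case: pc].
  case=> [Jgc|/= egc]; last first.
    have /(root_neq0 rsD) := pos_root _ pc.
    by rewrite -(addKr g c) egc addNr eqxx.
  move: pwy; rewrite ey => pwy.
  exact: (apos_asym rsD srP _ pwy (peterson_inverted _ _ _ pw Jgc)).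
have pv1 : apos (v b1).
  have [//|] := apos_or_neg rsD srP _ rv1 => /(neg _ _ evg).
  by rewrite vw => /(_ pb1 rv2).
have evg' : v b2 + v b1 = (- g, 1) by rewrite addrC.
have pv2 : apos (v b2).
  have [//|] := apos_or_neg rsD srP _ rv2 => /(neg _ _ evg').
  by rewrite vw => /(_ pb2 rv1).
(* Neither summand has level 0, but two positive levels cannot sum to 1. *)
have := both _ _ evg pv1 pv2; have := both _ _ evg' pv2 pv1; rewrite !vw.
move=> /(_ pb2) + /(_ pb1).
case: pv1 pv2 evg => [c1 [k1 [-> _ h1]]] [c2 [k2 [-> _ h2]]] /= [_ ek].
rewrite !intr_eq0 => k10 k20.
have : k1 + k2 = 1 by apply/eqP; rewrite -(eqr_int R) rmorphD /= ek.
by case: h1 => [?|[? _]]; case: h2 => [?|[? _]]; lia.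
Qed.

Lemma peterson_up J w g : abelian_ideal D P (J `|` [set g]) ->
  peterson D P J w -> ~ J g ->
  peterson D P (J `|` [set g]) (arefl (w (- g, 1)) \o w).
Proof.
move=> aJ pw Jg; have sa := peterson_simple_up _ _ _ aJ pw Jg.
have [aw eN] := pw; have Dg : D g by apply: pos_root (abelian_pos _ aJ _); right.
split; first by apply: (affine_weyl_comp (arefl _)) aw; apply: affine_weyl_arefl;
  exact: asimple_real rsD srP htheta _ sa.
rewrite inversions_add //; last exact: apos_delta_sub.
by rewrite eN image_setU image_set1 setUC.
Qed.

(** Set a = - w (delta - g). Then delta - a = w (2 delta - g) is positive because roots of level 2
    are never inverted, so a nonsimple a would split into two positive roots; minimality of g and a
    comparison of levels exclude this. *)
Lemma peterson_simple_down J w g : abelian_ideal D P J -> peterson D P J w ->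
  J g -> (forall v, J v -> root_le P v g -> v = g) -> asimple (- w (- g, 1)).
Proof.
move=> aJ pw Jg ming; have [aw eN] := pw.
have pg := abelian_pos _ aJ Jg; have Dg := pos_root _ pg.
have pa := peterson_inverted _ _ _ pw Jg.
have pda : apos ((0, 1) - - w (- g, 1)).
  rewrite opprK -(affine_weyl_delta _ aw) -(affine_weylD _ aw).
  rewrite -[_ + _]/(0 + - g, (1 + 1)) add0r.
  apply: (peterson_kept _ _ _ pw).
    apply: (apos_ge1 (- g) 2) => //.
    exact: (root_opp rsD).
  by move=> c _; rewrite xpair_eqE negb_and orbC -subr_eq0 addrK oner_eq0.
have [//|na] := pselect (asimple (- w (- g, 1))).
have [b1 [b2 [pb1 pb2 eb]]] := affine_indecomposable _ pa pda na.
have [v [av wv vw]] := affine_weyl_inv rsD _ aw.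
have evg : - v b1 + - v b2 = (- g, 1).
  by rewrite -opprD -(affine_weylD _ av) -eb (affine_weylN _ av) wv opprK.
have rv1 := affine_weyl_real rsD _ av _ (apos_real _ pb1).
have rv2 := affine_weyl_real rsD _ av _ (apos_real _ pb2).
have inv y : apos (- v y) -> apos y -> exists2 c, J c & (- c, 1) = - v y.
  move=> py pwy.
  have : inversions D P w (- v y) by split=> //; rewrite (affine_weylN _ aw) opprK vw.
  by rewrite eN => -[c Jc ec]; exists c.
(* If v y is positive, then - v y' = (delta - g) + v y is positive and inverted, say delta - c with
   c in J; then v y = g - c puts c strictly below g. *)
have neg y y' : - v y + - v y' = (- g, 1) -> apos y -> apos y' -> ~ apos (v y).
  move=> e py py' pvy.
  have ey' : - v y' = (- g, 1) + v y by rewrite -e addrAC addNr add0r.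
  have pvy' : apos (- v y').
    have rvy' := affine_weyl_real rsD _ av _ (apos_real _ py').
    have [Dvy' _] := rvy'; have rN := arealN rsD _ rvy'.
    case: pvy ey' rN => [c [k [-> _ hk]]] -> [/= D' [j]] /= ej.
    rewrite -[X in affine_positive _ _ X]/(- g + c, 1 + k%:~R).
    rewrite -[1]/((1 : int)%:~R) -rmorphD; apply: apos_ge1 => //.
    by case: hk => [?|[? _]]; lia.
  have [c Jc ec] := inv _ pvy' py'.
  have vyE : v y = (g - c, 0).
    have -> : v y = (- c, 1) - (- g, 1) by rewrite ec ey' addrC addKr.
    by rewrite -[LHS]/(- c - - g, 1 - 1) opprK subrr addrC.
  move: pvy; rewrite vyE => /apos_finite[Dgc ngc].
  have /(root_neq0 rsD) := Dgc; rewrite subr_eq0 => /eqP; apply.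
  exact/esym/ming.
have pv1 : apos (- v b1).
  by have [/(neg _ _ evg pb1 pb2)|] := apos_or_neg rsD srP _ rv1.
have pv2 : apos (- v b2).
  have [|//] := apos_or_neg rsD srP _ rv2.
  by rewrite addrC in evg => /(neg _ _ evg pb2 pb1).
(* Both summands are inversions, hence of level 1, whereas their sum delta - g also has level 1. *)
have [c1 _ e1] := inv _ pv1 pb1; have [c2 _ e2] := inv _ pv2 pb2.
move: evg; rewrite -e1 -e2 => -[_ /eqP].
by rewrite -subr_eq0 addrK oner_eq0.
Qed.

(** The reflected element sends delta - g to the simple root a, so [inversions_add] applied to it
    recovers w and shows that exactly delta - g is lost. *)
Lemma peterson_down J w g : abelian_ideal D P J -> peterson D P J w ->
  J g -> (forall v, J v -> root_le P v g -> v = g) ->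
  peterson D P (J `\ g) (arefl (- w (- g, 1)) \o w).
Proof.
move=> aJ pw Jg ming; have sa := peterson_simple_down _ _ _ aJ pw Jg ming.
have [aw eN] := pw; have Dg := pos_root _ (abelian_pos _ aJ Jg).
set a := - w (- g, 1) in sa *.
have ra := asimple_real rsD srP htheta _ sa; have a0 := areal_neq0 rsD _ ra.
have aw' : affine_weyl D (arefl a \o w).
  by apply: (affine_weyl_comp (arefl _)) aw; exact: affine_weyl_arefl.
split=> //.
have wg : (arefl a \o w) (- g, 1) = a.
  rewrite /= -[w (- g, 1)]opprK -/a -[- a in LHS](arefl_self _ a0).
  by rewrite areflK.
have pg : apos (- g, 1) by exact: apos_delta_sub.
have := inversions_add (arefl a \o w) (- g, 1) aw' pg; rewrite wg => /(_ sa).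
have -> : arefl a \o (arefl a \o w) = w by apply/funext => x /=; rewrite areflK.
rewrite eN => e; apply/seteqP; split=> x.
  move=> ix; have : ([set (- c, 1) | c in J] : set A) x by rewrite e; right.
  move=> [c Jc ex]; exists c => //; split=> //= ecg.
  case: ix => _; rewrite -ex ecg wg => pNa.
  by apply: (apos_asym rsD srP _ (asimple_apos rsD srP htheta _ sa)).
move=> [c [Jc cg] ex]; have : ([set (- c, 1) | c in J] : set A) x by exists c.
rewrite e => -[/= exg|//]; case: cg.
by move: exg; rewrite -ex => -[/oppr_inj].
Qed.

End PetersonStep.

(** * Rootlets *)

Section SubsetCount.

Context {T : choiceType} {s : seq T}.
Hypothesis us : uniq s.
Implicit Types (J K : set T).

Definition cnt J : nat := count (fun v => `[< J v >]) s.

Lemma cnt_le J K : J `<=` K -> (cnt J <= cnt K)%N.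
Proof. by move=> JK; apply: sub_count => v /asboolP /JK /asboolP. Qed.

Lemma cnt_set0 : cnt set0 = 0%N.
Proof.
by rewrite /cnt -[RHS](count_pred0 s); apply: eq_count => v; apply/asboolP.
Qed.

Lemma cnt_setU1 J g : g \in s -> ~ J g -> cnt (J `|` [set g]) = (cnt J).+1.
Proof.
move=> gs Jg; rewrite /cnt.
have := count_predUI (fun v => `[< J v >]) (pred1 g) s.
rewrite [X in (_ + X)%N](@eq_count _ _ pred0); last first.
  by move=> v /=; apply/negP => /andP[/asboolP Jv /eqP vg]; apply: Jg; rewrite -vg.
rewrite count_pred0 addn0 count_uniq_mem // gs addn1 => <-; apply: eq_count => v.
apply/asboolP/idP => /=.
  by case=> [?|->]; rewrite ?eqxx ?orbT //; apply/orP; left; apply/asboolP.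
by case/orP => [/asboolP|/eqP]; [left|right].
Qed.

Lemma cnt_setD1 J g : g \in s -> J g -> cnt J = (cnt (J `\ g)).+1.
Proof.
move=> gs Jg; rewrite -(cnt_setU1 (J `\ g) g gs); last by case=> _; apply.
by rewrite setUC setD1K.
Qed.

Lemma cnt_ge_sub J K : J `<=` K -> (forall v, K v -> v \in s) ->
  (cnt K <= cnt J)%N -> K `<=` J.
Proof.
move=> JK Ks le v Kv; apply: contrapT => Jv.
have : (cnt (J `|` [set v]) <= cnt K)%N by apply: cnt_le => u [/JK|->].
by rewrite cnt_setU1 ?Ks //; move: le; lia.
Qed.

Lemma size_le_cnt J (r : seq T) : uniq r -> (forall v, v \in r -> v \in s /\ J v) ->
  (size r <= cnt J)%N.
Proof.
move=> ur h; rewrite /cnt -size_filter; apply: uniq_leq_size => // v /h[vs Jv].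
by rewrite mem_filter vs andbT; apply/asboolP.
Qed.

Lemma cnt_le_size J (r : seq T) : (forall v, v \in s -> J v -> v \in r) ->
  (cnt J <= size r)%N.
Proof.
move=> h; rewrite /cnt -size_filter; apply: uniq_leq_size; first exact: filter_uniq.
by move=> v; rewrite mem_filter => /andP[/asboolP Jv vs]; exact: h.
Qed.

End SubsetCount.

Section Rootlets.

Context {R : realFieldType} {m : nat} {D : set 'rV[R]_m} {P : seq 'rV[R]_m}.
Context {theta : 'rV[R]_m}.
Hypotheses (rsD : root_system D) (srP : simple_roots D P).
Hypotheses (htheta : highest_root D P theta).
Hypotheses (ltheta : forall b, D b -> dot b b <= dot theta theta).
Local Notation A := ('rV[R]_m * R)%type.
Implicit Types (a b x y : A) (w : A -> A) (g u v c mu : 'rV[R]_m).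
Implicit Types (I J K : set 'rV[R]_m).

Local Notation pos := (positive D P).
Local Notation areal := (@areal R m D).
Local Notation asimple := (@asimple R m P theta).

Context {s : seq 'rV[R]_m}.
Hypotheses (us : uniq s) (Ds : forall v, (v \in s) <-> D v).
(* By [hB] and [hP], [h c] is the coroot height of a long root [c]. *)
Context {h : 'rV[R]_m -> R}.
Hypotheses (hB : forall t u v, h (u - t *: v) = h u - t * h v).
Hypotheses (hP : forall al : 'rV[R]_m, al \in P -> h al * dot theta theta = dot al al).
Local Notation cnt := (@cnt _ s).

(** [theta] is left out: it lies in every nonempty abelian ideal, and the remaining elements are
    exactly those that lower the coroot height of the rootlet, by one each. *)
Definition heisenberg : set 'rV[R]_m :=
  [set b | [/\ pos b, 0 < dot b theta & b <> theta]].

Lemma minimal_root K : K !=set0 -> K `<=` pos ->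
  exists2 g, K g & forall v, K v -> root_le P v g -> v = g.
Proof.
move=> [g0 Kg0] Kp; have frP := sr_free srP.
have [n hn] := ht_nat P frP _ (Kp _ Kg0).2.
have : ht P g0 < n.+1%:R by rewrite hn ltr_nat.
move: n.+1 => {hn}n; elim: n g0 Kg0 => [|n IH] g Kg hg.
  have := ht_nat P frP _ (Kp _ Kg).2 => -[k hk].
  by move: hg; rewrite hk ltr_nat.
have [[v [Kv nv vg]]|hmin] := pselect (exists v, [/\ K v, root_le P v g & v <> g]).
  apply: (IH v) => //.
  have := ht_ge1 P frP _ nv; rewrite subr_eq0 eq_sym htB => /(_ (introN eqP vg)).
  by move: hg; rewrite -addn1 natrD; lra.
exists g => // v Kv nv; apply: contrapT => vg; apply: hmin; by exists v.
Qed.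

Lemma maximal_root K : K !=set0 -> K `<=` pos ->
  exists2 g, K g & forall v, K v -> root_le P g v -> v = g.
Proof.
move=> [g0 Kg0] Kp; have frP := sr_free srP.
have [n hn] := ht_nat P frP _ (le_theta htheta _ (Kp _ Kg0)).
have : ht P (theta - g0) < n.+1%:R by rewrite hn ltr_nat.
move: n.+1 => {hn}n; elim: n g0 Kg0 => [|n IH] g Kg hg.
  have := ht_nat P frP _ (le_theta htheta _ (Kp _ Kg)) => -[k hk].
  by move: hg; rewrite hk ltr_nat.
have [[v [Kv nv vg]]|hmax] := pselect (exists v, [/\ K v, root_le P g v & v <> g]).
  apply: (IH v) => //.
  have := ht_ge1 P frP _ nv; rewrite subr_eq0 htB => /(_ (introN eqP vg)).
  by move: hg; rewrite !htB -addn1 natrD; lra.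
exists g => // v Kv nv; apply: contrapT => vg; apply: hmax; by exists v.
Qed.

Lemma abelian_theta {J} : abelian_ideal D P J -> J !=set0 -> J theta.
Proof.
move=> aJ [g Jg]; apply: (abelian_upper g theta aJ Jg); first exact: theta_pos htheta.
by apply: (le_theta htheta); exact: (abelian_pos g aJ Jg).
Qed.

Lemma abelian_remove J g : abelian_ideal D P J ->
  (forall v, J v -> root_le P v g -> v = g) -> abelian_ideal D P (J `\ g).
Proof.
move=> aJ ming; split; last by move=> u v [Ju _] [Jv _]; case: aJ => _; apply.
split=> [u [Ju _]|u v [Ju ug] pv nuv]; first exact: abelian_pos u aJ Ju.
split; first exact: (abelian_upper u v aJ Ju pv nuv).
by move=> /= vg; apply: ug; apply: ming => //; rewrite -vg.
Qed.

Lemma root_int_scale_nonneg u v al : D u -> D v -> al \in P -> 0 <= cartan u v ->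
  nonneg P (cartan u v *: al).
Proof.
move=> Du Dv aP; have [k ->] := rs_crystallographic rsD Du Dv; rewrite ler0z.
case: k => // n _; rewrite -[_%:~R]/(n%:R) scaler_nat.
by apply: nonnegMn; exact: nonneg_mem.
Qed.

Lemma heisenberg_sub_theta g : heisenberg g -> D (theta - g).
Proof.
by move=> [[Dg _] g0 /eqP gt]; exact: (root_theta_sub rsD htheta).
Qed.

Lemma heisenberg_cartan g : heisenberg g -> cartan g theta = 1.
Proof.
by move=> [[Dg _] g0 /eqP gt]; exact: (cartan_theta rsD htheta ltheta).
Qed.

Lemma theta_cartan_self : cartan theta theta = 2.
Proof. by rewrite cartan_self // (root_neq0 rsD) //; exact: theta_root htheta. Qed.

(** The sum pairs to 2 with the coroot of theta, a value that only theta attains. *)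
Lemma heisenberg_pair g v : heisenberg g -> heisenberg v -> D (g + v) ->
  v = theta - g.
Proof.
move=> Hg Hv Dgv; have : g + v = theta.
  apply: (cartan_theta_eq2 rsD htheta ltheta) => //.
  by rewrite cartanDl !heisenberg_cartan //; lra.
by move=> <-; rewrite addrAC subrr add0r.
Qed.

(* By induction on [J], removing minimal elements. The last clause is the
   invariant that controls the next root to be adjoined. *)
Lemma rootlet_structure J w : abelian_ideal D P J -> J !=set0 -> peterson D P J w ->
  [/\ (w (- theta, 2)).2 = 0,
      forall g, J g -> 0 < dot g theta -> root_le P (w (- theta, 2)).1 g,
      h (w (- theta, 2)).1 = h theta - (cnt (J `&` heisenberg))%:R &
      (forall g, J g -> 0 < dot g theta) -> forall g, heisenberg g -> ~ J g ->
        (w (- (theta - g), 1)).2 = 0 /\ nonneg P (g - (w (- (theta - g), 1)).1)].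
Proof.
have Dt := theta_root htheta; have t0 := root_neq0 rsD _ Dt.
have ttpos := root_dot_gt0 rsD _ Dt.
have [n] := ubnP (cnt J); elim: n J w => // n IH J w + aJ J0 pw.
rewrite ltnS => cJ; have [aw eN] := pw; have Jt := abelian_theta aJ J0.
have remove g : J g -> (forall v, J v -> root_le P v g -> v = g) ->
  let a := - w (- g, 1) in
  [/\ asimple a, abelian_ideal D P (J `\ g), peterson D P (J `\ g) (arefl a \o w),
      (cnt (J `\ g) < n)%N & involutive (arefl a)].
  move=> Jg ming; have sa := peterson_simple_down rsD srP htheta J w g aJ pw Jg ming.
  split=> //; first exact: abelian_remove.
  - exact: peterson_down rsD srP htheta ltheta J w g aJ pw Jg ming.
  - by rewrite (cnt_setD1 us J g) in cJ => //; apply/Ds; exact: pos_root (abelian_pos g aJ Jg).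
  - by apply: areflK; exact: areal_neq0 rsD _ (asimple_real rsD srP htheta _ sa).
(* If J has an element orthogonal to theta, a minimal such element is minimal in all of J, because
   the product with theta is monotone. Removing it reflects in a root orthogonal to the image of 2
   delta - theta, and the last clause is vacuous. *)
have [[g0 [Jg0 g0t]]|allH] := pselect (exists g, J g /\ ~ 0 < dot g theta).
  have [|u [Ju _]|g [Jg gH] ming] := minimal_root (J `&` [set g | ~ 0 < dot g theta]).
  - by exists g0.
  - exact: abelian_pos u aJ Ju.
  have gt0 : dot g theta = 0.
    apply/eqP; rewrite eq_le leNgt; apply/andP; split; first exact/negP.
    exact: pos_dot_theta rsD srP htheta g (abelian_pos g aJ Jg).
  have ming' v : J v -> root_le P v g -> v = g.
    move=> Jv nvg; apply: ming => //; split=> //= vt.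
    have := nonneg_dot_theta rsD srP htheta _ nvg.
    by rewrite dotBl gt0; lra.
  have [sa aJ' pw' cJ' _] := remove g Jg ming'; set a := - w (- g, 1) in sa pw'.
  have tg : theta <> g by move=> e; rewrite -e in gt0; move: ttpos; rewrite gt0 ltxx.
  have J'0 : (J `\ g) !=set0 by exists theta.
  have [] := IH _ _ cJ' aJ' J'0 pw'.
  have -> : (arefl a \o w) (- theta, 2) = w (- theta, 2).
    rewrite /= areflE /a /cartan /= dotNr (affine_weyl_dot rsD _ aw) /=.
    rewrite dotNl dotNr opprK dotC gt0 oppr0 mulr0 mul0r.
    by rewrite /asub scale0r mul0r !subr0; case: (w _).
  have -> : (J `\ g) `&` heisenberg = J `&` heisenberg.
    apply/seteqP; split=> v [] /=; first by move=> [].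
    move=> Jv Hv; split=> //; split=> // /= vg; apply: gH; rewrite -vg.
    by case: Hv.
  move=> e2 low hmu _; split=> //.
    by move=> v Jv vt; apply: low => //; split=> // /= vg; rewrite vg gt0 ltxx in vt.
  by move=> allH; move: (allH _ Jg0).
have {}allH g : J g -> 0 < dot g theta.
  by move=> Jg; apply: contrapT => ngt; apply: allH; exists g.
have [//|u Ju|g Jg ming] := minimal_root J; first exact: abelian_pos u aJ Ju.
have [sa aJ' pw' cJ' aK] := remove g Jg ming; set a := - w (- g, 1) in sa pw' aK.
have ra := asimple_real rsD srP htheta _ sa; have a0 := areal_neq0 rsD _ ra.
have Dg : D g by apply: pos_root (abelian_pos g aJ Jg).
(* Base case: J = {theta}. Removing theta leaves no inversion, so w is a reflection, and its root is
   found to be delta - theta. *)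
have [gt|/eqP gt] := eqVneq g theta.
  have Jt1 v : J v -> v = theta.
    by move=> Jv; rewrite -gt; apply: ming => //; rewrite gt; apply: (le_theta htheta);
      exact: abelian_pos v aJ Jv.
  have w'id : arefl a \o w = id.
    apply: (no_inversion_id rsD srP htheta ltheta); first by case: pw'.
    case: pw' => _ ->; rewrite -subset0 => x [v [Jv vg]] _.
    by apply: vg; rewrite gt; exact: Jt1.
  have wE x : w x = arefl a x by rewrite -[w x]aK -[arefl a (w x)]/((arefl a \o w) x) w'id.
  have aE : a = (- theta, 1).
    apply: oppr_inj; rewrite -(arefl_self a a0).
    have -> : arefl a a = arefl a (- arefl a (- g, 1)) by rewrite -(wE (- g, 1)).
    by rewrite (affine_weylN _ (affine_weyl_arefl a ra)) aK gt.
  have muE : w (- theta, 2) = (theta, 0).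
    rewrite wE aE /arefl /= cartanNN theta_cartan_self refl_self ?oppr_eq0 //.
    by rewrite opprK mul1r subrr.
  rewrite muE; split=> //=.
  - by move=> v /Jt1 -> _; exact: root_le_refl.
  - rewrite (_ : _ `&` _ = set0) ?cnt_set0 ?subr0 //.
    by rewrite -subset0 => v [/Jt1 -> []].
  - move=> _ v Hv _; rewrite wE aE /arefl /= cartanNN cartanBl theta_cartan_self.
    rewrite heisenberg_cartan // (_ : 2 - 1 = 1 :> R); last by ring.
    rewrite mul1r subrr; split=> //.
    rewrite /refl cartanNN cartanBl theta_cartan_self heisenberg_cartan //.
    rewrite (_ : 2 - 1 = 1 :> R); last by ring.
    rewrite scale1r opprK opprB subrK subrr; exact: nonneg0.
have Hg : heisenberg g by split=> //; [exact: abelian_pos g aJ Jg|exact: allH].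
have J'0 : (J `\ g) !=set0 by exists theta; split=> // /= e; exact: gt.
have [aw' _] := pw'.
set w' := arefl a \o w in pw' aw'.
have wE x : w x = arefl a (w' x) by rewrite /w' /= aK.
have w'g : w' (- g, 1) = a.
  rewrite /w' /= -[w (- g, 1)]opprK -/a (affine_weylN _ (affine_weyl_arefl a ra)).
  by rewrite arefl_self // opprK.
have [e2 low hmu inv] := IH _ _ cJ' aJ' J'0 pw'.
have {}inv := inv (fun v Jv => allH v Jv.1).
(* The last clause for the smaller ideal, applied to the removed root g itself. *)
have [wg2 wgn] : (w' (- (theta - g), 1)).2 = 0 /\
    nonneg P (g - (w' (- (theta - g), 1)).1) by apply: inv => //; case=> _; apply.
have sum : w' (- g, 1) + w' (- (theta - g), 1) = w' (- theta, 2).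
  rewrite -(affine_weylD _ aw'); congr w'.
  rewrite -[LHS]/(- g + - (theta - g), 1 + 1); congr pair.
  by rewrite opprB addKr.
(* In the splitting of 2 delta - theta the other two terms have level 0, so the simple root a is not
   alpha_0. *)
have a2 : a.2 = 0.
  move: (congr1 snd sum); rewrite w'g e2 -[LHS]/(a.2 + (w' (- (theta - g), 1)).2).
  by rewrite wg2 addr0.
have [al alP aE] : exists2 al, al \in P & a = (al, 0).
  by case: sa => // e; move: a2; rewrite e /= => /eqP; rewrite oner_eq0.
set mu' := w' (- theta, 2) in e2 low hmu sum.
have sum1 : al + (w' (- (theta - g), 1)).1 = mu'.1.
  by rewrite -sum w'g aE.
have wmu : w (- theta, 2) = arefl a mu' by rewrite wE.
have kE : cartan mu'.1 al = cartan theta g.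
  have -> : al = (w' (- g, 1)).1 by rewrite w'g aE.
  by rewrite (affine_weyl_cartan rsD _ aw') /= cartanNN.
clearbody mu'.
have k1 : 1 <= cartan theta g.
  apply: (cartan_ge1 rsD) => //; rewrite cartan_gt0 ?(root_neq0 rsD) // dotC.
  exact: allH.
have muE : w (- theta, 2) = (mu'.1 - cartan theta g *: al, 0).
  by rewrite wmu aE /arefl /refl /= kE mul0r e2 subr0.
have nal := nonneg_mem P _ alP.
have nk1 : nonneg P ((cartan theta g - 1) *: al).
  have [k kk] := rs_crystallographic rsD Dt Dg.
  move: k1; rewrite kk (_ : 1 = (1 : int)%:~R) // ler_int -rmorphB /= => k1.
  have -> : (k - 1)%:~R = `|k - 1|%N%:R :> R.
    by rewrite -[RHS]/(`|k - 1|%:Z%:~R) gez0_abs ?subr_ge0.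
  by rewrite scaler_nat; exact: nonnegMn.
have nk : nonneg P (cartan theta g *: al).
  by apply: root_int_scale_nonneg => //; lra.
rewrite muE; split=> //=.
(* For v = g, one copy of al is absorbed in passing from mu' to the image of delta - (theta - g),
   which is at most g; k - 1 further copies are subtracted. For the other v the rootlet only went
   down. *)
- move=> v Jv vt; rewrite /root_le; have [->|/eqP vg] := eqVneq v g.
    rewrite -sum1 (_ : _ - _ = (g - (w' (- (theta - g), 1)).1) + (cartan theta g - 1) *: al).
      exact: nonnegD.
    by apply/rowP => i; rewrite !mxE; ring.
  rewrite opprB addrCA addrC; apply: nonnegD => //.
  by apply: low.
(* al has the length of g, so k |al|^2 = 2 (theta, g) = |theta|^2, the last step because <g,
   theta^v> = 1. *)
- have hal : cartan theta g * h al = 1.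
    apply: (mulIf (lt0r_neq0 ttpos)); rewrite -mulrA hP // mul1r.
    have -> : dot al al = dot g g.
      have -> : al = (w' (- g, 1)).1 by rewrite w'g aE.
      by rewrite (affine_weyl_dot rsD _ aw') /= dotNl dotNr opprK.
    rewrite cartan_dot ?(root_neq0 rsD) // dotC -(cartan_dot g theta) //.
    by rewrite heisenberg_cartan // mul1r.
  rewrite hB hmu hal (cnt_setD1 us (J `&` heisenberg) g) //; last exact/Ds.
  have -> : (J `&` heisenberg) `\ g = (J `\ g) `&` heisenberg.
    by rewrite [RHS]setIC setIDA (setIC heisenberg).
  by rewrite -natr1; ring.
- move=> _ v Hv Jv; have [w2 wn] : (w' (- (theta - v), 1)).2 = 0 /\
      nonneg P (v - (w' (- (theta - v), 1)).1) by apply: inv => // -[].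
  have ce : cartan (w' (- (theta - v), 1)).1 al = cartan (theta - v) g.
    have -> : al = (w' (- g, 1)).1 by rewrite w'g aE.
    by rewrite (affine_weyl_cartan rsD _ aw') /= cartanNN.
  rewrite wE; move: (w' (- (theta - v), 1)) w2 wn ce => y w2 wn ce.
  rewrite aE /arefl /refl /= w2 mul0r subr0 ce; split=> //.
  rewrite opprB addrCA addrC; apply: nonnegD => //.
  have Dtv := heisenberg_sub_theta _ Hv.
  apply: root_int_scale_nonneg => //; rewrite leNgt; apply/negP => neg.
  (* A negative product would make theta - v + g a root that pairs to 2 - 1 + 1 with the coroot of
     theta; it would be theta, so v = g, which lies in J. *)
  have dneg : dot (theta - v) g < 0.
    rewrite ltNge; apply/negP => d0; move: neg; rewrite ltNge /cartan => /negP; apply.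
    by rewrite divr_ge0 ?dot_sqr_ge0 // mulr_ge0.
  have tvg : theta - v != - g.
    apply/eqP => e; have pg := abelian_pos g aJ Jg.
    apply: (pos_asym rsD srP g pg); rewrite -e; split=> //.
    by apply: (le_theta htheta); case: Hv.
  have Dtvg := root_add rsD _ _ Dtv Dg tvg dneg.
  apply: Jv; rewrite (_ : v = g) //.
  have : theta - v + g = theta.
    apply: (cartan_theta_eq2 rsD htheta ltheta) => //.
    by rewrite cartanDl cartanBl theta_cartan_self !heisenberg_cartan //; lra.
  move=> /eqP; rewrite -subr_eq0 => /eqP e.
  apply/eqP; rewrite eq_sym -subr_eq0 -e; apply/eqP.
  by apply/rowP => i; rewrite !mxE; ring.
Qed.

End Rootlets.

(** * Ideals with a prescribed long rootlet and the criterion for amazing roots *)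

Section AmazingCriterion.

Context {R : realFieldType} {m : nat} {D : set 'rV[R]_m} {P : seq 'rV[R]_m}.
Context {theta : 'rV[R]_m}.
Hypotheses (rsD : root_system D) (srP : simple_roots D P).
Hypotheses (htheta : highest_root D P theta).
Hypotheses (ltheta : forall b, D b -> dot b b <= dot theta theta).
Local Notation A := ('rV[R]_m * R)%type.
Implicit Types (a b x y : A) (w : A -> A) (g u v c mu : 'rV[R]_m).
Implicit Types (I J K : set 'rV[R]_m).

Local Notation pos := (positive D P).
Local Notation apos := (affine_positive D P).
Local Notation areal := (@areal R m D).
Local Notation asimple := (@asimple R m P theta).
Local Notation heisenberg := (@heisenberg R m D P theta).

(** The reflection adds al at least once, so it strictly raises the height; this drives the
    induction from mu up to theta. *)
Lemma long_refl_neg c al : pos c -> dot c c = dot theta theta ->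
  al \in P -> dot c al < 0 -> pos (refl al c) /\ nonneg P (refl al c - al - c).
Proof.
move=> [Dc nc] lc alP cal; have [Dal nal] := simple_pos srP _ alP.
have al0 := root_neq0 rsD _ Dal.
have cN : 0 < - cartan c al.
  by rewrite -cartanNl cartan_gt0 // dotNl oppr_gt0.
have k1 : 1 <= - cartan c al.
  by rewrite -cartanNl; apply: (cartan_ge1 rsD); rewrite ?cartanNl //; exact: (root_opp rsD).
have [k kE] := rs_crystallographic rsD Dc Dal.
have nk : nonneg P ((- cartan c al - 1) *: al).
  move: k1; rewrite kE -rmorphN (_ : 1 = (1 : int)%:~R) // ler_int -rmorphB /= => k1.
  have -> : (- k - 1)%:~R = `|- k - 1|%N%:R :> R.
    by rewrite -[RHS]/(`|- k - 1|%:Z%:~R) gez0_abs ?subr_ge0.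
  by rewrite scaler_nat; exact: nonnegMn.
have e : refl al c - al - c = (- cartan c al - 1) *: al.
  by rewrite /refl; apply/rowP => i; rewrite !mxE; ring.
split; last by rewrite e.
split; first exact: rs_refl.
have -> : refl al c = (refl al c - al - c) + (al + c).
  by apply/rowP => i; rewrite !mxE; ring.
by rewrite e; apply: nonnegD => //; exact: nonnegD.
Qed.

(* Reflecting [theta] downwards in simple roots reaches [mu], and each
   reflection adjoins one root to [J]. *)
Lemma long_rootlet mu : pos mu -> dot mu mu = dot theta theta ->
  exists J w, [/\ abelian_ideal D P J, peterson D P J w, w (- theta, 2) = (mu, 0),
    J theta & forall g, J g -> 0 < dot g theta].
Proof.
have Dt := theta_root htheta; have t0 := root_neq0 rsD _ Dt.
have pt := theta_pos htheta; have ttpos := root_dot_gt0 rsD _ Dt.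
have frP := sr_free srP.
move=> pmu lmu.
have [n hn] := ht_nat P frP _ (le_theta htheta _ pmu).
have : ht P (theta - mu) < n.+1%:R by rewrite hn ltr_nat.
move: n.+1 => {hn}n; elim: n mu pmu lmu => [|n IH] mu pmu lmu hmu.
  have := ht_nat P frP _ (le_theta htheta _ pmu) => -[k hk].
  by move: hmu; rewrite hk ltr_nat.
have [->|mut] := eqVneq mu theta.
  exists [set theta], (arefl (- theta, 1)).
  have ra := areal_delta rsD _ Dt; have sa : asimple (- theta, 1) by right.
  split=> //; last by move=> g ->.
  - split; last first.
      move=> u v -> ->; rewrite -mulr2n -scaler_nat => -[D2t _].
      by have [] := rs_reduced rsD Dt D2t => h; exfalso; move: h; lra.
    split=> [u ->//|u v -> pv nvt].
    by apply: (root_le_anti P frP) => //; exact: le_theta htheta _ pv.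
  - split; first exact: affine_weyl_arefl.
    have := inversions_add rsD srP htheta ltheta id (- theta, 1) (AffineWeyl_id _)
      (apos_delta_sub rsD _ Dt) sa.
    rewrite -[X in inversions D P X = _]/(arefl (- theta, 1)) => ->.
    rewrite image_set1 (_ : inversions D P id = set0) ?setU0 //.
    by rewrite -subset0 => x [px /(apos_asym rsD srP _ px)].
  - rewrite /arefl /= cartanNN (theta_cartan_self rsD htheta) // refl_self ?oppr_eq0 //.
    by rewrite opprK mul1r subrr.
have [al alP mual] := long_neg_simple htheta _ pmu lmu mut.
have [Dal nal] := simple_pos srP _ alP; have al0 := root_neq0 rsD _ Dal.
have [pmu1 nmu1] := long_refl_neg _ _ pmu lmu alP mual.
set mu1 := refl al mu in pmu1 nmu1.
have lmu1 : dot mu1 mu1 = dot theta theta by rewrite refl_dot.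
have mu1al : 0 < dot al mu1.
  have := refl_dot al al mu al0; rewrite refl_self // dotNl -/mu1 (dotC al mu).
  by move: mual; lra.
have mu1E : refl al mu1 = mu.
  rewrite /mu1 /refl cartanBl cartanZl cartan_self //.
  by apply/rowP => i; rewrite !mxE; ring.
have hmu1 : ht P (theta - mu1) < n%:R.
  have [k hk] := ht_nat P frP _ nmu1.
  move: hk hmu; rewrite !htB (ht_simple P frP _ alP) -natr1.
  by have := ler0n R k; lra.
have [J [w [aJ pw wmu1 Jt JH]]] := IH _ pmu1 lmu1 hmu1.
have [aw eN] := pw; have [v [av wv vw]] := affine_weyl_inv rsD _ aw.
have sal : asimple (al, 0) by left; exists al.
have pal : apos (al, 0) := asimple_apos rsD srP htheta _ sal.
have mu1al_ne : mu1 != al.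
  apply/eqP => e; apply: (pos_asym rsD srP _ pmu).
  by rewrite -mu1E e refl_self // opprK; exact: simple_pos srP _ alP.
have pmal : pos (mu1 - al).
  apply: (pos_add_ge _ mu) => //.
  by apply: (root_sub rsD) => //; [case: pmu1|rewrite dotC].
have apmal : apos (mu1 - al, 0) by apply/apos_finite.
(* A positive root of level below 1 is finite and pairs nonnegatively with theta; a negative root
   sent to a positive one is c - delta with c in J, and pairs positively with theta. *)
have noneg x : apos (w x) -> areal x -> (x.2 < 1) -> dot x.1 theta < 0 -> False.
  move=> pwx rx x2 xt; have [px|nx] := apos_or_neg rsD srP _ rx.
    have := pos_dot_theta rsD srP htheta _ (apos_lt1 _ px x2).
    by rewrite leNgt xt.
  have : inversions D P w (- x) by split=> //; rewrite (affine_weylN _ aw) opprK.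
  rewrite eN => -[c Jc ec].
  have := JH _ Jc; rewrite -oppr_lt0 -dotNl; move: (congr1 fst ec) => /= ->.
  by rewrite dotNl; lra.
(* The candidate x = delta - c is the preimage of al: adjoining c then reflects mu1 in al, which
   gives mu. *)
have [x [xE rx xt]] : exists x, [/\ w x = (al, 0), areal x & dot x.1 theta < 0].
  exists (v (al, 0)); split; first by rewrite vw.
    by apply: (affine_weyl_real rsD _ av); apply: apos_real pal.
  have -> : dot (v (al, 0)).1 theta = - dot (w (v (al, 0))).1 (w (- theta, 2)).1.
    by rewrite (affine_weyl_dot rsD _ aw) dotNr opprK.
  by rewrite vw wmu1 /= oppr_lt0.
have x2 : 1 <= x.2 by rewrite leNgt; apply/negP => x1; apply: (noneg x); rewrite ?xE.
(* x and y have images al and mu1 - al, both positive, and both pair negatively with theta, so each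
   has level at least 1; the levels sum to 2, hence both equal 1. *)
pose y : A := (- theta, 2) - x.
have yE : w y = (mu1 - al, 0).
  by rewrite (affine_weylB _ aw) wmu1 xE -[LHS]/(mu1 - al, 0 - 0) subr0.
have ry : areal y.
  rewrite -(wv y) yE; apply: (affine_weyl_real rsD _ av); exact: apos_real apmal.
have yt : dot y.1 theta < 0.
  have -> : dot y.1 theta = - dot (w y).1 (w (- theta, 2)).1.
    by rewrite (affine_weyl_dot rsD _ aw) dotNr opprK.
  rewrite yE wmu1 /= oppr_lt0 dotBl lmu1.
  have := cartan_le1 rsD _ _ Dal (pos_root _ pmu1) _ _.
  rewrite lmu1 => /(_ (ltheta _ Dal)); rewrite eq_sym => /(_ mu1al_ne).
  rewrite /cartan lmu1 ler_pdivrMr // mul1r; lra.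
have y2 : 1 <= y.2 by rewrite leNgt; apply/negP => y1; apply: (noneg y); rewrite ?yE.
have x21 : x.2 = 1.
  have e : x.2 + y.2 = 2 by rewrite -[y.2]/(2 - x.2) addrCA subrr addr0.
  by apply/eqP; rewrite eq_le x2 andbT; lra.
pose c := - x.1; have xc : x = (- c, 1) by rewrite opprK -x21; case: (x).
have Dc : D c by apply: (root_opp rsD); case: rx.
have ct : 0 < dot c theta by rewrite dotNl oppr_gt0.
have pc := dot_theta_pos rsD srP htheta _ Dc ct.
have wc : w (- c, 1) = (al, 0) by rewrite -xc.
have Jc : ~ J c.
  move=> /(peterson_inverted J w c pw); rewrite wc.
  exact: apos_asym rsD srP _ pal.
have c_t : c <> theta by move=> e; apply: Jc; rewrite e.
have Hc : heisenberg c by [].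
have yc : y = (- (theta - c), 1).
  rewrite /y xc -[LHS]/(- theta - - c, 2 - 1); congr pair; last by ring.
  by rewrite opprK opprB addrC.
have aJ' : abelian_ideal D P (J `|` [set c]).
  (* For u = theta the sum would pair to 3 with the coroot of theta. Otherwise u = theta - c, but
     delta - (theta - c) is y, whose image is positive, so theta - c is not in J. *)
  have notsum u : J u -> ~ pos (c + u).
    move=> Ju [Dcu _]; have [ut|/eqP ut] := eqVneq u theta.
      have := cartan_theta_le2 rsD htheta ltheta _ Dcu.
      rewrite cartanDl ut (theta_cartan_self rsD htheta) //.
      rewrite (heisenberg_cartan rsD htheta ltheta _ Hc).
      by lra.
    have Hu : heisenberg u by split=> //; [exact: (abelian_pos u aJ Ju)|exact: JH].
    have e := heisenberg_pair rsD htheta ltheta _ _ Hc Hu Dcu.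
    have := peterson_inverted J w u pw Ju; rewrite e -yc yE.
    exact: apos_asym rsD srP _ apmal.
  split; last first.
    move=> u u' [Ju|->] [Ju'|->]; first by case: aJ => _; apply.
    - by rewrite addrC; exact: notsum.
    - exact: notsum.
    - rewrite -mulr2n -scaler_nat => -[D2c _].
      by have [] := rs_reduced rsD Dc D2c => h; exfalso; move: h; lra.
  split=> [u [Ju|->//]|u u' Ju pu' nu]; first exact: (abelian_pos u aJ Ju).
  case: Ju nu => [Ju|->] nu; first by left; exact: (abelian_upper u u' aJ Ju).
  have [->|/eqP uc] := eqVneq u' c; first by right.
  left; apply: contrapT => Ju'.
  have pwu := peterson_out rsD srP J w u' pw (pos_root _ pu') Ju'.
  have ewu : w (- c, 1) = w (- u', 1) + w (u' - c, 0).
    rewrite -(affine_weylD _ aw); congr w; rewrite -[RHS]/(- u' + (u' - c), 1 + 0).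
    by rewrite addr0 addKr.
  (* Upward closure by affine height: if u' > c were missing from J, then al = w (delta - u') + w
     (u' - c) would be a sum of two terms of height at least 1. *)
  have hge z : nonneg P z -> 0 <= aht (P := P) (theta := theta) (w (z, 0)) /\
      (z != 0 -> 1 <= aht (P := P) (theta := theta) (w (z, 0))).
    move: z; apply: nonneg_ind => [|be z beP nz [IH0 _]].
      rewrite (affine_weyl0 _ aw) eqxx; split=> //.
      by rewrite /aht /= mul0r addr0 -[0 : 'rV_m](subrr 0) htB subrr.
    have -> : w (be + z, 0) = w (be, 0) + w (z, 0).
      by rewrite -(affine_weylD _ aw) -[(be, 0) + _]/(be + z, 0 + 0) addr0.
    have := aht_ge1 rsD srP htheta _
      (peterson_finite rsD srP J w be pw (simple_pos srP _ beP)).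
    by rewrite ahtD; split=> [|_]; lra.
  have [_] := hge _ nu; rewrite subr_eq0 => /(_ (introN eqP uc)).
  have := aht_ge1 rsD srP htheta _ pwu.
  have := aht_simple srP _ sal; rewrite -wc ewu ahtD; lra.
exists (J `|` [set c]), (arefl (w (- c, 1)) \o w); split=> //.
- exact: peterson_up rsD srP htheta ltheta J w c aJ' pw Jc.
- by rewrite wc /= wmu1 /arefl /= mul0r subr0 mu1E.
- by left.
- by move=> g [/JH|->].
Qed.

Context {s : seq 'rV[R]_m}.
Hypotheses (us : uniq s) (Ds : forall v, (v \in s) <-> D v).
Local Notation cnt := (@cnt _ s).

(* Adjoining a root orthogonal to [theta] reflects in a root orthogonal to the
   rootlet. *)
Lemma extend_rootlet I J w : abelian_ideal D P I -> abelian_ideal D P J ->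
  J `<=` I -> peterson D P J w -> (forall g, I g -> 0 < dot g theta -> J g) ->
  exists2 w', peterson D P I w' & w' (- theta, 2) = w (- theta, 2).
Proof.
move=> aI; have [n] := ubnP (cnt I - cnt J); elim: n J w => // n IH J w + aJ JI pw HI.
rewrite ltnS => cIJ.
have [IJ|/nonsubset[g0 [Ig0 Jg0]]] := pselect (I `<=` J).
  by have -> : I = J by [apply/seteqP]; exists w.
(* A maximal missing root is adjoined, so that the larger set is again an upper ideal. *)
have [|u [Iu _]|g [Ig Jg] maxg] := maximal_root srP htheta (I `\` J).
- by exists g0.
- exact: (abelian_pos u aI Iu).
have gs : g \in s by apply/Ds; exact: pos_root _ (abelian_pos g aI Ig).
have J'I : J `|` [set g] `<=` I by move=> u [/JI|->].
have aJ' : abelian_ideal D P (J `|` [set g]).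
  split; last by move=> u v /J'I Iu /J'I Iv; case: aI => _; apply.
  split=> [u /J'I Iu|u v Ju pv nuv]; first exact: (abelian_pos u aI Iu).
  case: Ju nuv => [Ju|->] nuv; first by left; exact: (abelian_upper u v aJ Ju).
  have [Jv|Jv] := pselect (J v); [by left|right; apply: maxg => //].
  by split=> //; exact: (abelian_upper g v aI Ig).
have pw' := peterson_up rsD srP htheta ltheta J w g aJ' pw Jg.
have gt0 : dot g theta = 0.
  apply/eqP; rewrite eq_le (pos_dot_theta rsD srP htheta _ (abelian_pos g aI Ig)).
  by rewrite andbT leNgt; apply/negP => gt; apply: Jg; exact: HI.
have cIJ' : (cnt I - cnt (J `|` [set g]) < n)%N.
  have := cnt_le (s := s) _ _ J'I; rewrite (cnt_setU1 us J g gs Jg).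
  by move: cIJ; clear; move: (cnt I) (cnt J) => p q; lia.
have [v Iv vt|w' pw'' ew'] := IH _ _ cIJ' aJ' J'I pw'; first by left; exact: HI.
exists w' => //; rewrite ew' /= areflE /cartan.
have [aw _] := pw.
rewrite (affine_weyl_dot rsD _ aw) /= dotNl dotNr opprK dotC gt0 mulr0 mul0r.
by rewrite /asub scale0r mul0r !subr0; case: (w _).
Qed.

Context {h : 'rV[R]_m -> R}.
Hypotheses (hB : forall t u v, h (u - t *: v) = h u - t * h v).
Hypotheses (hP : forall al : 'rV[R]_m, al \in P -> h al * dot theta theta = dot al al).

Lemma rootlet_theta I mu : rootlet D P I mu ->
  exists2 w, peterson D P I w & w (- theta, 2) = (mu, 0).
Proof.
by move=> [w [t' [pw /(highest_root_uniq srP htheta) -> e]]]; exists w.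
Qed.

(** I(>= c) itself has rootlet c, so the count of [rootlet_structure] applies to it. *)
Lemma amazing_necessary c : amazing D P c ->
  [/\ long_positive D P c, abelian_ideal D P (ideal_above D P c) &
      (cnt (ideal_above D P c `&` heisenberg))%:R = h theta - h c].
Proof.
move=> [lc [[[aI I0 /rootlet_theta[w pw e]] _] _]]; split=> //.
have [_ _ + _] := rootlet_structure rsD srP htheta ltheta us Ds hB hP _ w aI I0 pw.
by rewrite e /= => ->; rewrite opprB addrC subrK.
Qed.

(* The last hypothesis makes an ideal of rootlet [c], whose part in the
   Heisenberg ideal lies above [c], lie above [c] altogether. *)
Lemma amazing_sufficient c : long_positive D P c ->
  abelian_ideal D P (ideal_above D P c) ->
  (cnt (ideal_above D P c `&` heisenberg))%:R <= h theta - h c ->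
  (forall v, pos v -> dot v theta = 0 -> ~ root_le P c v ->
     exists u, [/\ pos u, 0 < dot u theta, root_le P v u & ~ root_le P c u]) ->
  amazing D P c.
Proof.
move=> lc aI cI U; have [pc maxc] := lc; set I := ideal_above D P c.
have Ic : I c by split=> //; exact: root_le_refl.
(* An element v of J orthogonal to theta and not above c would have a root u of H over it that is
   not above c; u lies in J by upward closure and is then above c after all. *)
have below J w : abelian_ideal D P J -> J !=set0 -> peterson D P J w ->
    w (- theta, 2) = (c, 0) -> J `<=` I.
  move=> aJ J0 pw e.
  have [_ low _ _] := rootlet_structure rsD srP htheta ltheta us Ds hB hP J w aJ J0 pw.
  move=> v Jv; have pv := abelian_pos v aJ Jv; split=> //.
  rewrite e /= in low; have [vt|vt] := ltP 0 (dot v theta); first exact: low.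
  apply: contrapT => cv; have [|b [pb bt vb cb]] := U v pv _ cv.
    by apply/eqP; rewrite eq_le vt (pos_dot_theta rsD srP htheta _ pv).
  by apply: cb; apply: low => //; exact: (abelian_upper v b aJ Jv pb vb).
have lcE : dot c c = dot theta theta.
  apply/eqP; rewrite eq_le ltheta ?maxc //; first exact: theta_root htheta.
  by case: pc.
have [J [w [aJ pw e Jt JH]]] := long_rootlet c pc lcE.
have J0 : J !=set0 by exists theta.
have JI := below J w aJ J0 pw e.
(* J has exactly h theta - h c Heisenberg elements, all in I, and I has no more; so the two
   Heisenberg parts coincide and J can be enlarged to I without moving the rootlet. *)
have IHJ : I `&` heisenberg `<=` J `&` heisenberg.
  apply: (cnt_ge_sub us) => [v [/JI Iv Hv] //|v [_ [[Dv _] _ _]]|]; first exact/Ds.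
  have [_ _ + _] := rootlet_structure rsD srP htheta ltheta us Ds hB hP J w aJ J0 pw.
  rewrite e /= -(ler_nat R) => hc; apply: le_trans cI _; rewrite hc.
  by rewrite opprB addrC subrK.
have [|w' pw' ew'] := extend_rootlet I J w aI aJ JI pw.
  move=> g Ig gt; have [->//|/eqP g_t] := eqVneq g theta.
  by have [] : (J `&` heisenberg) g by apply: IHJ; split=> //; split=> //; case: Ig.
have Irt : ideals_with_rootlet D P c I.
  split=> //; first by exists c.
  by exists w', theta; split=> //; rewrite ew'.
have maxI J' : ideals_with_rootlet D P c J' -> J' `<=` I.
  by move=> [aJ' J'0 /rootlet_theta[w'' pw'' e'']]; exact: (below J' w'').
split=> //; split.
  by split=> // J' /maxI J'I IJ'; apply/seteqP.
move=> J' [rJ' mJ']; apply: mJ' => //; exact: maxI.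
Qed.

End AmazingCriterion.

(** * Lists and coordinates *)

Section ListCriterion.

Context {R : realFieldType} {m : nat} {D : set 'rV[R]_m} {P : seq 'rV[R]_m}.
Hypotheses (rsD : root_system D) (srP : simple_roots D P).
Implicit Types (u v b c : 'rV[R]_m) (S : set 'rV[R]_m) (r : seq 'rV[R]_m).

Local Notation pos := (positive D P).

(** A positive root that is not simple pairs positively with some simple root; reflecting in it
    gives a lower positive root, from which the original is recovered by a reflection that raises
    the height. *)
Lemma positive_eq_raise S : (forall al, al \in P -> S al) ->
  (forall c, S c -> D c /\ nonneg P c) ->
  (forall al c, al \in P -> S c -> dot c al < 0 -> S (refl al c)) -> pos = S.
Proof.
move=> PS SD Srefl; apply/seteqP; split=> c; last exact: SD.
move=> pc; have frP := sr_free srP.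
have [n hn] := ht_nat P frP _ pc.2.
have : ht P c < n.+1%:R by rewrite hn ltr_nat.
move: n.+1 => {hn}n; elim: n c pc => [|n IH] c pc hc.
  by have := ht_nat P frP _ pc.2 => -[k hk]; move: hc; rewrite hk ltr_nat.
have [cP|cP] := boolP (c \in P); first exact: PS.
have [al alP cal] := pos_dot_simple rsD _ pc.
have Dal := sr_root srP alP; have al0 := root_neq0 rsD _ Dal.
have ca : c != al by apply: contraNneq cP => ->.
have ce : refl al (refl al c) = c.
  rewrite /refl cartanBl cartanZl cartan_self //.
  by apply/rowP => i; rewrite !mxE; ring.
have k1 : 1 <= cartan c al.
  by apply: (cartan_ge1 rsD) => //; [case: pc|rewrite cartan_gt0].
have Sr : S (refl al c).
  apply: IH; first exact: simple_refl_pos rsD srP _ _ alP pc ca.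
  rewrite /refl htB htZ (ht_simple P frP _ alP); move: hc k1; rewrite -natr1.
  by lra.
rewrite -ce; apply: Srefl => //.
have := refl_dot al c al al0; rewrite refl_self // dotNr => e.
by move: cal; rewrite -oppr_lt0 -e opprK.
Qed.

Lemma positive_eq S : (forall al, al \in P -> S al) ->
  (forall c, S c -> D c /\ nonneg P c) ->
  (forall al c, al \in P -> S c -> c != al -> S (refl al c)) -> pos = S.
Proof.
move=> PS SD Srefl; apply: positive_eq_raise => // al c alP Sc cal.
apply: Srefl => //; apply: contraTneq cal => ->.
by rewrite -leNgt dot_sqr_ge0.
Qed.

Context {theta : 'rV[R]_m} {h : 'rV[R]_m -> R}.
Hypotheses (htheta : highest_root D P theta).
Hypotheses (ltheta : forall b, D b -> dot b b <= dot theta theta).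
Hypotheses (hB : forall t u v, h (u - t *: v) = h u - t * h v).
Hypotheses (hP : forall al : 'rV[R]_m, al \in P -> h al * dot theta theta = dot al al).

Lemma root_enum : exists2 s : seq 'rV[R]_m, uniq s & forall v, (v \in s) <-> D v.
Proof.
have /finite_seqP[s Ds] := rs_finite rsD.
exists (undup s); first exact: undup_uniq.
by move=> v; rewrite mem_undup Ds.
Qed.

Lemma amazing_abelian c u v : amazing D P c -> pos u -> pos v ->
  root_le P c u -> root_le P c v -> ~ pos (u + v).
Proof. by move=> [_ [[[[_ aI] _ _] _] _]] pu pv cu cv; apply: aI. Qed.

(** The form used for refutations: a list of distinct Heisenberg roots above c that is too long
    shows that c is not amazing. *)
Lemma amazing_size_le c r : amazing D P c -> uniq r ->
  (forall b, b \in r -> [/\ pos b, 0 < dot b theta, b <> theta & root_le P c b]) ->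
  (size r)%:R <= h theta - h c.
Proof.
have [s us Ds] := root_enum.
move=> /(amazing_necessary rsD srP htheta ltheta us Ds hB hP)[_ _ <-] ur hr.
rewrite ler_nat; apply: size_le_cnt ur _ => b /hr[pb bt b_t cb].
by split; [apply/Ds; case: pb|].
Qed.

(** The form used for membership: r only has to contain the Heisenberg roots above c, since an upper
    bound on their number suffices. *)
Lemma amazing_intro c r : long_positive D P c ->
  (forall u v, pos u -> pos v -> root_le P c u -> root_le P c v -> ~ pos (u + v)) ->
  (forall b, pos b -> 0 < dot b theta -> b <> theta -> root_le P c b -> b \in r) ->
  (size r)%:R <= h theta - h c ->
  (forall v, pos v -> dot v theta = 0 -> ~ root_le P c v ->
     exists u, [/\ pos u, 0 < dot u theta, root_le P v u & ~ root_le P c u]) ->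
  amazing D P c.
Proof.
have [s us Ds] := root_enum => lc aI hr sr U.
apply: (amazing_sufficient rsD srP htheta ltheta us Ds hB hP) => //.
  split; last by move=> u v [pu cu] [pv cv]; exact: aI.
  split=> [u []//|u v [pu cu] pv uv]; split=> //.
  exact: root_le_trans cu uv.
apply: le_trans sr; rewrite ler_nat; apply: (cnt_le_size us).
by move=> v _ [[pv cv] [_ vt v_t]]; exact: hr.
Qed.

Lemma amazing_long c : amazing D P c -> long_positive D P c.
Proof. by case. Qed.

Lemma long_positiveE c : long_positive D P c <-> pos c /\ dot c c = dot theta theta.
Proof.
have Dt := theta_root htheta; split=> [[pc maxc]|[pc lc]].
  by split=> //; apply/eqP; rewrite eq_le ltheta ?maxc //; case: pc.
by split=> // b Db; rewrite lc; exact: ltheta.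
Qed.

End ListCriterion.

Ltac decide_nat_rel := repeat match goal with
  | |- context [@eq_op ?T ?i ?j] =>
      first [have -> : (i == j) = false by lia | have -> : (i == j) = true by lia]
  | |- context [leq ?i ?j] =>
      first [have -> : leq i j = false by lia | have -> : leq i j = true by lia]
  end.

Definition swap (p q i : nat) : nat := if i == p then q else if i == q then p else i.

Lemma swapL p q : swap p q p = q.
Proof. by rewrite /swap eqxx. Qed.

Lemma swap_id p q i : i != p -> i != q -> swap p q i = i.
Proof. by rewrite /swap => /negPf -> /negPf ->. Qed.

Lemma swap_inj p q : injective (swap p q).
Proof. by move=> i j; rewrite /swap; repeat (case: eqP => ?); lia. Qed.

(** * Orthogonal coordinates and functionals prescribed on them *)

Section Coordinates.

Context {R : realFieldType} {m : nat} {N : nat} {e : nat -> 'rV[R]_m} {a : R}.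
Hypotheses (a0 : 0 < a).
Hypotheses (ee : forall i j, (1 <= i <= N)%N -> (1 <= j <= N)%N ->
  dot (e i) (e j) = if i == j then a else 0).

Lemma coord_dot i j : (1 <= i <= N)%N -> (1 <= j <= N)%N ->
  dot (e i) (e j) = a * (i == j)%:R.
Proof. by move=> hi hj; rewrite ee //; case: (i == j); rewrite ?mulr1 ?mulr0. Qed.

(** The linear functional with value [c i] on [e i], represented as a vector so that
    [nonneg_dot_ge0] applies to it. *)
Definition dual_vec (c : nat -> R) : 'rV[R]_m :=
  \sum_(1 <= i < N.+1) (c i / a) *: e i.

Lemma dot_dual_vec c i : (1 <= i <= N)%N -> dot (e i) (dual_vec c) = c i.
Proof.
move=> hi; rewrite dotC dot_suml (bigD1_seq i) ?iota_uniq //=; last first.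
  by rewrite mem_index_iota ltnS.
rewrite dotZl ee // eqxx divfK ?lt0r_neq0 // big_seq_cond big1 ?addr0 // => j.
rewrite mem_index_iota ltnS => /andP[hj /negPf ji].
by rewrite dotZl ee // ji mulr0.
Qed.

Lemma coord_inj i j : (1 <= i <= N)%N -> (1 <= j <= N)%N -> e i = e j -> i = j.
Proof.
move=> hi hj eij; have := ee i j hi hj; rewrite eij ee // eqxx.
by case: eqVneq => // _ /eqP; rewrite (gt_eqF a0).
Qed.

Lemma refl_sub_coord p q i : (1 <= p <= N)%N -> (1 <= q <= N)%N -> (1 <= i <= N)%N ->
  p != q -> refl (e p - e q) (e i) = e (swap p q i).
Proof.
move=> hp hq hi pq; rewrite /refl /cartan !(dotBl, dotBr) !coord_dot // !eqxx.
rewrite (eq_sym q p) (negPf pq) !mulr0 !mulr1 subr0 sub0r opprK /swap.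
have aa : a + a != 0 by rewrite gt_eqF // addr_gt0.
have [->|ip] := eqVneq i p.
  rewrite (negPf pq) mulr1 mulr0 subr0 (_ : 2 * a / _ = 1) ?scale1r ?subKr //.
  by rewrite mulr_natl mulr2n divff.
have [->|iq] := eqVneq i q.
  rewrite mulr1 mulr0 sub0r (_ : 2 * - a / _ = -1) ?scaleN1r ?opprK ?subrKC //.
  by rewrite mulrN mulNr mulr_natl mulr2n divff.
by rewrite ?mulr0 subr0 mulr0 mul0r scale0r subr0.
Qed.

Lemma dot_sub_self i j : (1 <= i < j)%N -> (j <= N)%N ->
  dot (e i - e j) (e i - e j) = 2 * a.
Proof.
move=> hij hj; rewrite !(dotBl, dotBr) !coord_dot; try lia.
by decide_nat_rel; rewrite /=; ring.
Qed.

Lemma dot_add_self i j : (1 <= i < j)%N -> (j <= N)%N ->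
  dot (e i + e j) (e i + e j) = 2 * a.
Proof.
move=> hij hj; rewrite !(dotDl, dotDr) !coord_dot; try lia.
by decide_nat_rel; rewrite /=; ring.
Qed.

Lemma dot_mul_self i k : (1 <= i <= N)%N -> dot (e i *+ k) (e i *+ k) = a * (k * k)%:R.
Proof.
move=> hi; rewrite dotMnl dotMnr coord_dot; try lia.
by rewrite eqxx mulr1 -mulrnA mulr_natr.
Qed.

End Coordinates.

Section ReflectionLinearity.

Context {R : realFieldType} {m : nat}.
Implicit Types (u v c : 'rV[R]_m).

Lemma reflD c u v : refl c (u + v) = refl c u + refl c v.
Proof. by rewrite /refl cartanDl scalerDl opprD addrACA. Qed.

Lemma reflN c u : refl c (- u) = - refl c u.
Proof. by rewrite /refl cartanNl scaleNr opprB opprK addrC. Qed.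

Lemma reflB c u v : refl c (u - v) = refl c u - refl c v.
Proof. by rewrite reflD reflN. Qed.

Lemma reflMn c u n : refl c (u *+ n) = refl c u *+ n.
Proof.
elim: n => [|n IH]; last by rewrite !mulrS reflD IH.
by rewrite !mulr0n /refl /cartan dot0l mulr0 mul0r scale0r subr0.
Qed.

End ReflectionLinearity.

(** * Type A *)

Section TypeA.

Context {R : realFieldType} {m : nat} {D : set 'rV[R]_m} {n : nat} {e : nat -> 'rV[R]_m}.
Context {a : R}.
Hypotheses (rsD : root_system D) (srP : simple_roots D (simple_A e n)).
Hypotheses (n1 : (1 <= n)%N) (a0 : 0 < a).
Hypotheses (ee : forall i j, (1 <= i <= n.+1)%N -> (1 <= j <= n.+1)%N ->
  dot (e i) (e j) = if i == j then a else 0).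

Local Notation P := (simple_A e n).
Local Notation dv := (@dual_vec R m n.+1 e a).

Lemma simple_A_mem k : (1 <= k <= n)%N -> e k - e k.+1 \in P.
Proof. by move=> hk; apply: map_f; rewrite mem_iota; lia. Qed.

Lemma simple_A_inv al : al \in P -> exists2 k, (1 <= k <= n)%N & al = e k - e k.+1.
Proof. by move=> /mapP[k]; rewrite mem_iota => hk ->; exists k => //; lia. Qed.

Lemma nonneg_subA i j : (1 <= i <= j)%N -> (j <= n.+1)%N -> nonneg P (e i - e j).
Proof.
elim: j => [|j IH] hij hj; first by lia.
have [->|hij'] : i = j.+1 \/ (1 <= i <= j)%N by lia.
  by rewrite subrr; exact: nonneg0.
rewrite -(subrKA (e j)); apply: nonnegD; first by apply: IH; lia.
by apply: nonneg_mem; apply: simple_A_mem; lia.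
Qed.

Lemma nonneg_dualA c v : (forall i, (1 <= i <= n)%N -> c i.+1 <= c i) ->
  nonneg P v -> 0 <= dot v (dv c).
Proof.
move=> hc; apply: nonneg_dot_ge0 => al /simple_A_inv[k hk ->].
by rewrite dotBl !(dot_dual_vec a0 ee) ?subr_ge0 ?hc //; lia.
Qed.

Definition rootsA : set 'rV[R]_m :=
  [set v | exists i j, (1 <= i < j)%N /\ (j <= n.+1)%N /\ v = e i - e j].

Lemma rootsA_sub i j : (1 <= i < j)%N -> (j <= n.+1)%N -> rootsA (e i - e j).
Proof. by move=> hij hj; exists i, j. Qed.

Lemma root_subA i j : (1 <= i < j)%N -> (j <= n.+1)%N -> D (e i - e j).
Proof.
elim: j => [|j IH] hij hj; first by lia.
have [->|hij'] : i = j \/ (1 <= i < j)%N by lia.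
  by apply: (sr_root srP); apply: simple_A_mem; lia.
have Dj : D (e j - e j.+1) by apply: (sr_root srP); apply: simple_A_mem; lia.
have Dij : D (e i - e j) by apply: IH; lia.
have := rs_refl rsD Dij Dj; rewrite reflB !(refl_sub_coord a0 ee); try lia.
by rewrite swapL swap_id //; lia.
Qed.

Lemma positiveA : positive D P = rootsA.
Proof.
apply: (positive_eq rsD srP) => [al /simple_A_inv[k hk ->]|c [i [j [hij [hj ->]]]]|].
- by apply: rootsA_sub; lia.
- by split; [exact: root_subA|apply: nonneg_subA; lia].
move=> al c /simple_A_inv[k hk ->] [i [j [hij [hj ->]]]] ne.
rewrite reflB !(refl_sub_coord a0 ee); try lia.
have {}ne : ~ (i = k /\ j = k.+1) by move=> [ik jk]; move: ne; rewrite ik jk eqxx.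
by apply: rootsA_sub; rewrite /swap; repeat (case: eqP => ?); lia.
Qed.

Local Notation theta := (e 1%N - e n.+1).

Lemma dot_subA i j k l : (1 <= i < j)%N -> (j <= n.+1)%N -> (1 <= k < l)%N ->
  (l <= n.+1)%N -> dot (e i - e j) (e k - e l) =
  a * ((i == k)%:R + (j == l)%:R - (i == l)%:R - (j == k)%:R).
Proof.
move=> hij hj hkl hl; rewrite !(dotBl, dotBr) !(coord_dot ee); try lia.
by ring.
Qed.

Lemma dot_selfA i j : (1 <= i < j)%N -> (j <= n.+1)%N ->
  dot (e i - e j) (e i - e j) = 2 * a.
Proof.
by move=> hij hj; rewrite dot_subA //; decide_nat_rel; rewrite /=; ring.
Qed.

Lemma highestA : highest_root D P theta.
Proof.
have pt : positive D P theta by rewrite positiveA; apply: rootsA_sub; lia.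
split=> // c; rewrite positiveA => -[i [j [hij [hj ->]]]]; rewrite /root_le.
have -> : theta - (e i - e j) = (e 1%N - e i) + (e j - e n.+1).
  by apply/rowP => x; rewrite !mxE; ring.
by apply: nonnegD; apply: nonneg_subA; lia.
Qed.

Lemma longA b : D b -> dot b b = 2 * a.
Proof.
move=> Db; have [|] := pos_or_neg rsD srP b Db; rewrite positiveA.
  by move=> [i [j [hij [hj ->]]]]; rewrite dot_selfA.
by rewrite -dotNN => -[i [j [hij [hj ->]]]]; rewrite dot_selfA.
Qed.

(** The partial coordinate sums up to k are nonnegative on simple roots; k = p detects i > p and k =
    q - 1 detects j < q. *)
Lemma root_leA p q i j : (1 <= p < q)%N -> (q <= n.+1)%N -> (1 <= i < j)%N ->
  (j <= n.+1)%N -> root_le P (e p - e q) (e i - e j) <-> (i <= p)%N /\ (q <= j)%N.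
Proof.
move=> hpq hq hij hj; split=> [le|[ip qj]]; last first.
  rewrite /root_le (_ : _ - _ = (e i - e p) + (e q - e j)).
    by apply: nonnegD; apply: nonneg_subA; lia.
  by apply/rowP => x; rewrite !mxE; ring.
have ind k : (forall i : nat, (1 <= i <= n)%N -> (i.+1 <= k)%N%:R <= (i <= k)%N%:R :> R).
  by move=> l _; rewrite ler_nat; lia.
have H k : (0 : R) <= (i <= k)%N%:R - (j <= k)%N%:R - ((p <= k)%N%:R - (q <= k)%N%:R).
  have := nonneg_dualA _ _ (ind k) le.
  by rewrite !dotBl !(dot_dual_vec a0 ee) //; lia.
split.
  have [//|pi] := leqP i p; exfalso; have := H p.
  by decide_nat_rel; rewrite /=; lra.
have [//|jq] := leqP q j; exfalso; have := H q.-1.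
by decide_nat_rel; rewrite /=; lra.
Qed.

Lemma amazing_A : amazing D P = positive D P /\ positive D P = rootsA.
Proof.
split; last exact: positiveA.
have ltheta b : D b -> dot b b <= dot theta theta.
  by move=> Db; rewrite longA // longA //; case: highestA => -[].
apply/seteqP; split=> [c [[pc _] _] //|c pc].
(* Gives h (e_i - e_j) = j - i, the height, which in type A is also the coroot height. *)
pose h v := dot v (dv (fun i => - i%:R)).
have hB t u v : h (u - t *: v) = h u - t * h v by rewrite /h dotBl dotZl.
have hP (al : 'rV[R]_m) : al \in P -> h al * dot theta theta = dot al al.
  move=> /[dup] /(sr_root srP) Dal /simple_A_inv[k hk alE].
  rewrite longA //; last by case: highestA => -[].
  rewrite longA // /h alE dotBl !(dot_dual_vec a0 ee); try lia.
  by rewrite -natr1; ring.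
have lc : long_positive D P c.
  split=> // b Db; rewrite longA // longA //; by case: pc.
move: pc lc; rewrite positiveA => -[p [q [hpq [hq ->]]]] lc.
(* The Heisenberg roots above e_p - e_q: second index from q to n, or first index from 2 to p. There
   are (n + 1 - q) + (p - 1) = n - (q - p) of them. *)
pose r := [seq e 1%N - e k | k <- iota q (n.+1 - q)] ++
          [seq e k - e n.+1 | k <- iota 2 p.-1].
apply: (amazing_intro rsD srP highestA ltheta hB hP _ r lc).
- move=> u v; rewrite positiveA => -[i [j [hij [hj ->]]]] [i' [j' [hij' [hj' ->]]]].
  move=> /root_leA[//|//|//|//|ip qj] /root_leA[//|//|//|//|ip' qj'].
  (* The coordinate sum up to p is 1 on every root above e_p - e_q and at most 1 on a positive
     root. *)
  move=> [k [l [hkl [hl]]]] /(congr1 (fun x => dot x (dv (fun i => (i <= p)%N%:R)))).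
  rewrite !(dotDl, dotNl) !(dot_dual_vec a0 ee); try lia.
  rewrite /=; decide_nat_rel.
  by case: (k <= p)%N; case: (l <= p)%N => /=; lra.
- move=> b; rewrite positiveA => -[i [j [hij [hj ->]]]] bt b_t.
  move=> /root_leA[//|//|//|//|ip qj].
  rewrite mem_cat; have [i1|i1] := eqVneq i 1%N.
    have jn : j <> n.+1 by move=> jn; apply: b_t; rewrite i1 jn.
    apply/orP; left; rewrite i1; apply: map_f; rewrite mem_iota; lia.
  have [jn|jn] := eqVneq j n.+1.
    apply/orP; right; rewrite jn; apply: (map_f (fun k => e k - e n.+1)).
    rewrite mem_iota; lia.
  move: bt; rewrite dot_subA; try lia.
  by decide_nat_rel; rewrite /= !(addr0, subr0) mulr0 ltxx.
- rewrite size_cat !size_map !size_iota /h !dotBl !(dot_dual_vec a0 ee); try lia.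
  rewrite natrD natrB // (_ : p.-1%:R = p%:R - 1); first by lra.
  by case: p hpq {lc r} => // p' _; rewrite -[in RHS]natr1 addrK.
- move=> v; rewrite positiveA => -[i [j [hij [hj ->]]]].
  rewrite dot_subA; try lia.
  move=> /eqP; rewrite mulf_eq0 (gt_eqF a0) /= => /eqP vt /root_leA le.
  have i1 : i <> 1%N.
    move=> i1; move: vt; rewrite i1; have [jn|jn] := eqVneq j n.+1.
      by decide_nat_rel; rewrite /=; lra.
    by decide_nat_rel; rewrite /=; lra.
  have jn : j <> n.+1 by move=> jn; move: vt; rewrite jn; decide_nat_rel; rewrite /=; lra.
  have {}le : ~ ((i <= p)%N /\ (q <= j)%N) by move=> h'; apply: le => //.
  (* The witness keeps the index that prevents v from being above e_p - e_q and moves the other one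
     to the end, n + 1 or 1. *)
  have [pi|ip] := ltnP p i.
    exists (e i - e n.+1); split.
    + by apply: rootsA_sub; lia.
    + rewrite dot_subA; try lia.
      by decide_nat_rel; rewrite mulr_gt0 //=; lra.
    + by apply/root_leA; lia.
    + by move=> /root_leA; lia.
  exists (e 1%N - e j); split.
  + by apply: rootsA_sub; lia.
  + rewrite dot_subA; try lia.
    by decide_nat_rel; rewrite mulr_gt0 //=; lra.
  + by apply/root_leA; lia.
  + by move=> /root_leA; lia.
Qed.

End TypeA.

(** * Types B, C, D *)

(* Types B, C, D together: the last simple root is [e n *+ k] with k = 1 in type
   B and k = 2 in type C, while k = 0 encodes type D. *)
Definition last_simple {R : realFieldType} {m : nat} (e : nat -> 'rV[R]_m) (n k : nat) :=
  if k == 0%N then e n.-1 + e n else e n *+ k.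

Definition simple_BCD {R : realFieldType} {m : nat} (e : nat -> 'rV[R]_m) (n k : nat) :=
  rcons [seq e i - e i.+1 | i <- iota 1 n.-1] (last_simple e n k).

Variant roots_BCD {R : realFieldType} {m : nat} (e : nat -> 'rV[R]_m) (n k : nat) :
    set 'rV[R]_m :=
| RootSub i j of (1 <= i < j)%N & (j <= n)%N : roots_BCD e n k (e i - e j)
| RootAdd i j of (1 <= i < j)%N & (j <= n)%N : roots_BCD e n k (e i + e j)
| RootMul i of (1 <= i <= n)%N & (0 < k)%N : roots_BCD e n k (e i *+ k).

Section TypeBCD.

Context {R : realFieldType} {m : nat} {D : set 'rV[R]_m} {n k : nat}.
Context {e : nat -> 'rV[R]_m} {a : R}.
Hypotheses (rsD : root_system D) (srP : simple_roots D (simple_BCD e n k)).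
Hypotheses (n2 : (2 <= n)%N) (k2 : (k <= 2)%N) (a0 : 0 < a).
Hypotheses (ee : forall i j, (1 <= i <= n)%N -> (1 <= j <= n)%N ->
  dot (e i) (e j) = if i == j then a else 0).

Local Notation P := (simple_BCD e n k).
Local Notation S := (roots_BCD e n k).
Local Notation dv := (@dual_vec R m n e a).

Lemma simple_BCD_mem i : (1 <= i < n)%N -> e i - e i.+1 \in P.
Proof.
move=> hi; rewrite mem_rcons inE; apply/orP; right.
by apply: (map_f (fun i => e i - e i.+1)); rewrite mem_iota; lia.
Qed.

Lemma last_simple_mem : last_simple e n k \in P.
Proof. by rewrite mem_rcons inE eqxx. Qed.

Lemma simple_BCD_inv al : al \in P ->
  al = last_simple e n k \/ exists2 i, (1 <= i < n)%N & al = e i - e i.+1.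
Proof.
rewrite mem_rcons inE => /orP[/eqP ->|/mapP[i]]; first by left.
by rewrite mem_iota => hi ->; right; exists i => //; lia.
Qed.

Lemma nonneg_subBCD i j : (1 <= i <= j)%N -> (j <= n)%N -> nonneg P (e i - e j).
Proof.
elim: j => [|j IH] hij hj; first by lia.
have [->|hij'] : i = j.+1 \/ (1 <= i <= j)%N by lia.
  by rewrite subrr; exact: nonneg0.
rewrite -(subrKA (e j)); apply: nonnegD; first by apply: IH; lia.
by apply: nonneg_mem; apply: simple_BCD_mem; lia.
Qed.

Lemma nonneg_mulBCD i : (1 <= i <= n)%N -> (0 < k)%N -> nonneg P (e i *+ k).
Proof.
move=> hi k0; rewrite -[e i](subrK (e n)) mulrnDl; apply: nonnegD.
  by apply: nonnegMn; apply: nonneg_subBCD; lia.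
have := last_simple_mem; rewrite /last_simple ifF; last by lia.
exact: nonneg_mem.
Qed.

(** The side condition excludes only e_n + e_n in type D, where 2 e_n is the difference of the last
    two simple roots. *)
Lemma nonneg_addBCD i j : (1 <= i <= n)%N -> (1 <= j <= n)%N ->
  (0 < k)%N || (i < n)%N || (j < n)%N -> nonneg P (e i + e j).
Proof.
have nl : nonneg P (last_simple e n k) by apply: nonneg_mem; exact: last_simple_mem.
wlog ij : i j / (i <= j)%N => [H hi hj h|hi hj h].
  have [ij|ji] := leqP i j; first exact: H.
  by rewrite addrC; apply: H; lia.
have [k0|k0] := eqVneq k 0%N.
  have -> : e i + e j = (e i - e n.-1) + (e j - e n) + last_simple e n k.
    by rewrite /last_simple k0 eqxx; apply/rowP => x; rewrite !mxE; ring.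
  by apply: nonnegD => //; apply: nonnegD; apply: nonneg_subBCD; lia.
have -> : e i + e j = (e i - e n) + (e j - e n) + e n *+ 2.
  by rewrite mulr2n; apply/rowP => x; rewrite !mxE; ring.
apply: nonnegD.
  by apply: nonnegD; apply: nonneg_subBCD; lia.
have [k1|k1] : k = 1%N \/ k = 2 by lia.
  by apply: nonnegMn; move: nl; rewrite /last_simple k1.
by move: nl; rewrite /last_simple k1.
Qed.

Lemma nonneg_dualBCD c v : (forall i, (1 <= i < n)%N -> c i.+1 <= c i) ->
  0 <= dot (last_simple e n k) (dv c) -> nonneg P v -> 0 <= dot v (dv c).
Proof.
move=> hc hl; apply: nonneg_dot_ge0 => al /simple_BCD_inv[->//|[i hi ->]].
by rewrite dotBl !(dot_dual_vec a0 ee) ?subr_ge0 ?hc //; lia.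
Qed.

Lemma roots_addC i j : (1 <= i <= n)%N -> (1 <= j <= n)%N -> i != j -> S (e i + e j).
Proof.
move=> hi hj ij; have [lt|lt] : (i < j)%N \/ (j < i)%N by lia.
  by apply: RootAdd; lia.
by rewrite addrC; apply: RootAdd; lia.
Qed.

Lemma root_subBCD i j : (1 <= i < j)%N -> (j <= n)%N -> D (e i - e j).
Proof.
elim: j => [|j IH] hij hj; first by lia.
have [->|hij'] : i = j \/ (1 <= i < j)%N by lia.
  by apply: (sr_root srP); apply: simple_BCD_mem; lia.
have Dj : D (e j - e j.+1) by apply: (sr_root srP); apply: simple_BCD_mem; lia.
have Dij : D (e i - e j) by apply: IH; lia.
have := rs_refl rsD Dij Dj; rewrite reflB !(refl_sub_coord a0 ee); try lia.
by rewrite swapL swap_id //; lia.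
Qed.

Lemma refl_last_mul i : (0 < k)%N -> (1 <= i <= n)%N ->
  refl (last_simple e n k) (e i) = if i == n then - e n else e i.
Proof.
move=> k0 hi; rewrite /last_simple ifF; last by lia.
have kR : (k%:R : R) != 0 by rewrite pnatr_eq0; lia.
rewrite /refl /cartan !dotMnl !dotMnr !(coord_dot ee); try lia.
have [->|ni] := eqVneq i n.
  rewrite eqxx mulr1 -scaler_nat scalerA.
  have -> : 2 * (a *+ k) / (a *+ k *+ k) * k%:R = 2 :> R.
    by rewrite -(mulr_natr a k) -(mulr_natr (a * _) k); field; rewrite kR (gt_eqF a0).
  by rewrite scaler_nat mulr2n opprD addNKr.
by rewrite mulr0 mul0rn mulr0 mul0r scale0r subr0.
Qed.

Lemma refl_last_add i : k = 0%N -> (1 <= i <= n)%N ->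
  refl (last_simple e n k) (e i) =
  if (i == n.-1) || (i == n) then - e (swap n.-1 n i) else e i.
Proof.
move=> k0 hi; rewrite /last_simple k0 eqxx /refl /cartan !(dotDl, dotDr).
rewrite !(coord_dot ee); try lia.
have nn : (n.-1 == n) = false by lia.
rewrite !eqxx (eq_sym n) nn !mulr0 !mulr1 addr0 add0r.
have aa : 2 * a / (a + a) = 1.
  by rewrite mulr_natl mulr2n divff // gt_eqF // addr_gt0.
have [->|i1] := eqVneq i n.-1.
  by rewrite nn /= swapL mulr1 mulr0 addr0 aa scale1r opprD addrA subrr sub0r.
have [->|i2] := eqVneq i n.
  rewrite /swap eq_sym nn eqxx /= mulr1 mulr0 add0r aa scale1r opprD addrCA.
  by rewrite subrr addr0.
by rewrite !mulr0 addr0 mulr0 mul0r scale0r subr0.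
Qed.

Lemma root_add_last i : (1 <= i < n)%N -> D (e i + e n).
Proof.
move=> hi; have Dl := sr_root srP last_simple_mem.
have [k0|k0] := eqVneq k 0%N; last first.
  have Din : D (e i - e n) by apply: root_subBCD; lia.
  have := rs_refl rsD Din Dl; rewrite reflB !refl_last_mul; try lia.
  by rewrite eqxx ifF ?opprK //; lia.
have [->|ni] := eqVneq i n.-1; first by move: Dl; rewrite /last_simple k0.
have Din : D (e i - e n.-1) by apply: root_subBCD; lia.
have := rs_refl rsD Din Dl; rewrite reflB !refl_last_add //; try lia.
by rewrite eqxx /= swapL opprK ifF //; lia.
Qed.

Lemma root_addBCD i j : (1 <= i < j)%N -> (j <= n)%N -> D (e i + e j).
Proof.
move=> hij hj; have [->|jn] := eqVneq j n; first by apply: root_add_last; lia.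
have Din : D (e i + e n) by apply: root_add_last; lia.
have Djn : D (e j - e n) by apply: root_subBCD; lia.
have := rs_refl rsD Din Djn; rewrite reflD !(refl_sub_coord a0 ee); try lia.
rewrite swap_id; try lia.
by rewrite /swap eqxx ifF //; lia.
Qed.

Lemma root_mulBCD i : (1 <= i <= n)%N -> (0 < k)%N -> D (e i *+ k).
Proof.
move=> hi k0; have := sr_root srP last_simple_mem; rewrite /last_simple ifF; last by lia.
have [->//|ni] := eqVneq i n; move=> Dn.
have Din : D (e i - e n) by apply: root_subBCD; lia.
have := rs_refl rsD Dn Din; rewrite reflMn !(refl_sub_coord a0 ee); try lia.
by rewrite /swap eqxx ifF //; lia.
Qed.

(** The three families are closed under simple reflections, checked case by case; the hypothesis
    [ne] removes the one root that its own reflection makes negative. *)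
Lemma positive_BCD : positive D P = S.
Proof.
apply: (positive_eq rsD srP) =>
  [al /simple_BCD_inv[->|[i hi ->]]|c [i j hij hj|i j hij hj|i hi k0]|].
- rewrite /last_simple; case: eqP => k0; first by apply: RootAdd; lia.
  by apply: RootMul; lia.
- by apply: RootSub; lia.
- by split; [exact: root_subBCD|apply: nonneg_subBCD; lia].
- by split; [exact: root_addBCD|apply: nonneg_addBCD; lia].
- by split; [exact: root_mulBCD|exact: nonneg_mulBCD].
move=> al c /simple_BCD_inv[->|[p hp ->]] [i j hij hj|i j hij hj|i hi k0] ne.
- have [k0|k0] := eqVneq k 0%N; last first.
    rewrite reflB !refl_last_mul; try lia.
    rewrite (ifF _ _ (_ : (i == n) = false)); last by lia.
    case: eqP => jn; last by apply: RootSub; lia.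
    by rewrite opprK; apply: RootAdd; lia.
  rewrite reflB !refl_last_add //; try lia.
  have [j2|j2] := eqVneq j n.
    rewrite j2 orbT (_ : swap n.-1 n n = n.-1); last by rewrite /swap eqxx ifF //; lia.
    rewrite (_ : (i == n) = false) ?orbF; last by lia.
    have [i1|i1] := eqVneq i n.-1.
      by rewrite i1 swapL addrC opprK; apply: RootSub; lia.
    by rewrite opprK; apply: RootAdd; lia.
  rewrite orbF (_ : (i == n.-1) || (i == n) = false); last by lia.
  have [j1|j1] := eqVneq j n.-1; last by apply: RootSub; lia.
  by rewrite j1 swapL opprK; apply: RootAdd; lia.
- have [k0|k0] := eqVneq k 0%N; last first.
    rewrite reflD !refl_last_mul; try lia.
    rewrite (ifF _ _ (_ : (i == n) = false)); last by lia.
    case: eqP => jn; last by apply: RootAdd; lia.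
    by apply: RootSub; lia.
  have {}ne : ~ (i = n.-1 /\ j = n).
    by move=> [i1 j1]; move: ne; rewrite i1 j1 /last_simple k0 !eqxx.
  rewrite reflD !refl_last_add //; try lia.
  rewrite (_ : (i == n.-1) || (i == n) = false); last by lia.
  have [j2|j2] := eqVneq j n.
    rewrite j2 orbT (_ : swap n.-1 n n = n.-1); last by rewrite /swap eqxx ifF //; lia.
    by apply: RootSub; lia.
  rewrite orbF; have [j1|j1] := eqVneq j n.-1; last by apply: RootAdd; lia.
  by rewrite j1 swapL; apply: RootSub; lia.
- have i_n : i <> n.
    by move=> i_n; move: ne; rewrite i_n /last_simple ifF ?eqxx //; lia.
  by rewrite reflMn refl_last_mul // ifF; [exact: RootMul|lia].
- have {}ne : ~ (i = p /\ j = p.+1) by move=> [ip jp]; move: ne; rewrite ip jp eqxx.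
  rewrite reflB !(refl_sub_coord a0 ee); try lia.
  by apply: RootSub; rewrite /swap; repeat (case: eqP => ?); lia.
- rewrite reflD !(refl_sub_coord a0 ee); try lia.
  apply: roots_addC; last by rewrite (inj_eq (swap_inj _ _)); lia.
    by rewrite /swap; repeat (case: eqP => ?); lia.
  by rewrite /swap; repeat (case: eqP => ?); lia.
- rewrite reflMn !(refl_sub_coord a0 ee); try lia.
  apply: RootMul => //; rewrite /swap; case: eqP => [?|_]; first by lia.
  by case: eqP => [?|_]; lia.
Qed.

(** If f is nonnegative on simple roots, a sum of two roots above c has f-value at least 2 f(c);
    bounding f on positive roots below that value makes the ideal abelian. *)
Lemma abelian_dualBCD c f : (forall i, (1 <= i < n)%N -> f i.+1 <= f i) ->
  0 <= dot (last_simple e n k) (dv f) ->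
  (forall v, S v -> dot v (dv f) < 2 * dot c (dv f)) ->
  forall u v, positive D P u -> positive D P v -> root_le P c u -> root_le P c v ->
    ~ positive D P (u + v).
Proof.
move=> hf hl fmax u v _ _ cu cv; rewrite positive_BCD => /fmax; rewrite dotDl.
have := nonneg_dualBCD _ _ hf hl cu; have := nonneg_dualBCD _ _ hf hl cv.
by rewrite !dotBl; lra.
Qed.

End TypeBCD.

(** * Type C *)

Section TypeC.

Context {R : realFieldType} {m : nat} {D : set 'rV[R]_m} {n : nat}.
Context {e : nat -> 'rV[R]_m} {a : R}.
Hypotheses (rsD : root_system D) (srP : simple_roots D (simple_BCD e n 2)).
Hypotheses (n2 : (2 <= n)%N) (a0 : 0 < a).
Hypotheses (ee : forall i j, (1 <= i <= n)%N -> (1 <= j <= n)%N ->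
  dot (e i) (e j) = if i == j then a else 0).

Local Notation P := (simple_BCD e n 2).
Local Notation S := (roots_BCD e n 2).
Local Notation dv := (@dual_vec R m n e a).
Local Notation theta := (e 1%N *+ 2).

Local Notation positiveE := (positive_BCD rsD srP n2 isT a0 ee).

Lemma highestC : highest_root D P theta.
Proof.
have pt : positive D P theta by rewrite positiveE; apply: RootMul; lia.
have nsub i j : (1 <= i <= j)%N -> (j <= n)%N -> nonneg P (e i - e j).
  exact: nonneg_subBCD.
have nadd i j : (1 <= i <= n)%N -> (1 <= j <= n)%N -> nonneg P (e i + e j).
  by move=> hi hj; apply: nonneg_addBCD.
split=> // c; rewrite positiveE /root_le mulr2n => -[i j hij hj|i j hij hj|i hi _].
- have -> : e 1%N + e 1%N - (e i - e j) = (e 1%N - e i) + (e 1%N + e j).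
    by apply/rowP => x; rewrite !mxE; ring.
  by apply: nonnegD; [apply: nsub|apply: nadd]; lia.
- have -> : e 1%N + e 1%N - (e i + e j) = (e 1%N - e i) + (e 1%N - e j).
    by apply/rowP => x; rewrite !mxE; ring.
  by apply: nonnegD; apply: nsub; lia.
- have -> : e 1%N + e 1%N - e i *+ 2 = (e 1%N - e i) + (e 1%N - e i).
    by rewrite mulr2n; apply/rowP => x; rewrite !mxE; ring.
  by apply: nonnegD; apply: nsub; lia.
Qed.

Lemma thetaC_self : dot theta theta = 4 * a.
Proof. by rewrite (dot_mul_self a0 ee); [rewrite mulrC|lia]. Qed.

Lemma positive_normC b : S b ->
  dot b b = 2 * a \/ (dot b b = 4 * a /\ exists2 i, (1 <= i <= n)%N & b = e i *+ 2).
Proof.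
case=> [i j hij hj|i j hij hj|i hi _].
- by left; apply: (dot_sub_self a0 ee).
- by left; apply: (dot_add_self a0 ee).
- by right; rewrite (dot_mul_self a0 ee) // mulrC; split=> //; exists i.
Qed.

Lemma longC b : D b -> dot b b <= dot theta theta.
Proof.
rewrite thetaC_self; wlog pb : b / positive D P b => [H Db|Db].
  have [/H|/H] := pos_or_neg rsD srP b Db; first exact.
  by rewrite -[dot b b]dotNN; apply; exact: (root_opp rsD).
by move: pb; rewrite positiveE => /positive_normC[->|[-> _]]; move: a0; lra.
Qed.

Lemma long_positiveC :
  long_positive D P = [set e i *+ 2 | i in [set i : nat | (1 <= i <= n)%N]].
Proof.
apply/seteqP; split=> c.
  move=> /(long_positiveE highestC longC)[]; rewrite positiveE thetaC_self.
  move=> /positive_normC[-> h|[_ [i hi ->]] _]; first by exfalso; move: a0 h; lra.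
  by exists i.
move=> [i hi <-]; apply/(long_positiveE highestC longC).
split; first by rewrite positiveE; exact: RootMul.
by rewrite thetaC_self (dot_mul_self a0 ee) // mulrC.
Qed.

Lemma amazing_C : amazing D P = long_positive D P /\
  long_positive D P = [set e i *+ 2 | i in [set i : nat | (1 <= i <= n)%N]].
Proof.
split; last exact: long_positiveC.
apply/seteqP; split=> [c /amazing_long //|c lc].
(* Coroots of long roots are the e_i, of coroot height n + 1 - i; the factor 1/2 compensates for
   evaluating h on 2 e_i. *)
pose h v := dot v (dv (fun i => (n.+1%:R - i%:R) / 2)).
have hB t u v : h (u - t *: v) = h u - t * h v by rewrite /h dotBl dotZl.
have hP (al : 'rV[R]_m) : al \in P -> h al * dot theta theta = dot al al.
  rewrite thetaC_self => /(simple_BCD_inv (k := 2) n2 isT a0)[->|[i hi ->]].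
    rewrite /last_simple /= (dot_mul_self a0 ee) /h ?dotMnl ?(dot_dual_vec a0 ee); try lia.
    by rewrite -natr1; field.
  rewrite (dot_sub_self a0 ee); try lia.
  rewrite /h dotBl !(dot_dual_vec a0 ee); try lia.
  by rewrite -!natr1; field.
have := lc; rewrite long_positiveC => -[p /= hp cE].
move: lc; rewrite -{c}cE => lc.
(* f is at most 2 on positive roots, with value 2 exactly when both indices are at most p with plus
   signs, that is, above 2 e_p. *)
pose f := dv (fun i => (i <= p)%N%:R).
have hf (i : nat) : (1 <= i < n)%N -> (i.+1 <= p)%N%:R <= (i <= p)%N%:R :> R.
  by move=> _; rewrite ler_nat; lia.
have hl : 0 <= dot (last_simple e n 2) f.
  by rewrite /last_simple /= dotMnl (dot_dual_vec a0 ee) ?mulrn_wge0 //; lia.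
have fp : dot (e p *+ 2) f = 2.
  by rewrite dotMnl (dot_dual_vec a0 ee) ?leqnn //; lia.
have above v : root_le P (e p *+ 2) v -> 2 <= dot v f.
  move=> /(nonneg_dualBCD (k := 2) n2 isT a0 ee _ _ hf hl); rewrite -/f dotBl fp; lra.
have dot_theta i : (1 <= i <= n)%N -> dot (e i) theta = if (i <= 1)%N then 2 * a else 0.
  move=> hi; rewrite dotMnr (coord_dot ee) //; last by lia.
  by rewrite (_ : (i == 1)%N = (i <= 1)%N); [case: ifP => _ /=; ring|lia].
apply: (amazing_intro rsD srP highestC longC hB hP _
  [seq e 1%N + e i | i <- iota 2 p.-1] lc).
- apply: (abelian_dualBCD rsD srP n2 isT a0 ee _ _ hf hl) => v; rewrite -/f fp.
  have le1 (b : bool) : (b%:R : R) <= 1 by case: b.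
  have ge0 (b : bool) : (0 : R) <= b%:R by case: b.
  case=> [i j hij hj|i j hij hj|i hi _]; rewrite /f !(dotDl, dotNl, dotMnl);
    rewrite !(dot_dual_vec a0 ee); try lia.
  + have := le1 (i <= p)%N; have := ge0 (j <= p)%N; lra.
  + have := le1 (i <= p)%N; have := le1 (j <= p)%N; lra.
  + have := le1 (i <= p)%N; lra.
- move=> b; rewrite positiveE => -[i j hij hj|i j hij hj|i hi _].
  + move=> _ _ /above; rewrite /f !(dotDl, dotNl) !(dot_dual_vec a0 ee); try lia.
    by case: (i <= p)%N; case: (j <= p)%N => /= h2; exfalso; lra.
  + rewrite dotDl !dot_theta; try lia.
    have [i1|i1] := leqP i 1; last first.
      by decide_nat_rel; rewrite /= addr0 ltxx.
    have -> : i = 1%N by lia.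
    move=> _ _ /above; rewrite /f !dotDl !(dot_dual_vec a0 ee); try lia.
    have [jp|jp] := leqP j p; last by decide_nat_rel; rewrite /= => h2; exfalso; lra.
    by move=> _; apply: map_f; rewrite mem_iota; lia.
  + rewrite dotMnl dot_theta //; have [i1|i1] := leqP i 1.
      by have -> : i = 1%N by lia.
    by rewrite mul0rn ltxx.
- rewrite size_map size_iota /h !dotMnl !(dot_dual_vec a0 ee); try lia.
  rewrite (_ : p.-1%:R = p%:R - 1); first by lra.
  by case: p hp {lc f hf hl fp above} => // p' _; rewrite -[in RHS]natr1 addrK.
- have nsub i j : (1 <= i <= j)%N -> (j <= n)%N -> nonneg P (e i - e j).
    exact: nonneg_subBCD.
  move=> v; rewrite positiveE => -[i j hij hj|i j hij hj|i hi _].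
  + rewrite dotBl !dot_theta; try lia.
    have [i1|i1] := leqP i 1; first by decide_nat_rel; rewrite /= => h0; exfalso; move: a0; lra.
    (* A difference of coordinates has f-value at most 1, so it is never above 2 e_p. *)
    move=> _ _; exists (e 1%N - e j); split.
    * by apply: RootSub; lia.
    * rewrite dotBl !dot_theta; try lia.
      by decide_nat_rel; rewrite /=; move: a0; lra.
    * rewrite /root_le (_ : _ - _ = e 1%N - e i); first by apply: nsub; lia.
      by apply/rowP => x; rewrite !mxE; ring.
    * move=> /above; rewrite /f !dotBl !(dot_dual_vec a0 ee); try lia.
      by case: (j <= p)%N; case: (1 <= p)%N => /=; lra.
  + rewrite dotDl !dot_theta; try lia.
    have [i1|i1] := leqP i 1; first by decide_nat_rel; rewrite /= => h0; exfalso; move: a0; lra.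
    move=> _ le; exists (e 1%N + e j); split.
    * by apply: RootAdd; lia.
    * rewrite dotDl !dot_theta; try lia.
      by decide_nat_rel; rewrite /=; move: a0; lra.
    * rewrite /root_le (_ : _ - _ = e 1%N - e i); first by apply: nsub; lia.
      by apply/rowP => x; rewrite !mxE; ring.
    * move=> /above; rewrite /f !dotDl !(dot_dual_vec a0 ee); try lia.
      have [jp|jp] := leqP j p; last by decide_nat_rel; rewrite /=; move: a0; lra.
      exfalso; apply: le; rewrite /root_le.
      have -> : e i + e j - e p *+ 2 = (e i - e p) + (e j - e p).
        by rewrite mulr2n; apply/rowP => x; rewrite !mxE; ring.
      by apply: nonnegD; apply: nsub; lia.
  + rewrite dotMnl !dot_theta; try lia.
    have [i1|i1] := leqP i 1; first by rewrite /= => h0; exfalso; move: a0; lra.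
    move=> _ le; exists (e 1%N + e i); split.
    * by apply: RootAdd; lia.
    * rewrite dotDl !dot_theta; try lia.
      by decide_nat_rel; rewrite /=; move: a0; lra.
    * rewrite /root_le (_ : _ - _ = e 1%N - e i); first by apply: nsub; lia.
      by rewrite mulr2n; apply/rowP => x; rewrite !mxE; ring.
    * move=> /above; rewrite /f !dotDl !(dot_dual_vec a0 ee); try lia.
      have [ip|ip] := leqP i p; last by decide_nat_rel; rewrite /=; move: a0; lra.
      exfalso; apply: le; rewrite /root_le -mulrnBl; apply: nonnegMn.
      by apply: nsub; lia.
Qed.

End TypeC.

(** Lists of Heisenberg roots are shown to be disjoint by a functional whose values separate them,
    such as a partial coordinate sum. *)
Lemma uniq_cat_dot {R : realFieldType} {m : nat} (s1 s2 : seq 'rV[R]_m) (g : 'rV[R]_m)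
    (t : R) : uniq s1 -> uniq s2 -> (forall x, x \in s1 -> dot x g <= t) ->
  (forall x, x \in s2 -> t < dot x g) -> uniq (s1 ++ s2).
Proof.
move=> u1 u2 h1 h2; rewrite cat_uniq u1 u2 andbT /=; apply/hasPn => x /h2 tx.
by apply/negP => /h1; rewrite leNgt tx.
Qed.

(** * Types B ([k = 1], n >= 3) and D ([k = 0], n >= 4) *)

Section TypeBD.

Context {R : realFieldType} {m : nat} {D : set 'rV[R]_m} {n k : nat}.
Context {e : nat -> 'rV[R]_m} {a : R}.
Hypotheses (rsD : root_system D) (srP : simple_roots D (simple_BCD e n k)).
Hypotheses (n3 : (4 <= n + k)%N) (k1 : (k <= 1)%N) (a0 : 0 < a).
Hypotheses (ee : forall i j, (1 <= i <= n)%N -> (1 <= j <= n)%N ->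
  dot (e i) (e j) = if i == j then a else 0).

Local Notation P := (simple_BCD e n k).
Local Notation S := (roots_BCD e n k).
Local Notation dv := (@dual_vec R m n e a).
Local Notation theta := (e 1%N + e 2%N).

Lemma n2_BD : (2 <= n)%N. Proof. by lia. Qed.

Lemma k2_BD : (k <= 2)%N. Proof. by lia. Qed.

Lemma nonneg_subBD i j : (1 <= i <= j)%N -> (j <= n)%N -> nonneg P (e i - e j).
Proof. exact: (nonneg_subBCD n2_BD k2_BD a0). Qed.

Lemma nonneg_addBD i j : (1 <= i <= n)%N -> (1 <= j <= n)%N ->
  (0 < k)%N || (i < n)%N || (j < n)%N -> nonneg P (e i + e j).
Proof. exact: (nonneg_addBCD n2_BD k2_BD a0). Qed.

Lemma positiveBD : positive D P = S.
Proof. exact: (positive_BCD rsD srP n2_BD k2_BD a0 ee). Qed.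

Lemma highestBD : highest_root D P theta.
Proof.
split; first by rewrite positiveBD; apply: RootAdd; lia.
move=> c; rewrite positiveBD /root_le => -[i j hij hj|i j hij hj|i hi k0].
- have -> : theta - (e i - e j) = (e 1%N - e i) + (e 2%N + e j).
    by apply/rowP => x; rewrite !mxE; ring.
  by apply: nonnegD; [apply: nonneg_subBD|apply: nonneg_addBD]; lia.
- have -> : theta - (e i + e j) = (e 1%N - e i) + (e 2%N - e j).
    by apply/rowP => x; rewrite !mxE; ring.
  by apply: nonnegD; apply: nonneg_subBD; lia.
- have kE : k = 1%N by lia.
  have -> : theta - e i *+ k = (e 1%N - e i) + e 2%N *+ k.
    by rewrite kE; apply/rowP => x; rewrite !mxE; ring.
  apply: nonnegD; first by apply: nonneg_subBD; lia.
  by apply: (nonneg_mulBCD n2_BD k2_BD a0); lia.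
Qed.

Lemma thetaBD_self : dot theta theta = 2 * a.
Proof. by rewrite (dot_add_self a0 ee) //; lia. Qed.

Lemma longBD b : D b -> dot b b <= dot theta theta.
Proof.
rewrite thetaBD_self; wlog pb : b / positive D P b => [H Db|Db].
  have [/H|/H] := pos_or_neg rsD srP b Db; first exact.
  by rewrite -[dot b b]dotNN; apply; exact: (root_opp rsD).
move: pb; rewrite positiveBD => -[i j hij hj|i j hij hj|i hi k0].
- by rewrite (dot_sub_self a0 ee).
- by rewrite (dot_add_self a0 ee).
- by rewrite (dot_mul_self a0 ee) // (_ : k = 1%N) ?mulr1; [move: a0; lra|lia].
Qed.

Lemma long_subBD i j : (1 <= i < j)%N -> (j <= n)%N -> long_positive D P (e i - e j).
Proof.
move=> hij hj; apply/(long_positiveE highestBD longBD).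
rewrite thetaBD_self (dot_sub_self a0 ee) // positiveBD; split=> //.
exact: RootSub.
Qed.

Lemma long_addBD i j : (1 <= i < j)%N -> (j <= n)%N -> long_positive D P (e i + e j).
Proof.
move=> hij hj; apply/(long_positiveE highestBD longBD).
rewrite thetaBD_self (dot_add_self a0 ee) // positiveBD; split=> //.
exact: RootAdd.
Qed.

Lemma long_positiveBD c : long_positive D P c ->
  exists i j, [/\ (1 <= i < j)%N, (j <= n)%N & c = e i - e j \/ c = e i + e j].
Proof.
move=> /(long_positiveE highestBD longBD)[]; rewrite positiveBD thetaBD_self.
case=> [i j hij hj _|i j hij hj _|i hi k0].
- by exists i, j; split=> //; left.
- by exists i, j; split=> //; right.
- rewrite (dot_mul_self a0 ee) // (_ : k = 1%N) ?mulr1; last by lia.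
  by move=> h; exfalso; move: h a0; lra.
Qed.

(** The values n - i + k/2 are the coordinates of half the sum of the positive roots; pairing with
    it gives the height of a coroot, and long coroots are proportional to their roots. *)
Definition hBD (v : 'rV[R]_m) : R := dot v (dv (fun i => n%:R - i%:R + k%:R / 2)).

Lemma hBD_sub t u v : hBD (u - t *: v) = hBD u - t * hBD v.
Proof. by rewrite /hBD dotBl dotZl. Qed.

Lemma hBD_coord i : (1 <= i <= n)%N -> hBD (e i) = n%:R - i%:R + k%:R / 2.
Proof. by move=> hi; rewrite /hBD (dot_dual_vec a0 ee). Qed.

Lemma hBD_simple (al : 'rV[R]_m) : al \in P -> hBD al * dot theta theta = dot al al.
Proof.
have natr_pred (i : nat) : (0 < i)%N -> i.-1%:R = i%:R - 1 :> R.
  by case: i => // i _; rewrite -[in RHS]natr1 addrK.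
rewrite thetaBD_self => /(simple_BCD_inv n2_BD k2_BD a0)[->|[i hi ->]].
  rewrite /last_simple /hBD; case: eqP => [->|k0].
    rewrite (dot_add_self a0 ee); try lia.
    rewrite dotDl !(dot_dual_vec a0 ee); try lia.
    by rewrite natr_pred; [field|lia].
  rewrite (dot_mul_self a0 ee); try lia.
  rewrite (_ : k = 1%N); last by lia.
  by rewrite dotMnl !(dot_dual_vec a0 ee); try lia; rewrite mulr1n; field.
rewrite (dot_sub_self a0 ee); try lia.
rewrite /hBD dotBl !(dot_dual_vec a0 ee); try lia.
by rewrite -natr1; field.
Qed.

Lemma dot_thetaBD i : (1 <= i <= n)%N -> dot (e i) theta = if (i <= 2)%N then a else 0.
Proof.
move=> hi; rewrite dotDr !(coord_dot ee); try lia.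
have [i2|i2] := leqP i 2; last by decide_nat_rel; rewrite /=; ring.
have [->|->] : i = 1%N \/ i = 2 by lia.
  by rewrite /=; ring.
by rewrite /=; ring.
Qed.

Lemma heisenberg_BD (Q : 'rV[R]_m -> Prop) :
  (forall p j, (1 <= p <= 2)%N -> (3 <= j <= n)%N -> Q (e p - e j)) ->
  (forall p j, (1 <= p <= 2)%N -> (3 <= j <= n)%N -> Q (e p + e j)) ->
  (forall p, (1 <= p <= 2)%N -> (0 < k)%N -> Q (e p *+ k)) ->
  forall b, positive D P b -> 0 < dot b theta -> b <> theta -> Q b.
Proof.
move=> Qs Qa Qm b; rewrite positiveBD => -[i j hij hj|i j hij hj|i hi k0].
- rewrite dotBl !dot_thetaBD; try lia.
  case: (leqP i 2) => i2; case: (leqP j 2) => j2 bt b_t; last by move: bt; rewrite subrr ltxx.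
  + by move: bt; rewrite subrr ltxx.
  + by apply: Qs; lia.
  + by exfalso; lia.
- rewrite dotDl !dot_thetaBD; try lia.
  case: (leqP i 2) => i2; case: (leqP j 2) => j2 bt b_t; last by move: bt; rewrite addr0 ltxx.
  + by case: b_t; have [-> ->] : i = 1%N /\ j = 2 by lia.
  + by apply: Qa; lia.
  + by exfalso; lia.
- rewrite dotMnl dot_thetaBD //; case: (leqP i 2) => i2 bt b_t.
    by apply: Qm; lia.
  by move: bt; rewrite mul0rn ltxx.
Qed.

(** The positive roots orthogonal to e_1 + e_2 are e_1 - e_2 and those supported on coordinates from
    3 on. The former lies below e_1 - e_3; for the others, replacing the first index by 2 gives a
    Heisenberg root above. *)
Lemma orthogonal_witness_BD c :
  root_le P c (e 1%N - e 2%N) \/ ~ root_le P c (e 1%N - e 3%N) ->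
  (forall i j, (3 <= i < j)%N -> (j <= n)%N -> ~ root_le P c (e i - e j) ->
    ~ root_le P c (e 2%N - e j)) ->
  (forall i j, (3 <= i < j)%N -> (j <= n)%N -> ~ root_le P c (e i + e j) ->
    ~ root_le P c (e 2%N + e j)) ->
  ((0 < k)%N -> ~ root_le P c (e 2%N *+ k)) ->
  forall v, positive D P v -> dot v theta = 0 -> ~ root_le P c v ->
     exists u, [/\ positive D P u, 0 < dot u theta, root_le P v u & ~ root_le P c u].
Proof.
move=> h12 hs ha hm v; rewrite positiveBD => -[i j hij hj|i j hij hj|i hi k0].
- rewrite dotBl !dot_thetaBD; try lia.
  case: (leqP i 2) => i2; case: (leqP j 2) => j2.
  + have [-> ->] : i = 1%N /\ j = 2 by lia.
    move=> _ le; exists (e 1%N - e 3%N); split.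
    * by apply: RootSub; lia.
    * by rewrite dotBl !dot_thetaBD; try lia; rewrite subr0.
    * rewrite /root_le (_ : _ - _ = e 2%N - e 3%N); first by apply: nonneg_subBD; lia.
      by apply/rowP => x; rewrite !mxE; ring.
    * by case: h12.
  + by move=> h; exfalso; move: h a0; lra.
  + by exfalso; lia.
  + move=> _ le; exists (e 2%N - e j); split.
    * by apply: RootSub; lia.
    * by rewrite dotBl !dot_thetaBD; try lia; decide_nat_rel; rewrite subr0.
    * rewrite /root_le (_ : _ - _ = e 2%N - e i); first by apply: nonneg_subBD; lia.
      by apply/rowP => x; rewrite !mxE; ring.
    * by apply: hs le; lia.
- rewrite dotDl !dot_thetaBD; try lia.
  case: (leqP i 2) => i2.
    by case: ifP => _ h; exfalso; move: h a0; lra.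
  move=> _ le; exists (e 2%N + e j); split.
  * by apply: RootAdd; lia.
  * by rewrite dotDl !dot_thetaBD; try lia; decide_nat_rel; rewrite addr0.
  * rewrite /root_le (_ : _ - _ = e 2%N - e i); first by apply: nonneg_subBD; lia.
    by apply/rowP => x; rewrite !mxE; ring.
  * by apply: ha le; lia.
- rewrite dotMnl !dot_thetaBD //; have kE : k = 1%N by lia.
  case: (leqP i 2) => i2.
    by rewrite kE => h; exfalso; move: h a0; lra.
  move=> _ le; exists (e 2%N *+ k); split.
  * by apply: RootMul; lia.
  * by rewrite dotMnl dot_thetaBD; try lia; rewrite kE.
  * rewrite /root_le -mulrnBl; apply: nonnegMn.
    by apply: nonneg_subBD; lia.
  * exact: hm.
Qed.

Local Notation ind p := (dv (fun i : nat => (i <= p)%N%:R)).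
(** Twice the coefficient of alpha_(n-1) in type D. It is nonnegative on the simple roots only for
    [k = 0], as in type B the last simple root e_n has value -1. *)
Local Notation spin := (dv (fun i : nat => if (i < n)%N then 1 else - 1)).

Lemma ind_anti (p i : nat) : (1 <= i < n)%N -> (i.+1 <= p)%N%:R <= (i <= p)%N%:R :> R.
Proof. by move=> _; rewrite ler_nat; lia. Qed.

Lemma ind_last p : 0 <= dot (last_simple e n k) (ind p).
Proof.
rewrite /last_simple; case: eqP => _; last first.
  by rewrite dotMnl (dot_dual_vec a0 ee) ?mulrn_wge0 //; lia.
by rewrite dotDl !(dot_dual_vec a0 ee) ?addr_ge0 //; lia.
Qed.

Lemma ind_le p c v : root_le P c v -> dot c (ind p) <= dot v (ind p).
Proof.
move=> /(nonneg_dualBCD n2_BD k2_BD a0 ee _ _ (ind_anti p) (ind_last p)).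
by rewrite dotBl subr_ge0.
Qed.

Lemma spin_anti i : (1 <= i < n)%N ->
  (if (i.+1 < n)%N then 1 else - 1 : R) <= (if (i < n)%N then 1 else - 1 : R).
Proof. by move=> /andP[_ ->]; case: ifP => _; lra. Qed.

Lemma spin_last : k == 0%N -> 0 <= dot (last_simple e n k) spin.
Proof.
move=> k0; rewrite /last_simple k0 dotDl !(dot_dual_vec a0 ee); try lia.
by decide_nat_rel; rewrite /= subrr.
Qed.

Lemma spin_le c v : k == 0%N -> root_le P c v -> dot c spin <= dot v spin.
Proof.
move=> k0 /(nonneg_dualBCD n2_BD k2_BD a0 ee _ _ spin_anti (spin_last k0)).
by rewrite dotBl subr_ge0.
Qed.

Lemma bool_bounds (b : bool) : 0 <= b%:R :> R /\ b%:R <= 1 :> R.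
Proof. by case: b; rewrite /= ?lexx ?ler01. Qed.

Lemma ind1_max v : S v -> dot v (ind 1) <= 1.
Proof.
case=> [i j hij hj|i j hij hj|i hi k0]; rewrite !(dotDl, dotNl, dotMnl);
  rewrite !(dot_dual_vec a0 ee); try lia.
- have := bool_bounds (i <= 1)%N; have := bool_bounds (j <= 1)%N; lra.
- have -> : (j <= 1)%N = false by lia.
  have := bool_bounds (i <= 1)%N; rewrite /=; lra.
- rewrite (_ : k = 1%N); last by lia.
  have := bool_bounds (i <= 1)%N; lra.
Qed.

Lemma ind_max p v : S v -> dot v (ind p) <= 2.
Proof.
case=> [i j hij hj|i j hij hj|i hi k0]; rewrite !(dotDl, dotNl, dotMnl);
  rewrite !(dot_dual_vec a0 ee); try lia.
- have := bool_bounds (i <= p)%N; have := bool_bounds (j <= p)%N; lra.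
- have := bool_bounds (i <= p)%N; have := bool_bounds (j <= p)%N; lra.
- rewrite (_ : k = 1%N); last by lia.
  have := bool_bounds (i <= p)%N; lra.
Qed.

Lemma spin_max v : k == 0%N -> S v -> dot v spin <= 2.
Proof.
move=> k0 [i j hij hj|i j hij hj|i hi]; last by lia.
  rewrite dotBl !(dot_dual_vec a0 ee); try lia.
  by case: ifP => _; case: ifP => _; lra.
rewrite dotDl !(dot_dual_vec a0 ee); try lia.
by case: ifP => _; case: ifP => _; lra.
Qed.

Local Notation abelianBD := (abelian_dualBCD rsD srP n2_BD k2_BD a0 ee).
Local Notation introBD := (amazing_intro rsD srP highestBD longBD hBD_sub hBD_simple).

Lemma hBD_B u v : hBD (u - v) = hBD u - hBD v.
Proof. exact: dotBl. Qed.

Lemma hBD_D u v : hBD (u + v) = hBD u + hBD v.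
Proof. exact: dotDl. Qed.

Lemma amazing_BD_12 : amazing D P (e 1%N - e 2%N).
Proof.
have c1 : dot (e 1%N - e 2%N) (ind 1) = 1.
  by rewrite dotBl !(dot_dual_vec a0 ee); try lia; rewrite /= subr0.
(* The Heisenberg roots with coefficient 1 at alpha_1, other than theta: 2 (n - 2) + k of them. The
   [nseq] contributes e_1 in type B and nothing in type D. *)
apply: (introBD _ ([seq e 1%N - e j | j <- iota 3 (n - 2)] ++
  [seq e 1%N + e j | j <- iota 3 (n - 2)] ++ nseq k (e 1%N *+ k))).
- by apply: long_subBD; lia.
- apply: (abelianBD _ _ (ind_anti 1) (ind_last 1)) => v /ind1_max.
  by rewrite c1; lra.
- apply: heisenberg_BD => [p j hp hj|p j hp hj|p hp k0] /(ind_le 1); rewrite c1.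
  + rewrite dotBl !(dot_dual_vec a0 ee); try lia.
    have [p1|p1] := leqP p 1; last by decide_nat_rel; rewrite /= => h; exfalso; lra.
    have -> : p = 1%N by lia.
    by move=> _; rewrite mem_cat; apply/orP; left; apply: map_f; rewrite mem_iota; lia.
  + rewrite dotDl !(dot_dual_vec a0 ee); try lia.
    have [p1|p1] := leqP p 1; last by decide_nat_rel; rewrite /= => h; exfalso; lra.
    have -> : p = 1%N by lia.
    move=> _; rewrite !mem_cat; apply/orP; right; apply/orP; left.
    by apply: map_f; rewrite mem_iota; lia.
  + rewrite dotMnl !(dot_dual_vec a0 ee); try lia.
    have [p1|p1] := leqP p 1; last by rewrite /= mul0rn => h; exfalso; lra.
    have -> : p = 1%N by lia.
    by move=> _; rewrite !mem_cat mem_nseq k0 eqxx !orbT.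
- rewrite !size_cat !size_map !size_iota size_nseq hBD_B hBD_D !hBD_coord; try lia.
  by rewrite !natrD natrB; [lra|lia].
- apply: orthogonal_witness_BD.
  + by left; exact: root_le_refl.
  + move=> i j hij hj _ /(ind_le 1); rewrite c1 dotBl !(dot_dual_vec a0 ee); try lia.
    by decide_nat_rel; rewrite /=; lra.
  + move=> i j hij hj _ /(ind_le 1); rewrite c1 dotDl !(dot_dual_vec a0 ee); try lia.
    by decide_nat_rel; rewrite /=; lra.
  + move=> k0 /(ind_le 1); rewrite c1 dotMnl !(dot_dual_vec a0 ee); try lia.
    by rewrite /= mul0rn; lra.
Qed.

(** [ind q] equal to 2 forces plus signs and indices at most q, and [ind 1] forces the first index
    to be 1. This leaves q - 2 Heisenberg roots, the drop in coroot height from theta; abelianness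
    comes from [ind 1], which is at most 1. *)
Lemma amazing_BD_1add q : (2 <= q <= n)%N -> amazing D P (e 1%N + e q).
Proof.
move=> hq.
have c1 : dot (e 1%N + e q) (ind 1) = 1.
  by rewrite dotDl !(dot_dual_vec a0 ee); try lia; decide_nat_rel; rewrite /= addr0.
have cq : dot (e 1%N + e q) (ind q) = 2.
  by rewrite dotDl !(dot_dual_vec a0 ee); try lia; decide_nat_rel.
apply: (introBD _ [seq e 1%N + e j | j <- iota 3 (q - 2)]).
- by apply: long_addBD; lia.
- apply: (abelianBD _ _ (ind_anti 1) (ind_last 1)) => v /ind1_max.
  by rewrite c1; lra.
- apply: heisenberg_BD => [p j hp hj|p j hp hj|p hp k0] le;
    have := ind_le 1 _ _ le; have := ind_le q _ _ le; rewrite c1 cq => {le}.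
  + rewrite !dotBl !(dot_dual_vec a0 ee); try lia.
    by have := bool_bounds (j <= q)%N; decide_nat_rel; rewrite /= => ? h; exfalso; lra.
  + rewrite !dotDl !(dot_dual_vec a0 ee); try lia.
    have [jq|jq] := leqP j q; last first.
      by decide_nat_rel; rewrite /= => h; exfalso; lra.
    have [p1|p1] := leqP p 1; last by decide_nat_rel; rewrite /= => _ h; exfalso; lra.
    have -> : p = 1%N by lia.
    by move=> _ _; apply: map_f; rewrite mem_iota; lia.
  + rewrite !dotMnl !(dot_dual_vec a0 ee); try lia.
    rewrite (_ : k = 1%N); last by lia.
    by decide_nat_rel; rewrite /= mulr1n => h; exfalso; lra.
- rewrite size_map size_iota !hBD_D !hBD_coord; try lia.
  by rewrite natrB; [lra|lia].
- apply: orthogonal_witness_BD.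
  + right; move=> /(ind_le q); rewrite cq !dotBl !(dot_dual_vec a0 ee); try lia.
    by have := bool_bounds (3 <= q)%N; decide_nat_rel; rewrite /=; lra.
  + move=> i j hij hj _ /(ind_le 1); rewrite c1 dotBl !(dot_dual_vec a0 ee); try lia.
    by decide_nat_rel; rewrite /=; lra.
  + move=> i j hij hj _ /(ind_le 1); rewrite c1 dotDl !(dot_dual_vec a0 ee); try lia.
    by decide_nat_rel; rewrite /=; lra.
  + move=> k0 /(ind_le 1); rewrite c1 dotMnl !(dot_dual_vec a0 ee); try lia.
    by rewrite /= mul0rn; lra.
Qed.

(** Here [ind q.+1] alone describes the ideal, since 2 is its maximum on positive roots. There are 2
    (q - 1) Heisenberg roots above, which matches the drop in h because the two indices are
    consecutive. *)
Lemma amazing_BD_consecutive q : (2 <= q < n)%N -> amazing D P (e q + e q.+1).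
Proof.
move=> hq.
have cq : dot (e q + e q.+1) (ind q.+1) = 2.
  by rewrite dotDl !(dot_dual_vec a0 ee); try lia; decide_nat_rel.
apply: (introBD _ ([seq e 1%N + e j | j <- iota 3 (q - 1)] ++
  [seq e 2%N + e j | j <- iota 3 (q - 1)])).
- by apply: long_addBD; lia.
- apply: (abelianBD _ _ (ind_anti q.+1) (ind_last q.+1)) => v /(ind_max q.+1).
  by rewrite cq; lra.
- apply: heisenberg_BD => [p j hp hj|p j hp hj|p hp k0] /(ind_le q.+1); rewrite cq.
  + rewrite !dotBl !(dot_dual_vec a0 ee); try lia.
    by have := bool_bounds (j <= q.+1)%N; decide_nat_rel; rewrite /= => ? h; exfalso; lra.
  + rewrite !dotDl !(dot_dual_vec a0 ee); try lia.
    have [jq|jq] := leqP j q.+1; last first.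
      by decide_nat_rel; rewrite /= => h; exfalso; lra.
    rewrite mem_cat => _; apply/orP.
    have p12 : p = 1%N \/ p = 2 by lia.
    by case: p12 => ->; [left|right]; apply: map_f; rewrite mem_iota; lia.
  + rewrite !dotMnl !(dot_dual_vec a0 ee); try lia.
    rewrite (_ : k = 1%N); last by lia.
    by decide_nat_rel; rewrite /= mulr1n => h; exfalso; lra.
- rewrite size_cat !size_map !size_iota !hBD_D !hBD_coord; try lia.
  by rewrite natrD natrB -?natr1; [lra|lia].
- apply: orthogonal_witness_BD.
  + right; move=> /(ind_le q.+1); rewrite cq !dotBl !(dot_dual_vec a0 ee); try lia.
    by have := bool_bounds (3 <= q.+1)%N; decide_nat_rel; rewrite /=; lra.
  + move=> i j hij hj _ /(ind_le q.+1); rewrite cq dotBl !(dot_dual_vec a0 ee); try lia.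
    by have := bool_bounds (j <= q.+1)%N; decide_nat_rel; rewrite /=; lra.
  + move=> i j hij hj h /(ind_le q.+1); rewrite cq dotDl !(dot_dual_vec a0 ee); try lia.
    have [jq|jq] := leqP j q.+1; last by decide_nat_rel; rewrite /=; lra.
    exfalso; apply: h; rewrite /root_le.
    rewrite (_ : _ - _ = (e i - e q) + (e j - e q.+1)).
      by apply: nonnegD; apply: nonneg_subBD; lia.
    by apply/rowP => x; rewrite !mxE; ring.
  + move=> k0 /(ind_le q.+1); rewrite cq dotMnl !(dot_dual_vec a0 ee); try lia.
    rewrite (_ : k = 1%N); last by lia.
    by decide_nat_rel; rewrite /= mulr1n; lra.
Qed.

(** The mirror image of e_1 + e_n under the diagram automorphism e_n -> - e_n; [spin] takes over the
    part of [ind n]. *)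
Lemma amazing_D_1n : k == 0%N -> amazing D P (e 1%N - e n).
Proof.
move=> k0.
have c1 : dot (e 1%N - e n) (ind 1) = 1.
  by rewrite dotBl !(dot_dual_vec a0 ee); try lia; decide_nat_rel; rewrite /= subr0.
have cs : dot (e 1%N - e n) spin = 2.
  by rewrite dotBl !(dot_dual_vec a0 ee); try lia; decide_nat_rel; rewrite opprK.
apply: (introBD _ ([seq e 1%N + e j | j <- iota 3 (n - 3)] ++ [:: e 1%N - e n])).
- by apply: long_subBD; lia.
- apply: (abelianBD _ _ (ind_anti 1) (ind_last 1)) => v /ind1_max.
  by rewrite c1; lra.
- apply: heisenberg_BD => [p j hp hj|p j hp hj|p hp kpos] le; last by exfalso; lia.
    have := ind_le 1 _ _ le; have := spin_le _ _ k0 le; rewrite c1 cs => {le}.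
    rewrite !dotBl !(dot_dual_vec a0 ee); try lia.
    have [jn|jn] := ltnP j n; first by decide_nat_rel => h; exfalso; lra.
    have [p1|p1] := leqP p 1; last by decide_nat_rel; rewrite /= => _ h; exfalso; lra.
    have -> : p = 1%N by lia.
    have -> : j = n by lia.
    by move=> _ _; rewrite mem_cat inE eqxx orbT.
  have := ind_le 1 _ _ le; have := spin_le _ _ k0 le; rewrite c1 cs => {le}.
  rewrite !dotDl !(dot_dual_vec a0 ee); try lia.
  have [jn|jn] := ltnP j n; last by decide_nat_rel => h; exfalso; lra.
  have [p1|p1] := leqP p 1; last by decide_nat_rel; rewrite /= => _ h; exfalso; lra.
  have -> : p = 1%N by lia.
  by move=> _ _; rewrite mem_cat; apply/orP; left; apply: map_f; rewrite mem_iota; lia.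
- rewrite size_cat !size_map !size_iota hBD_B hBD_D !hBD_coord; try lia.
  have := ler0n R k.
  by rewrite /= natrD natrB; [lra|lia].
- apply: orthogonal_witness_BD.
  + right; move=> /(spin_le _ _ k0); rewrite cs !dotBl !(dot_dual_vec a0 ee); try lia.
    by decide_nat_rel; rewrite /=; lra.
  + move=> i j hij hj _ /(ind_le 1); rewrite c1 dotBl !(dot_dual_vec a0 ee); try lia.
    by decide_nat_rel; rewrite /=; lra.
  + move=> i j hij hj _ /(ind_le 1); rewrite c1 dotDl !(dot_dual_vec a0 ee); try lia.
    by decide_nat_rel; rewrite /=; lra.
  + by move=> kpos; exfalso; lia.
Qed.

(** The simple root at a spin node, which has coefficient 1 in theta: the ideal consists of the
    positive roots where [spin] attains its maximum 2. It is the mirror image of e_(n-1) + e_n. *)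
Lemma amazing_D_last : k == 0%N -> amazing D P (e n.-1 - e n).
Proof.
move=> k0.
have cs : dot (e n.-1 - e n) spin = 2.
  by rewrite dotBl !(dot_dual_vec a0 ee); try lia; decide_nat_rel; rewrite opprK.
apply: (introBD _ ([seq e 1%N + e j | j <- iota 3 (n - 3)] ++
  [seq e 2%N + e j | j <- iota 3 (n - 3)] ++ [:: e 1%N - e n; e 2%N - e n])).
- by apply: long_subBD; lia.
- apply: (abelianBD _ _ spin_anti (spin_last k0)) => v /(spin_max _ k0).
  by rewrite cs; lra.
- apply: heisenberg_BD => [p j hp hj|p j hp hj|p hp kpos] /(spin_le _ _ k0);
    last by exfalso; lia.
    rewrite cs !dotBl !(dot_dual_vec a0 ee); try lia.
    have [jn|jn] := ltnP j n; first by decide_nat_rel => h; exfalso; lra.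
    have -> : j = n by lia.
    move=> _; rewrite !mem_cat !inE.
    have p12 : p = 1%N \/ p = 2 by lia.
    by case: p12 => ->; rewrite eqxx !orbT.
  rewrite cs !dotDl !(dot_dual_vec a0 ee); try lia.
  have [jn|jn] := ltnP j n; last by decide_nat_rel => h; exfalso; lra.
  move=> _; rewrite !mem_cat; apply/orP.
  have [->|->] : p = 1%N \/ p = 2 by lia.
    by left; apply: map_f; rewrite mem_iota; lia.
  by right; apply/orP; left; apply: map_f; rewrite mem_iota; lia.
- have n1E : n.-1%:R = n%:R - 1 :> R.
    by rewrite -[in RHS](@prednK n) -?natr1 ?addrK //; lia.
  rewrite !size_cat !size_map !size_iota hBD_B hBD_D !hBD_coord; try lia.
  have := ler0n R k.
  by rewrite n1E /= !natrD natrB; [lra|lia].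
- apply: orthogonal_witness_BD.
  + right; move=> /(spin_le _ _ k0); rewrite cs !dotBl !(dot_dual_vec a0 ee); try lia.
    by decide_nat_rel; rewrite /=; lra.
  + move=> i j hij hj h /(spin_le _ _ k0); rewrite cs dotBl !(dot_dual_vec a0 ee); try lia.
    have [jn|jn] := ltnP j n; first by decide_nat_rel; lra.
    exfalso; apply: h; have -> : j = n by lia.
    rewrite /root_le (_ : _ - _ = e i - e n.-1); first by apply: nonneg_subBD; lia.
    by apply/rowP => x; rewrite !mxE; ring.
  + move=> i j hij hj h /(spin_le _ _ k0); rewrite cs dotDl !(dot_dual_vec a0 ee); try lia.
    have [jn|jn] := ltnP j n; last by decide_nat_rel; lra.
    exfalso; apply: h; rewrite /root_le (_ : _ - _ = (e i - e n.-1) + (e j + e n)).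
      by apply: nonnegD; [apply: nonneg_subBD|apply: nonneg_addBD]; lia.
    by apply/rowP => x; rewrite !mxE; ring.
  + by move=> kpos; exfalso; lia.
Qed.

Local Notation heis b := [/\ positive D P b, 0 < dot b theta & b <> theta].

Lemma heisenberg_sub p j : (1 <= p <= 2)%N -> (3 <= j <= n)%N -> heis (e p - e j).
Proof.
move=> hp hj; split; first by rewrite positiveBD; apply: RootSub; lia.
  by rewrite dotBl !dot_thetaBD; try lia; decide_nat_rel; rewrite subr0.
move=> /(congr1 (fun v => dot v (e j))); rewrite dotBl dotDl !(coord_dot ee); try lia.
by decide_nat_rel; rewrite /= => h; move: h a0; lra.
Qed.

Lemma heisenberg_add p j : (1 <= p <= 2)%N -> (3 <= j <= n)%N -> heis (e p + e j).
Proof.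
move=> hp hj; split; first by rewrite positiveBD; apply: RootAdd; lia.
  by rewrite dotDl !dot_thetaBD; try lia; decide_nat_rel; rewrite addr0.
move=> /(congr1 (fun v => dot v (e j))); rewrite !dotDl !(coord_dot ee); try lia.
by decide_nat_rel; rewrite /= => h; move: h a0; lra.
Qed.

Lemma heisenberg_mul : (0 < k)%N -> heis (e 1%N *+ k).
Proof.
move=> k0; have kE : k = 1%N by lia.
split; first by rewrite positiveBD; apply: RootMul; lia.
  by rewrite dotMnl !dot_thetaBD; try lia; rewrite kE.
move=> /(congr1 (fun v => dot v (e 2%N))); rewrite dotMnl !dotDl !(coord_dot ee); try lia.
by rewrite kE /= => h; move: h a0; lra.
Qed.

Lemma uniq_map_add p j l : (1 <= j)%N -> (j + l <= n.+1)%N ->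
  uniq [seq e p + e i | i <- iota j l].
Proof.
move=> hj hl; rewrite map_inj_in_uniq ?iota_uniq // => x y.
rewrite !mem_iota => hx hy /addrI.
by apply: (coord_inj a0 ee); lia.
Qed.

Lemma uniq_map_sub p j l : (1 <= j)%N -> (j + l <= n.+1)%N ->
  uniq [seq e p - e i | i <- iota j l].
Proof.
move=> hj hl; rewrite map_inj_in_uniq ?iota_uniq // => x y.
rewrite !mem_iota => hx hy /addrI /oppr_inj.
by apply: (coord_inj a0 ee); lia.
Qed.

(** The ideal is not abelian: e_i - e_n and e_(i-1) + e_n both lie above e_i - e_j, and their sum
    e_(i-1) + e_i is a root. The second comparison needs e_j + e_n to be nonnegative, which is the
    role of the side condition. *)
Lemma not_amazing_sub i j : (2 <= i < j)%N -> (j <= n)%N -> (0 < k)%N || (j < n)%N ->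
  ~ amazing D P (e i - e j).
Proof.
move=> hij hj hk /amazing_abelian - /(_ (e i - e n) (e i.-1 + e n)).
rewrite positiveBD; apply.
- by apply: RootSub; lia.
- by apply: RootAdd; lia.
- rewrite /root_le (_ : _ - _ = e j - e n); first by apply: nonneg_subBD; lia.
  by apply/rowP => x; rewrite !mxE; ring.
- rewrite /root_le (_ : _ - _ = (e i.-1 - e i) + (e n + e j)).
    by apply: nonnegD; [apply: nonneg_subBD|apply: nonneg_addBD]; lia.
  by apply/rowP => x; rewrite !mxE; ring.
- have -> : e i - e n + (e i.-1 + e n) = e i.-1 + e i.
    by apply/rowP => x; rewrite !mxE; ring.
  by apply: RootAdd; lia.
Qed.

Local Notation size_leBD :=
  (amazing_size_le rsD srP highestBD longBD hBD_sub hBD_simple).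

(** One Heisenberg root too many: 2n - 1 + k - j of them lie above, while the coroot height allows
    2n - 2 + k - j. *)
Lemma not_amazing_1sub j : (3 <= j <= n)%N -> (0 < k)%N || (j < n)%N ->
  ~ amazing D P (e 1%N - e j).
Proof.
move=> hj hk am.
have := size_leBD _ ([seq e 1%N - e i | i <- iota j (n.+1 - j)] ++
  ([seq e 1%N + e i | i <- iota 3 (n - 2)] ++ nseq k (e 1%N *+ k))) am.
rewrite !size_cat !size_map !size_iota size_nseq hBD_B hBD_D !hBD_coord; try lia.
rewrite !natrD !natrB; try lia.
have e12 i : (1 <= i <= n)%N -> dot (e i) (ind n) = 1.
  by move=> hi; rewrite (dot_dual_vec a0 ee) //; decide_nat_rel.
have ek : (0 < k)%N -> dot (e 1%N *+ k) (ind n) = 1.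
  move=> k0; rewrite (_ : k = 1%N); last by lia.
  by rewrite mulr1n e12 //; lia.
move=> H; suff : n.+1%:R - j%:R + (n%:R - 2 + k%:R) <= hBD theta - hBD (e 1%N - e j).
  by rewrite hBD_B hBD_D !hBD_coord; try lia; rewrite -natr1; lra.
rewrite hBD_B hBD_D !hBD_coord; try lia.
apply: H.
(* The coordinate sum is 0, 1 and 2 on the roots e_1 - e_i, e_1 and e_1 + e_i respectively. *)
- apply: (uniq_cat_dot _ _ (ind n) 0).
  + by apply: uniq_map_sub; lia.
  + rewrite uniq_catC; apply: (uniq_cat_dot _ _ (ind n) 1).
    * have k01 : k = 0%N \/ k = 1%N by lia.
      by case: k01 => ->.
    * by apply: uniq_map_add; lia.
    * by move=> x; rewrite mem_nseq => /andP[k0 /eqP ->]; rewrite ek.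
    * move=> x /mapP[i]; rewrite mem_iota => hi ->.
      by rewrite dotDl !e12; [lra|lia..].
  + move=> x /mapP[i]; rewrite mem_iota => hi ->.
    by rewrite dotBl !e12; [rewrite subrr|lia..].
  + move=> x; rewrite mem_cat => /orP[/mapP[i]|].
      by rewrite mem_iota => hi ->; rewrite dotDl !e12; [lra|lia..].
    by rewrite mem_nseq => /andP[k0 /eqP ->]; rewrite ek.
- move=> b; rewrite !mem_cat => /or3P[/mapP[i]|/mapP[i]|].
  + rewrite mem_iota => hi ->; have [||? ? ?] := heisenberg_sub 1 i; try lia.
    split=> //; rewrite /root_le (_ : _ - _ = e j - e i).
      by apply: nonneg_subBD; lia.
    by apply/rowP => x; rewrite !mxE; ring.
  + rewrite mem_iota => hi ->; have [||? ? ?] := heisenberg_add 1 i; try lia.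
    split=> //; rewrite /root_le (_ : _ - _ = e j + e i).
      by apply: nonneg_addBD; lia.
    by apply/rowP => x; rewrite !mxE; ring.
  + rewrite mem_nseq => /andP[k0 /eqP ->]; have [? ? ?] := heisenberg_mul k0.
    have kE : k = 1%N by lia.
    split=> //; rewrite /root_le (_ : _ - _ = e j *+ k).
      by apply: (nonneg_mulBCD n2_BD k2_BD a0); lia.
    by rewrite kE; apply/rowP => x; rewrite !mxE; ring.
Qed.

(** There are 2 (j - 2) Heisenberg roots above against the i + j - 3 allowed; the excess is j - i -
    1, positive as soon as the indices are not consecutive. *)
Lemma not_amazing_add i j : (2 <= i)%N -> (i.+2 <= j <= n)%N ->
  ~ amazing D P (e i + e j).
Proof.
move=> hi hj am.
have := size_leBD _ ([seq e 2%N + e p | p <- iota 3 (j - 2)] ++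
  [seq e 1%N + e p | p <- iota 3 (j - 2)]) am.
rewrite !size_cat !size_map !size_iota !hBD_D !hBD_coord; try lia.
rewrite !natrD !natrB; try lia.
have ji : i%:R + 2 <= j%:R :> R by rewrite -natrD ler_nat; lia.
move=> H; suff : j%:R - 2 + (j%:R - 2) <= hBD theta - hBD (e i + e j).
  by rewrite !hBD_D !hBD_coord; try lia; lra.
rewrite !hBD_D !hBD_coord; try lia.
apply: H.
- apply: (uniq_cat_dot _ _ (ind 1) 0); try by apply: uniq_map_add; lia.
  + move=> x /mapP[p]; rewrite mem_iota => hp ->.
    rewrite dotDl !(dot_dual_vec a0 ee); try lia.
    by decide_nat_rel; rewrite /= addr0.
  + move=> x /mapP[p]; rewrite mem_iota => hp ->.
    rewrite dotDl !(dot_dual_vec a0 ee); try lia.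
    by decide_nat_rel; rewrite /= addr0.
- have above q p : (1 <= q <= 2)%N -> (3 <= p <= j)%N ->
    root_le P (e i + e j) (e q + e p).
    move=> hq hp; rewrite /root_le (_ : _ - _ = (e q - e i) + (e p - e j)).
      by apply: nonnegD; apply: nonneg_subBD; lia.
    by apply/rowP => x; rewrite !mxE; ring.
  move=> b; rewrite mem_cat => /orP[] /mapP[p]; rewrite mem_iota => hp ->.
    have [||? ? ?] := heisenberg_add 2 p; try lia.
    by split=> //; apply: above; lia.
  have [||? ? ?] := heisenberg_add 1 p; try lia.
  by split=> //; apply: above; lia.
Qed.

(** There are 2n - 4 Heisenberg roots above against the n + i - 3 allowed, too many when i < n -
    1. *)
Lemma not_amazing_D_subn i : k == 0%N -> (2 <= i)%N -> (i.+2 <= n)%N ->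
  ~ amazing D P (e i - e n).
Proof.
move=> k0 hi hn am.
have := size_leBD _ (([seq e 2%N + e p | p <- iota 3 (n - 3)] ++
  [seq e 1%N + e p | p <- iota 3 (n - 3)]) ++ [:: e 1%N - e n; e 2%N - e n]) am.
rewrite !size_cat !size_map !size_iota hBD_B hBD_D !hBD_coord; try lia.
rewrite !natrD !natrB; try lia.
have ni : i%:R + 2 <= n%:R :> R by rewrite -natrD ler_nat; lia.
have kE : k%:R = 0 :> R by rewrite (eqP k0).
move=> H; suff : n%:R - 3 + (n%:R - 3) + 2 <= hBD theta - hBD (e i - e n).
  by rewrite hBD_B hBD_D !hBD_coord; try lia; rewrite kE; lra.
rewrite hBD_B hBD_D !hBD_coord; try lia.
apply: H.
- rewrite uniq_catC; apply: (uniq_cat_dot _ _ (ind n) 0).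
  + rewrite /= inE andbT; apply/eqP => /addIr /(coord_inj a0 ee); lia.
  + apply: (uniq_cat_dot _ _ (ind 1) 0); try by apply: uniq_map_add; lia.
    * move=> x /mapP[p]; rewrite mem_iota => hp ->.
      rewrite dotDl !(dot_dual_vec a0 ee); try lia.
      by decide_nat_rel; rewrite /= addr0.
    * move=> x /mapP[p]; rewrite mem_iota => hp ->.
      rewrite dotDl !(dot_dual_vec a0 ee); try lia.
      by decide_nat_rel; rewrite /= addr0.
  + move=> x; rewrite !inE => /orP[] /eqP ->; rewrite dotBl !(dot_dual_vec a0 ee);
      try lia; by decide_nat_rel; rewrite subrr.
  + move=> x; rewrite mem_cat => /orP[] /mapP[p]; rewrite mem_iota => hp ->;
      rewrite dotDl !(dot_dual_vec a0 ee); try lia; by decide_nat_rel; rewrite /=; lra.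
- have above q p : (1 <= q <= 2)%N -> (3 <= p < n)%N ->
    root_le P (e i - e n) (e q + e p).
    move=> hq hp; rewrite /root_le (_ : _ - _ = (e q - e i) + (e p + e n)).
      by apply: nonnegD; [apply: nonneg_subBD|apply: nonneg_addBD]; lia.
    by apply/rowP => x; rewrite !mxE; ring.
  have above' q : (1 <= q <= 2)%N -> root_le P (e i - e n) (e q - e n).
    move=> hq; rewrite /root_le (_ : _ - _ = e q - e i).
      by apply: nonneg_subBD; lia.
    by apply/rowP => x; rewrite !mxE; ring.
  move=> b; rewrite !mem_cat => /orP[/orP[]|].
  + move=> /mapP[p]; rewrite mem_iota => hp ->.
    have [||? ? ?] := heisenberg_add 2 p; try lia.
    by split=> //; apply: above; lia.
  + move=> /mapP[p]; rewrite mem_iota => hp ->.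
    have [||? ? ?] := heisenberg_add 1 p; try lia.
    by split=> //; apply: above; lia.
  + rewrite !inE => /orP[] /eqP ->.
      have [||? ? ?] := heisenberg_sub 1 n; try lia.
      by split=> //; apply: above'.
    have [||? ? ?] := heisenberg_sub 2 n; try lia.
    by split=> //; apply: above'.
Qed.

Lemma amazing_B : (0 < k)%N -> amazing D P =
  [set e 1%N - e 2%N]
  `|` [set e 1%N + e j | j in [set j : nat | (2 <= j <= n)%N]]
  `|` [set e i + e i.+1 | i in [set i : nat | (2 <= i <= n.-1)%N]].
Proof.
move=> k0; apply/seteqP; split=> c.
  move=> /[dup] /amazing_long /long_positiveBD[i [j [hij hj [->|->]]]] am.
    have [i1|i2] := leqP i 1; last by exfalso; apply: (not_amazing_sub i j _ _ _ am); lia.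
    have i1E : i = 1%N by lia.
    rewrite i1E in am *; have [j2|j3] := leqP j 2.
      by left; left; rewrite (_ : j = 2); [|lia].
    by exfalso; apply: (not_amazing_1sub j _ _ am); lia.
  have [i1|i2] := leqP i 1.
    left; right; exists j; first by rewrite /=; lia.
    by congr (e _ + _); lia.
  have [j1|j2] := leqP j i.+1; last by exfalso; apply: (not_amazing_add i j _ _ am); lia.
  right; exists i; first by rewrite /=; lia.
  by congr (_ + e _); lia.
case=> [[->|[j /= hj <-]]|[i /= hi <-]].
- exact: amazing_BD_12.
- exact: amazing_BD_1add.
- by apply: amazing_BD_consecutive; lia.
Qed.

Lemma amazing_D : k == 0%N -> amazing D P =
  [set e 1%N - e 2%N; e 1%N - e n; e n.-1 - e n]
  `|` [set e 1%N + e j | j in [set j : nat | (2 <= j <= n)%N]]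
  `|` [set e i + e i.+1 | i in [set i : nat | (2 <= i <= n.-1)%N]].
Proof.
move=> k0; apply/seteqP; split=> c.
  move=> /[dup] /amazing_long /long_positiveBD[i [j [hij hj [->|->]]]] am.
    have [i1|i2] := leqP i 1.
      have i1E : i = 1%N by lia.
      rewrite i1E in am *; have [j2|j3] := leqP j 2.
        by left; left; left; left; rewrite (_ : j = 2); [|lia].
      have [jn|jn] := ltnP j n; first by exfalso; apply: (not_amazing_1sub j _ _ am); lia.
      by left; left; left; right; rewrite (_ : j = n); [|lia].
    have [jn|jn] := ltnP j n; first by exfalso; apply: (not_amazing_sub i j _ _ _ am); lia.
    have jnE : j = n by lia.
    rewrite jnE in am *; have [i3|i3] := leqP i.+2 n.
      by exfalso; apply: (not_amazing_D_subn i k0 _ _ am); lia.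
    by left; left; right; rewrite (_ : i = n.-1); [|lia].
  have [i1|i2] := leqP i 1.
    left; right; exists j; first by rewrite /=; lia.
    by congr (e _ + _); lia.
  have [j1|j2] := leqP j i.+1; last by exfalso; apply: (not_amazing_add i j _ _ am); lia.
  right; exists i; first by rewrite /=; lia.
  by congr (_ + e _); lia.
case=> [[[[->|->]|->]|[j /= hj <-]]|[i /= hi <-]].
- exact: amazing_BD_12.
- exact: amazing_D_1n.
- exact: amazing_D_last.
- exact: amazing_BD_1add.
- by apply: amazing_BD_consecutive; lia.
Qed.

End TypeBD.

(** * Exceptional types *)

(* Minus the Cartan integer of two distinct simple roots, indexed from 0. *)
Definition offdiag (d : seq nat) (E : seq (nat * nat)) (i j : nat) : nat :=
  if i == j then 0%N else
  if ((i.+1, j.+1) \in E) || ((j.+1, i.+1) \in E)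
  then (maxn (nth 0 d i) (nth 0 d j) %/ nth 0 d j)%N else 0%N.

Definition ndot (c v : seq nat) : nat := sumn [seq (x.1 * x.2)%N | x <- zip c v].

Definition le_coef (c c' : seq nat) : bool := all (fun x => x.1 <= x.2)%N (zip c c').

Definition simple_coef (r j : nat) : seq nat :=
  mkseq (fun i => nat_of_bool (i == j)) r.

(** * Enumeration of the positive roots and tests on coefficient lists *)

Section RootComputation.

(* The j-th row of M lists the [offdiag i j]. *)
Variables (d : seq nat) (M : seq (seq nat)).

Local Notation r := (size d).

Definition neighbours (c : seq nat) (j : nat) : nat := ndot c (nth [::] M j).

(* Reflecting in the simple root j replaces c_j by [neighbours c j - c_j], and
   raises the height when [2 c_j < neighbours c j]. *)
Definition refl_coef (j : nat) (c : seq nat) : seq nat :=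
  set_nth 0%N c j (neighbours c j - nth 0%N c j)%N.

Definition raising (c : seq nat) (j : nat) : bool :=
  (2 * nth 0%N c j < neighbours c j)%N.

Definition raise (L : seq (seq nat)) : seq (seq nat) :=
  undup (flatten [seq [seq refl_coef j c | j <- [seq j <- iota 0 r | raising c j]]
                 | c <- L]).

(** The layers are indexed by the number of reflections applied, not by height: outside the simply
    laced case a reflection can raise the height by more than one. *)
Fixpoint levels (k : nat) (L : seq (seq nat)) : seq (seq nat) :=
  if k is k'.+1 then L ++ levels k' (raise L) else [::].

(* The squared length of c is proportional to the difference of these two. *)
Definition norm_plus (c : seq nat) : nat :=
  (2 * ndot d [seq (x * x)%N | x <- c])%N.

Definition norm_minus (c : seq nat) : nat :=
  ndot d [seq (nth 0 c j * neighbours c j)%N | j <- iota 0 r].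

Variables (theta : seq nat).

Definition norm_le (c c' : seq nat) : bool :=
  (norm_plus c + norm_minus c' <= norm_plus c' + norm_minus c)%N.

Definition is_long (c : seq nat) : bool := norm_le c theta && norm_le theta c.

(** The inner products of theta with the simple roots, up to a common factor. The truncated
    subtraction is exact because [check_roots] tests that theta is dominant. *)
Definition theta_dot : seq nat :=
  [seq (nth 0 d j * (2 * nth 0 theta j - neighbours theta j))%N | j <- iota 0 r].

Definition theta_norm : nat := (norm_plus theta - norm_minus theta)%N.

(* The coroot height, up to the factor [theta_norm]. *)
Definition coht (c : seq nat) : nat := (2 * ndot c d)%N.

Variables (t : seq nat) (L : seq (seq nat)).

Definition in_heisenberg (c : seq nat) : bool := (0 < ndot c t)%N.

Definition few_above (c : seq nat) : bool :=
  (size [seq v <- L | [&& le_coef c v, in_heisenberg v & v != theta]] * theta_norm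
     + coht c <= coht theta)%N.

Definition witnessed (c : seq nat) : bool :=
  all (fun v => [|| in_heisenberg v, le_coef c v |
    has (fun b => [&& in_heisenberg b, le_coef v b & ~~ le_coef c b]) L]) L.

(** The first conjunct makes the count alone decide among long roots, so all nonmembers are refuted
    by counting. The last test of the second conjunct gives abelianness: some coefficient of c is
    more than half that of theta, so two roots above c cannot sum to a root. *)
Definition check_amazing (l : seq (seq nat)) : bool :=
  all (fun c => ~~ is_long c || ((c \in l) == few_above c)) L &&
  all (fun c => [&& c \in L, is_long c, witnessed c &
    has (fun j => nth 0 theta j < 2 * nth 0 c j)%N (iota 0 r)]) l.

Definition check_roots : bool :=
  [&& theta \in L, uniq L, all (fun c => le_coef c theta && norm_le c theta) L,
   all (fun j => neighbours theta j <= 2 * nth 0 theta j)%N (iota 0 r) &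
   (norm_minus theta <= norm_plus theta)%N].

(* Symmetrizability and connectedness determine the inner products up to a
   common factor. *)
Definition check_cartan : bool :=
  all (fun j => (0 < nth 0 d j)%N && all (fun i =>
        (nth 0 (nth [::] M j) i * nth 0 d j == nth 0 (nth [::] M i) j * nth 0 d i)%N)
     (iota 0 r)) (iota 0 r)
  && all (fun j => has (fun i => 0 < nth 0 (nth [::] M j) i)%N (iota 0 j)) (iota 1 r.-1).

End RootComputation.

Definition cartan_rows (d : seq nat) (E : seq (nat * nat)) : seq (seq nat) :=
  mkseq (fun j => mkseq (fun i => offdiag d E i j) (size d)) (size d).

(** The emptiness of the k-th iterate certifies that the first k layers are complete. *)
Definition check (d : seq nat) (E : seq (nat * nat)) (k : nat) (theta : seq nat)
    (l : seq (seq nat)) : bool :=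
  let M := cartan_rows d E in
  let L0 := mkseq (simple_coef (size d)) (size d) in
  let L := levels d M k L0 in
  let t := theta_dot d M theta in
  [&& iter k (raise d M) L0 == [::], (0 < size d)%N, check_cartan d M,
      check_roots d M theta L & check_amazing d M theta t L l].

Lemma ndot_sum r c v : size c = r -> size v = r ->
  ndot c v = (\sum_(i < r) nth 0 c i * nth 0 v i)%N.
Proof.
move=> sc sv; rewrite /ndot sumnE big_map (big_nth (0%N, 0%N)) size_zip sc sv minnn.
by rewrite big_mkord; apply: eq_bigr => i _; rewrite nth_zip ?sc ?sv.
Qed.

Lemma le_coefP r c c' : size c = r -> size c' = r ->
  reflect (forall i, (i < r)%N -> (nth 0 c i <= nth 0 c' i)%N) (le_coef c c').
Proof.
move=> sc sc'; apply: (iffP (all_nthP (0%N, 0%N))) => h i.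
  by move=> ir; have := h i; rewrite size_zip sc sc' minnn nth_zip ?sc ?sc' //; apply.
by rewrite size_zip sc sc' minnn nth_zip ?sc ?sc' //; exact: h.
Qed.

Section Combinations.

Context {R : realFieldType} {m : nat} (P : seq 'rV[R]_m).
Local Notation r := (size P).

Lemma comb_nonneg c : nonneg P (comb P c). Proof. by exists c. Qed.

Lemma comb_set_nth c j x : (j < r)%N ->
  comb P (set_nth 0%N c j x) = comb P c - P`_j *+ nth 0%N c j + P`_j *+ x.
Proof.
move=> jr; rewrite /comb [LHS](bigD1 (Ordinal jr)) //.
rewrite (bigD1 (Ordinal jr) (F := fun i => P`_i *+ nth 0%N c i)) //=.
rewrite nth_set_nth /= eqxx [X in _ = X + _]addrAC subrr add0r addrC.
by congr (_ + _); apply: eq_bigr => i ij; rewrite nth_set_nth /= ifF //; exact/negbTE.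
Qed.

Lemma comb_simple j : (j < r)%N -> comb P (simple_coef r j) = P`_j.
Proof.
move=> jr; rewrite /comb (bigD1 (Ordinal jr)) //= nth_mkseq // eqxx big1 ?addr0 // => i ij.
by rewrite nth_mkseq //= (_ : (i == j :> nat) = false) //; exact/negbTE.
Qed.

Hypothesis frP : free P.

Lemma cf_comb c (i : 'I_r) : cf P i (comb P c) = (nth 0%N c i)%:R.
Proof. exact: (cf_natsum P frP (fun i : 'I_r => nth 0%N c i)). Qed.

Lemma comb_inj c c' : size c = r -> size c' = r -> comb P c = comb P c' -> c = c'.
Proof.
move=> sc sc' e; apply: (@eq_from_nth _ 0%N); first by rewrite sc sc'.
move=> i; rewrite sc => ir; have := cf_comb c (Ordinal ir); rewrite e cf_comb /=.
by move=> /eqP; rewrite eqr_nat => /eqP.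
Qed.

Lemma root_le_comb c c' : size c = r -> size c' = r ->
  root_le P (comb P c) (comb P c') <-> le_coef c c'.
Proof.
move=> sc sc'; split=> [le|/(le_coefP _ _ _ sc sc') le].
  apply/(le_coefP _ _ _ sc sc') => i ir.
  have := cf_ge0 P frP (Ordinal ir) _ le.
  by rewrite cfB !cf_comb subr_ge0 ler_nat.
exists (mkseq (fun i => nth 0 c' i - nth 0 c i)%N r).
rewrite /comb -sumrB; apply: eq_bigr => i _.
by rewrite nth_mkseq // mulrnBr // le.
Qed.

Lemma dot_combl c v : dot (comb P c) v = \sum_(i < r) dot P`_i v *+ nth 0%N c i.
Proof. by rewrite dot_suml; apply: eq_bigr => i _; rewrite dotMnl. Qed.

End Combinations.

(** * Correctness of the enumeration and of the tests *)

Section Exceptional.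

Context {R : realFieldType} {m : nat} {D : set 'rV[R]_m} {P : seq 'rV[R]_m}.
Context {d : seq nat} {E : seq (nat * nat)} {k : nat} {theta : seq nat}.
Context {l : seq (seq nat)}.
Hypotheses (rsD : root_system D) (srP : simple_roots D P).
Hypotheses (dynP : dynkin d E P).
Local Notation r := (size P).
Local Notation M := (cartan_rows d E).
Local Notation L0 := (mkseq (simple_coef (size d)) (size d)).
Local Notation L := (levels d M k L0).
Local Notation t := (theta_dot d M theta).
Hypotheses (lastL : iter k (raise d M) L0 = [::]) (r0 : (0 < size d)%N).
Hypotheses (cartanM : check_cartan d M).

Lemma rank_size : size d = r. Proof. by case: dynP => ->. Qed.

Let frP : free P. Proof. exact: sr_free srP. Qed.

Lemma cartan_rowsE i j : (i < r)%N -> (j < r)%N ->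
  nth 0%N (nth [::] M j) i = offdiag d E i j.
Proof. by rewrite -rank_size => ir jr; rewrite !nth_mkseq. Qed.

Lemma size_cartan_row j : (j < r)%N -> size (nth [::] M j) = r.
Proof. by rewrite -rank_size => jr; rewrite nth_mkseq // size_mkseq. Qed.

Lemma cartan_simple i j : (i < r)%N -> (j < r)%N ->
  cartan P`_i P`_j = 2 * (i == j)%:R - (offdiag d E i j)%:R.
Proof.
move=> ir jr; have [_ /(_ i.+1 j.+1)] := dynP; rewrite rank_size => /(_ ir jr) /= ->.
rewrite /dynkin_cartan /offdiag eqSS; case: eqP => _ /=; first by rewrite subr0 mulr1.
by case: ifP => _; rewrite mulr0 ?subr0 // sub0r rmorphN.
Qed.

Lemma neighbours_sum c j : size c = r -> (j < r)%N ->
  (neighbours M c j)%:R = \sum_(i < r) (offdiag d E i j)%:R *+ nth 0%N c i :> R.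
Proof.
move=> sc jr; rewrite /neighbours (ndot_sum r) // ?size_cartan_row // natr_sum.
by apply: eq_bigr => i _; rewrite cartan_rowsE // natrM mulr_natl.
Qed.

Lemma cartan_comb c j : size c = r -> (j < r)%N ->
  cartan (comb P c) P`_j = 2 * (nth 0%N c j)%:R - (neighbours M c j)%:R.
Proof.
move=> sc jr; rewrite /cartan dot_combl mulr_sumr mulr_suml.
have -> : \sum_(i < r) 2 * (dot P`_i P`_j *+ nth 0%N c i) / dot P`_j P`_j =
    \sum_(i < r) cartan P`_i P`_j *+ nth 0%N c i.
  by apply: eq_bigr => i _; rewrite -mulrnAl -mulrnAr.
rewrite neighbours_sum // (eq_bigr (fun i : 'I_r =>
  (2 * (i == j :> nat)%:R) *+ nth 0%N c i - (offdiag d E i j)%:R *+ nth 0%N c i)).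
  rewrite sumrB; congr (_ - _); rewrite (bigD1 (Ordinal jr)) //= eqxx big1.
    by rewrite addr0 mulr1 mulr_natr.
  by move=> i ij; rewrite (_ : (i == j :> nat) = false) ?mulr0 ?mul0rn //; exact/negbTE.
by move=> i _; rewrite cartan_simple // mulrnBl.
Qed.

Lemma simple_neq0 j : (j < r)%N -> P`_j != 0.
Proof. by move=> jr; apply: (root_neq0 rsD); apply: (sr_root srP); exact: mem_nth. Qed.

(** Every simple root after the first is joined to an earlier one, and the two expressions of 2
    (alpha_i, alpha_j) by Cartan integers carry the scale across that edge. *)
Lemma inner_scale : exists2 a : R, 0 < a &
  forall j, (j < r)%N -> dot P`_j P`_j = 2 * a * (nth 0%N d j)%:R.
Proof.
have /andP[/allP symM /allP conM] : check_cartan d M := cartanM.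
have inI j : (j < r)%N -> j \in iota 0 (size d) by rewrite mem_iota rank_size.
have d0 j : (j < r)%N -> (0 < nth 0 d j)%N.
  by move=> /inI /symM /andP[].
have r0' : (0 < r)%N by rewrite -rank_size.
have [a a_gt0 aE] : exists2 a : R, 0 < a & dot P`_0 P`_0 = 2 * a * (nth 0%N d 0)%:R.
  exists (dot P`_0 P`_0 / (2 * (nth 0%N d 0)%:R)).
    by rewrite divr_gt0 ?mulr_gt0 ?ltr0n ?d0 // dot_sqr_gt0 simple_neq0.
  by field; rewrite pnatr_eq0 -lt0n d0.
exists a => // j; elim/ltn_ind: j => j IH jr.
have [->//|j0] := posnP j.
have jI : j \in iota 1 (size d).-1 by rewrite mem_iota rank_size; lia.
have /hasP[i] := conM j jI; rewrite mem_iota add0n => /andP[_ ij]; have ir := ltn_trans ij jr.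
have /andP[_ /allP /(_ i (inI i ir))] := symM j (inI j jr).
rewrite !cartan_rowsE // => /eqP sym nij.
have := cartan_dot P`_i P`_j (simple_neq0 j jr).
have := cartan_dot P`_j P`_i (simple_neq0 i ir).
rewrite !cartan_simple // (dotC P`_j P`_i) => <-.
rewrite (eq_sym j i) (_ : (i == j) = false) ?mulr0 ?sub0r ?(IH i ij ir) //; last by lia.
rewrite !mulNr => /oppr_inj e; apply: (mulfI (_ : (offdiag d E i j)%:R != 0)).
  by rewrite pnatr_eq0 -lt0n.
rewrite e; move: sym => /(congr1 (fun x => x%:R : R)); rewrite !natrM => sym.
transitivity (2 * a * ((offdiag d E j i)%:R * (nth 0%N d i)%:R)); first by ring.
by rewrite -sym; ring.
Qed.

Context {a : R}.
Hypotheses (a_gt0 : 0 < a).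
Hypotheses (aE : forall j, (j < r)%N -> dot P`_j P`_j = 2 * a * (nth 0%N d j)%:R).

Lemma dot_comb_simple c j : size c = r -> (j < r)%N -> dot (comb P c) P`_j =
  a * (nth 0%N d j)%:R * (2 * (nth 0%N c j)%:R - (neighbours M c j)%:R).
Proof.
move=> sc jr; apply: (mulfI (_ : 2 != 0 :> R)); first by rewrite pnatr_eq0.
by rewrite -(cartan_dot _ _ (simple_neq0 j jr)) cartan_comb // aE //; ring.
Qed.

Lemma dot_comb c c' : size c = r -> size c' = r -> dot (comb P c') (comb P c) =
  \sum_(j < r) a * (nth 0%N d j)%:R * (2 * (nth 0%N c j)%:R - (neighbours M c j)%:R)
     * (nth 0%N c' j)%:R.
Proof.
move=> sc sc'; rewrite dot_combl; apply: eq_bigr => j _.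
by rewrite dotC dot_comb_simple // [RHS]mulr_natr.
Qed.

Lemma dot_comb_norm c : size c = r ->
  dot (comb P c) (comb P c) = a * ((norm_plus d c)%:R - (norm_minus d M c)%:R).
Proof.
move=> sc; rewrite dot_comb // /norm_plus /norm_minus.
rewrite !(ndot_sum r) ?rank_size ?size_map ?size_iota ?rank_size //.
rewrite natrM !natr_sum mulr_sumr -sumrB mulr_sumr; apply: eq_bigr => j _.
rewrite (nth_map 0%N) ?sc // (nth_map 0%N) ?size_iota // nth_iota // add0n.
by rewrite !natrM; ring.
Qed.

Lemma comb_refl_coef c j : size c = r -> (j < r)%N ->
  (nth 0 c j <= neighbours M c j)%N ->
  refl P`_j (comb P c) = comb P (refl_coef M j c).
Proof.
move=> sc jr le; rewrite /refl_coef comb_set_nth // /refl cartan_comb // mulrnBr //.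
rewrite scalerBl -natrM !scaler_nat mul2n -addnn mulrnDr.
by apply/rowP => i; rewrite !mxE; ring.
Qed.

Lemma size_refl_coef c j : size c = r -> (j < r)%N -> size (refl_coef M j c) = r.
Proof. by move=> sc jr; rewrite size_set_nth sc; apply/maxn_idPr. Qed.

Lemma raiseP c L1 : c \in raise d M L1 ->
  exists c' j, [/\ c' \in L1, (j < r)%N, raising M c' j & c = refl_coef M j c'].
Proof.
rewrite mem_undup => /flattenP[s /mapP[c' c'L ->] /mapP[j]].
by rewrite mem_filter mem_iota rank_size => /andP[h jr] ->; exists c', j.
Qed.

Lemma raise_mem c j L1 : c \in L1 -> (j < r)%N -> raising M c j ->
  refl_coef M j c \in raise d M L1.
Proof.
move=> cL jr h; rewrite mem_undup; apply/flattenP; eexists; first exact: map_f cL.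
by apply: (map_f (fun j => refl_coef M j c)); rewrite mem_filter h mem_iota rank_size.
Qed.

Lemma raising_le c j : raising M c j -> (nth 0 c j <= neighbours M c j)%N.
Proof. by rewrite /raising; lia. Qed.

Lemma levels_root c : c \in L -> size c = r /\ D (comb P c).
Proof.
have H0 c' : c' \in L0 -> size c' = r /\ D (comb P c').
  move=> /mapP[j]; rewrite mem_iota rank_size => jr ->; rewrite size_mkseq.
  by rewrite comb_simple //; split=> //; apply: (sr_root srP); exact: mem_nth.
elim: k L0 H0 => [//|k' IH] L1 H1 /=; rewrite mem_cat => /orP[/H1 //|].
apply: IH => c' /raiseP[c'' [j [/H1[sc Dc] jr h ->]]].
split; first exact: size_refl_coef.
rewrite -comb_refl_coef //; last exact: raising_le.
by apply: rs_refl => //; apply: (sr_root srP); exact: mem_nth.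
Qed.

Lemma levels_simple j : (j < r)%N -> simple_coef (size d) j \in L.
Proof.
move=> jr; have s0 : simple_coef (size d) j \in L0.
  by apply: map_f; rewrite mem_iota rank_size.
case: k lastL => [/= e|k' _ /=]; first by rewrite e in s0.
by rewrite mem_cat s0.
Qed.

(** A raised root belongs to the next layer; it could be lost only after the last enumerated layer,
    and the layer after that one is empty. *)
Lemma levels_raise c j : c \in L -> (j < r)%N -> raising M c j ->
  refl_coef M j c \in L.
Proof.
move=> + jr h; elim: k L0 lastL => [//|k' IH] L1 /=; rewrite -iterS iterSr => e.
rewrite !mem_cat => /orP[cL|/(IH _ e) ->]; last by rewrite orbT.
have H := raise_mem _ _ _ cL jr h; apply/orP; right.
case: k' e {IH} => [/= e|k' _ /=]; first by move: H; rewrite e.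
by rewrite mem_cat H.
Qed.

Lemma positive_levels : positive D P = [set comb P c | c in [set` L]].
Proof.
apply: (positive_eq_raise rsD srP) => [al alP|v [c /= /levels_root[_ Dc] <-]|].
- have jr : (index al P < r)%N by rewrite index_mem.
  exists (simple_coef (size d) (index al P)); first exact: levels_simple.
  by rewrite rank_size comb_simple // nth_index.
- by split=> //; exact: comb_nonneg.
move=> al v alP [c /= cL <-].
have jr : (index al P < r)%N by rewrite index_mem.
have [sc _] := levels_root _ cL.
rewrite -(nth_index 0 alP) dot_comb_simple // => neg.
have h : raising M c (index al P).
  rewrite /raising -(ltr_nat R) natrM -subr_lt0; move: neg.
  apply: contraTT; rewrite -!leNgt => ge0.
  by rewrite mulr_ge0 // mulr_ge0 // ltW.
exists (refl_coef M (index al P) c); first exact: levels_raise.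
by rewrite comb_refl_coef //; exact: raising_le.
Qed.

Hypotheses (rootsL : check_roots d M theta L).

Lemma theta_levels : theta \in L. Proof. by case/and5P: rootsL. Qed.

Lemma size_theta : size theta = r. Proof. by case: (levels_root _ theta_levels). Qed.

Lemma highest_levels : highest_root D P (comb P theta).
Proof.
rewrite /highest_root positive_levels; split; first by exists theta => //; exact: theta_levels.
move=> v [c /= cL <-]; have [sc _] := levels_root _ cL.
apply/(root_le_comb P frP) => //; first exact: size_theta.
by have /and5P[_ _ /allP /(_ c cL) /andP[]] := rootsL.
Qed.

Lemma norm_leP c c' : size c = r -> size c' = r ->
  norm_le d M c c' = (dot (comb P c) (comb P c) <= dot (comb P c') (comb P c')).
Proof.
move=> sc sc'; rewrite !dot_comb_norm // ler_pM2l // /norm_le.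
by rewrite lerBlDr addrAC lerBrDr -!natrD ler_nat.
Qed.

Lemma long_levels v : D v -> dot v v <= dot (comb P theta) (comb P theta).
Proof.
wlog pv : v / positive D P v => [H Dv|Dv].
  have [/H|/H] := pos_or_neg rsD srP v Dv; first exact.
  by rewrite -[dot v v]dotNN; apply; exact: (root_opp rsD).
move: pv; rewrite positive_levels => -[c /= cL <-]; have [sc _] := levels_root _ cL.
rewrite -norm_leP ?size_theta //.
by have /and5P[_ _ /allP /(_ c cL) /andP[]] := rootsL.
Qed.

Lemma dot_comb_theta c : size c = r ->
  dot (comb P c) (comb P theta) = a * (ndot c t)%:R.
Proof.
have sth := size_theta.
move=> sc; rewrite dot_comb // (ndot_sum r) ?size_map ?size_iota ?rank_size //.
rewrite natr_sum mulr_sumr; apply: eq_bigr => j _.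
have -> : nth 0%N t j =
    (nth 0 d j * (2 * nth 0 theta j - neighbours M theta j))%N.
  by rewrite /theta_dot (nth_map 0%N) ?size_iota ?rank_size // nth_iota ?rank_size.
rewrite !natrM natrB ?natrM; first by ring.
have /and5P[_ _ _ /allP /(_ (j : nat)) h _] := rootsL.
by apply: h; rewrite mem_iota rank_size /=.
Qed.

Lemma in_heisenbergE c : size c = r ->
  in_heisenberg t c = (0 < dot (comb P c) (comb P theta)).
Proof. by move=> sc; rewrite dot_comb_theta // pmulr_rgt0 // ltr0n. Qed.

Lemma theta_norm_gt0 : (0 < theta_norm d M theta)%N.
Proof.
have := root_dot_gt0 rsD _ (theta_root highest_levels).
rewrite dot_comb_norm ?size_theta // pmulr_rgt0 // subr_gt0 ltr_nat.
by rewrite /theta_norm subn_gt0.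
Qed.

Lemma dot_theta_self : dot (comb P theta) (comb P theta) = a * (theta_norm d M theta)%:R.
Proof.
rewrite dot_comb_norm ?size_theta // natrB //.
by have /and5P[] := rootsL.
Qed.

(** A simple root has squared length 2 a d_i and theta has a times [theta_norm], so the ratio gives
    the value required on simple roots; the common scale a cancels. *)
Let hE (v : 'rV[R]_m) : R :=
  (\sum_(i < r) cf P i v * (2 * (nth 0%N d i)%:R)) / (theta_norm d M theta)%:R.

Let hE_sub s u v : hE (u - s *: v) = hE u - s * hE v.
Proof.
rewrite /hE mulrA -mulrBl mulr_sumr -sumrB; congr (_ / _).
by apply: eq_bigr => i _; rewrite cfB cfZ; ring.
Qed.

Let hE_comb c : size c = r ->
  hE (comb P c) = (coht d c)%:R / (theta_norm d M theta)%:R.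
Proof.
move=> sc; rewrite /hE /coht (ndot_sum r) ?rank_size // natrM natr_sum mulr_sumr.
by congr (_ / _); apply: eq_bigr => i _; rewrite cf_comb // natrM; ring.
Qed.

Let hE_simple (al : 'rV[R]_m) :
  al \in P -> hE al * dot (comb P theta) (comb P theta) = dot al al.
Proof.
move=> alP; have jr : (index al P < r)%N by rewrite index_mem.
rewrite -(nth_index 0 alP) aE // dot_theta_self /hE (bigD1 (Ordinal jr)) //=.
rewrite big1 ?addr0 => [|i ij].
  rewrite (cf_nth P frP (Ordinal jr) (Ordinal jr)) eqxx mul1r.
  by field; rewrite pnatr_eq0 -lt0n theta_norm_gt0.
by rewrite (cf_nth P frP i (Ordinal jr)) eq_sym (negPf ij) mul0r.
Qed.

Lemma is_longP c : c \in L -> is_long d M theta c <-> long_positive D P (comb P c).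
Proof.
move=> cL; have [sc _] := levels_root _ cL; have sth := size_theta.
rewrite (long_positiveE highest_levels long_levels) /is_long !norm_leP // -eq_le.
split=> [/eqP e|[_ ->]] //; split=> //.
by rewrite positive_levels; exists c.
Qed.

Local Notation heis_above c :=
  [seq v <- L | [&& le_coef c v, in_heisenberg t v & v != theta]].

Lemma few_aboveP c : c \in L -> few_above d M theta t L c =
  ((size (heis_above c))%:R <= hE (comb P theta) - hE (comb P c)).
Proof.
move=> cL; have [sc _] := levels_root _ cL; rewrite !hE_comb ?size_theta // -mulrBl.
rewrite ler_pdivlMr ?ltr0n ?theta_norm_gt0 // lerBrDr -natrM -natrD ler_nat.
by [].
Qed.

Hypotheses (amazingL : check_amazing d M theta t L l).

Lemma amazing_levels : amazing D P = [set comb P c | c in [set` l]].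
Proof.
have sth := size_theta; have /andP[/allP L_few /allP l_good] := amazingL.
apply/seteqP; split=> v.
  move=> am; have [pv _] := amazing_long _ am.
  move: pv am; rewrite {1}positive_levels => -[c /= cL <-] am; exists c => //=.
  have [sc _] := levels_root _ cL.
  move: (L_few _ cL); rewrite (_ : is_long _ _ _ _) ?orbF /=; last first.
    by apply/(is_longP _ cL); exact: amazing_long _ am.
  move=> /eqP ->; rewrite few_aboveP //.
  rewrite -(size_map (comb P)); apply: (amazing_size_le rsD srP highest_levels
    long_levels hE_sub hE_simple) => //.
    rewrite map_inj_in_uniq.
      by apply: filter_uniq; case/and5P: rootsL.
    move=> x y; rewrite !mem_filter => /andP[_ /levels_root[sx _]] /andP[_ /levels_root[sy _]].
    exact: comb_inj.
  move=> b /mapP[x]; rewrite mem_filter => /andP[/and3P[cx hx xt] xL] ->.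
  have [sx _] := levels_root _ xL; split.
  - by rewrite positive_levels; exists x.
  - by rewrite -in_heisenbergE.
  - by move=> /(comb_inj P frP _ _ sx sth) e; rewrite e eqxx in xt.
  - exact/(root_le_comb P frP).
move=> [c /= cl <-]; have /and4P[cL lc /allP wc /hasP[j]] := l_good _ cl.
rewrite mem_iota rank_size /= => jr jc; have [sc _] := levels_root _ cL.
(* At the coefficient j with 2 c_j > theta_j, roots above c have at least c_j and positive roots at
   most theta_j. *)
have cf_theta u : positive D P u -> cf P (Ordinal jr) u <= (nth 0%N theta j)%:R.
  move=> /(le_theta highest_levels) /(cf_ge0 P frP (Ordinal jr)).
  by rewrite cfB cf_comb // subr_ge0.
have cf_above u : root_le P (comb P c) u -> (nth 0%N c j)%:R <= cf P (Ordinal jr) u.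
  by move=> /(cf_ge0 P frP (Ordinal jr)); rewrite cfB cf_comb // subr_ge0.
apply: (amazing_intro rsD srP highest_levels long_levels hE_sub hE_simple _
  (map (comb P) (heis_above c))).
- exact/(is_longP _ cL).
- move=> u u' pu pu' cu cu' /cf_theta; rewrite cfD.
  have := cf_above _ cu; have := cf_above _ cu'; move: jc.
  by rewrite -(ltr_nat R) natrM; lra.
- move=> b; rewrite positive_levels => -[x /= xL <-] bt b_t cb; apply: map_f.
  have [sx _] := levels_root _ xL.
  rewrite mem_filter xL in_heisenbergE // bt andbT.
  apply/and3P; split=> //; first exact/(root_le_comb P frP).
  by apply/eqP => xt; apply: b_t; rewrite xt.
- rewrite size_map -few_aboveP //; move: (L_few _ cL).
  by rewrite lc cl /= => /eqP <-.
- move=> u; rewrite positive_levels => -[x /= xL <-] xt cx.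
  have [sx _] := levels_root _ xL.
  move: (wc _ xL); rewrite in_heisenbergE // xt ltxx /=.
  rewrite (_ : le_coef c x = false) /=; last first.
    by apply/negP => /(root_le_comb P frP _ _ sc sx).
  move=> /hasP[y yL /and3P[hy xy cy]]; have [sy _] := levels_root _ yL.
  exists (comb P y); split.
  + by exists y.
  + by rewrite -in_heisenbergE.
  + exact/(root_le_comb P frP).
  + by move=> /(root_le_comb P frP _ _ sc sy); apply/negP.
Qed.

End Exceptional.

Lemma amazing_check {R : realFieldType} {m : nat} {D : set 'rV[R]_m} {P : seq 'rV[R]_m}
    (d : seq nat) (E : seq (nat * nat)) (k : nat) (theta : seq nat) (l : seq (seq nat)) :
  root_system D -> simple_roots D P -> dynkin d E P -> check d E k theta l ->
  amazing D P = [set comb P c | c in [set` l]] /\ highest_root D P (comb P theta).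
Proof.
move=> rsD srP dynP /and5P[/eqP lastL r0 cartanM rootsL amazingL].
have [a a0 aE] := inner_scale rsD srP dynP r0 cartanM.
split.
  exact: (amazing_levels rsD srP dynP lastL r0 cartanM a0 aE rootsL amazingL).
exact: (highest_levels rsD srP dynP lastL r0 cartanM a0 aE rootsL).
Qed.

(** The left-nested unions are the shape to which the notation for explicit finite sets unfolds. *)
Lemma image_seq_cons {T : eqType} {U : Type} (f : T -> U) (x : T) (s : seq T) :
  [set f c | c in [set` x :: s]] = foldl (fun A y => A `|` [set f y]) [set f x] s.
Proof.
elim/last_ind: s => [|s y IH].
  apply/seteqP; split=> [v [c] /=|v ->]; first by rewrite inE => /eqP -> ->.
  by exists x; rewrite //= inE.
rewrite foldl_rcons -IH; apply/seteqP; split=> [v [c] /=|v].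
  rewrite inE mem_rcons inE => /or3P[/eqP ->|/eqP ->|cs] <-; last 2 first.
  - by right.
  - by left; exists c => //=; rewrite inE cs orbT.
  by left; exists x => //=; rewrite inE eqxx.
move=> [[c /=]|->]; last by exists y => //=; rewrite inE mem_rcons mem_head orbT.
by rewrite inE => cs <-; exists c => //=; rewrite inE mem_rcons inE orbCA cs orbT.
Qed.

(** In this and the following checks the number of layers is the height of theta, one less than the
    Coxeter number; each raising reflection increases the height, so this is always enough. *)
Lemma check_E6 : check (nseq 6 1%N) ((3, 6)%N :: chain 5) 11 [:: 1; 2; 3; 2; 1; 2]%N
  [:: [:: 1; 0; 0; 0; 0; 0]; [:: 0; 0; 0; 0; 1; 0]; [:: 1; 1; 1; 1; 1; 0];
      [:: 1; 2; 2; 1; 0; 1]; [:: 0; 1; 2; 2; 1; 1]; [:: 1; 1; 2; 2; 1; 1];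
      [:: 1; 2; 2; 1; 1; 1]; [:: 1; 2; 2; 2; 1; 1]; [:: 1; 2; 3; 2; 1; 1];
      [:: 1; 2; 3; 2; 1; 2]]%N.
Proof. by vm_compute. Qed.

Lemma check_E7 : check (nseq 7 1%N) ((4, 7)%N :: chain 6) 17 [:: 1; 2; 3; 4; 3; 2; 2]%N
  [:: [:: 1; 0; 0; 0; 0; 0; 0]; [:: 1; 2; 2; 2; 1; 0; 1]; [:: 0; 1; 2; 3; 2; 1; 2];
      [:: 1; 1; 2; 3; 2; 1; 2]; [:: 1; 2; 3; 3; 2; 1; 1]; [:: 1; 2; 2; 3; 2; 1; 2];
      [:: 1; 2; 3; 3; 2; 1; 2]; [:: 1; 2; 3; 4; 2; 1; 2]; [:: 1; 2; 3; 4; 3; 1; 2];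
      [:: 1; 2; 3; 4; 3; 2; 2]]%N.
Proof. by vm_compute. Qed.

Lemma check_E8 : check (nseq 8 1%N) ((5, 8)%N :: chain 7) 29
  [:: 2; 3; 4; 5; 6; 4; 2; 3]%N
  [:: [:: 0; 1; 2; 3; 4; 3; 2; 2]; [:: 1; 2; 3; 4; 5; 3; 1; 3];
      [:: 1; 2; 3; 4; 5; 4; 2; 2]; [:: 1; 2; 3; 4; 5; 3; 2; 3];
      [:: 1; 2; 3; 4; 5; 4; 2; 3]; [:: 1; 2; 3; 4; 6; 4; 2; 3];
      [:: 1; 2; 3; 5; 6; 4; 2; 3]; [:: 1; 2; 4; 5; 6; 4; 2; 3];
      [:: 1; 3; 4; 5; 6; 4; 2; 3]; [:: 2; 3; 4; 5; 6; 4; 2; 3]]%N.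
Proof. by vm_compute. Qed.

Lemma check_F4 : check [:: 1; 1; 2; 2]%N (chain 4) 11 [:: 2; 4; 3; 2]%N
  [:: [:: 2; 2; 1; 0]; [:: 2; 4; 2; 1]; [:: 2; 4; 3; 1]; [:: 2; 4; 3; 2]]%N.
Proof. by vm_compute. Qed.

Lemma check_G2 : check [:: 1; 3]%N (chain 2) 5 [:: 3; 2]%N [:: [:: 3; 1]; [:: 3; 2]]%N.
Proof. by vm_compute. Qed.

Theorem theorem3p1 (R : realFieldType) (m : nat) (D : set 'rV[R]_m)
    (P : seq 'rV[R]_m) (irrD : irreducible_root_system D P) :
  (forall (n : nat) (e : nat -> 'rV[R]_m),
     (1 <= n)%N -> coordinates n.+1 e -> P = simple_A e n ->
     amazing D P = positive D P /\
     positive D P =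
       [set v | exists i j, (1 <= i < j)%N /\ (j <= n.+1)%N /\ v = e i - e j])
  /\
  (forall (n : nat) (e : nat -> 'rV[R]_m),
     (3 <= n)%N -> coordinates n e -> P = simple_B e n ->
     amazing D P =
       [set e 1%N - e 2%N]
       `|` [set e 1%N + e j | j in [set j : nat | (2 <= j <= n)%N]]
       `|` [set e i + e i.+1 | i in [set i : nat | (2 <= i <= n.-1)%N]])
  /\
  (forall (n : nat) (e : nat -> 'rV[R]_m),
     (2 <= n)%N -> coordinates n e -> P = simple_C e n ->
     amazing D P = long_positive D P /\
     long_positive D P = [set e i *+ 2 | i in [set i : nat | (1 <= i <= n)%N]])
  /\
  (forall (n : nat) (e : nat -> 'rV[R]_m),
     (4 <= n)%N -> coordinates n e -> P = simple_D e n ->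
     amazing D P =
       [set e 1%N - e 2%N; e 1%N - e n; e n.-1 - e n]
       `|` [set e 1%N + e j | j in [set j : nat | (2 <= j <= n)%N]]
       `|` [set e i + e i.+1 | i in [set i : nat | (2 <= i <= n.-1)%N]])
  /\
  (type_E6 P ->
     amazing D P =
       [set P`_0; P`_4;
            comb P [:: 1; 1; 1; 1; 1; 0]%N; comb P [:: 1; 2; 2; 1; 0; 1]%N;
            comb P [:: 0; 1; 2; 2; 1; 1]%N; comb P [:: 1; 1; 2; 2; 1; 1]%N;
            comb P [:: 1; 2; 2; 1; 1; 1]%N; comb P [:: 1; 2; 2; 2; 1; 1]%N;
            comb P [:: 1; 2; 3; 2; 1; 1]%N; comb P [:: 1; 2; 3; 2; 1; 2]%N] /\
     highest_root D P (comb P [:: 1; 2; 3; 2; 1; 2]%N))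
  /\
  (type_E7 P ->
     amazing D P =
       [set P`_0;
            comb P [:: 1; 2; 2; 2; 1; 0; 1]%N; comb P [:: 0; 1; 2; 3; 2; 1; 2]%N;
            comb P [:: 1; 1; 2; 3; 2; 1; 2]%N; comb P [:: 1; 2; 3; 3; 2; 1; 1]%N;
            comb P [:: 1; 2; 2; 3; 2; 1; 2]%N; comb P [:: 1; 2; 3; 3; 2; 1; 2]%N;
            comb P [:: 1; 2; 3; 4; 2; 1; 2]%N; comb P [:: 1; 2; 3; 4; 3; 1; 2]%N;
            comb P [:: 1; 2; 3; 4; 3; 2; 2]%N] /\
     highest_root D P (comb P [:: 1; 2; 3; 4; 3; 2; 2]%N))
  /\
  (type_E8 P ->
     amazing D P =
       [set comb P [:: 0; 1; 2; 3; 4; 3; 2; 2]%N;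
            comb P [:: 1; 2; 3; 4; 5; 3; 1; 3]%N;
            comb P [:: 1; 2; 3; 4; 5; 4; 2; 2]%N;
            comb P [:: 1; 2; 3; 4; 5; 3; 2; 3]%N;
            comb P [:: 1; 2; 3; 4; 5; 4; 2; 3]%N;
            comb P [:: 1; 2; 3; 4; 6; 4; 2; 3]%N;
            comb P [:: 1; 2; 3; 5; 6; 4; 2; 3]%N;
            comb P [:: 1; 2; 4; 5; 6; 4; 2; 3]%N;
            comb P [:: 1; 3; 4; 5; 6; 4; 2; 3]%N;
            comb P [:: 2; 3; 4; 5; 6; 4; 2; 3]%N] /\
     highest_root D P (comb P [:: 2; 3; 4; 5; 6; 4; 2; 3]%N))
  /\
  (type_F4 P ->
     amazing D P =
       [set comb P [:: 2; 2; 1; 0]%N; comb P [:: 2; 4; 2; 1]%N;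
            comb P [:: 2; 4; 3; 1]%N; comb P [:: 2; 4; 3; 2]%N] /\
     highest_root D P (comb P [:: 2; 4; 3; 2]%N))
  /\
  (type_G2 P ->
     amazing D P = [set comb P [:: 3; 1]%N; comb P [:: 3; 2]%N] /\
     highest_root D P (comb P [:: 3; 2]%N)).
Proof.
have [rsD _ srP] := irrD.
split; [|split; [|split; [|split; [|split; [|split; [|split; [|split]]]]]]].
- move=> n e n1 [a a0 ee] PE; rewrite PE in srP *.
  exact: amazing_A rsD srP n1 a0 ee.
- move=> n e n3 [a a0 ee] PE.
  have PE1 : P = simple_BCD e n 1 by rewrite PE /simple_BCD /last_simple mulr1n.
  rewrite PE1 in srP *; apply: (amazing_B rsD srP _ isT a0 ee isT).
  by rewrite addn1.
- move=> n e n2 [a a0 ee] PE; rewrite (PE : P = simple_BCD e n 2) in srP *.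
  exact: amazing_C rsD srP n2 a0 ee.
- move=> n e n4 [a a0 ee] PE; rewrite (PE : P = simple_BCD e n 0) in srP *.
  apply: (amazing_D rsD srP _ isT a0 ee isT).
  by rewrite addn0.
- move=> tP; have [-> hi] := amazing_check _ _ _ _ _ rsD srP tP check_E6.
  split=> //; rewrite image_seq_cons /=; have [sP _] := tP.
  (* The statement writes the amazing simple roots as entries of [P], the computed list as unit
     coefficient vectors. *)
  by rewrite -(comb_simple P 0) ?sP // -(comb_simple P 4) ?sP.
- move=> tP; have [-> hi] := amazing_check _ _ _ _ _ rsD srP tP check_E7.
  split=> //; rewrite image_seq_cons /=; have [sP _] := tP.
  by rewrite -(comb_simple P 0) ?sP.
- move=> tP; have [-> hi] := amazing_check _ _ _ _ _ rsD srP tP check_E8.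
  by rewrite image_seq_cons.
- move=> tP; have [-> hi] := amazing_check _ _ _ _ _ rsD srP tP check_F4.
  by rewrite image_seq_cons.
- move=> tP; have [-> hi] := amazing_check _ _ _ _ _ rsD srP tP check_G2.
  by rewrite image_seq_cons.
Qed.
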